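(* For every $1<p<\infty$, one has $\mathrm{Cont}_p(\mathrm{WOT},\mathrm{SOT})=\mathcal{I}_p$ and $\mathrm{Cont}_p(\mathrm{WOT},\mathrm{SOT}^* )=\mathcal{U}_p$. In particular, for every $1<p<\infty$, the sets $\mathcal{I}_p$ and $\mathcal{U}_p$ are dense $G_\delta$ in $(\mathcal{C}_p,\mathrm{WOT})$.
   Context: $L^p[0,1]$ is the complex $L^p$-space of Lebesgue measure. An operator $T$ on it is positive if $Tf\ge0$ whenever $f\ge0$. $\mathcal{C}_p$, $\mathcal{I}_p$, $\mathcal{U}_p$ denote the sets of positive contractions, positive (linear) isometries, and positive invertible (surjective) isometries of $L^p[0,1]$. WOT and SOT are the weak and strong operator topologies; $\mathrm{SOT}^*$ is the topology in which $T_\alpha\to T$ iff $T_\alpha\to T$ strongly on $L^p[0,1]$ and $T_\alpha^*\to T^*$ strongly on $L^{p'}[0,1]$, $1/p+1/p'=1$. For topologies $\tau_1,\tau_2$ among these, $\mathrm{Cont}_p(\tau_1,\tau_2)$ is the set of points of continuity of the identity map from $(\mathcal{C}_p,\tau_1)$ onto $(\mathcal{C}_p,\tau_2)$. *)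

(* Defs.v *)
From HB Require Import structures.
From mathcomp Require Import all_boot all_order all_algebra.
From mathcomp Require Import generic_quotient ring_quotient complex.
From mathcomp Require Import all_classical all_reals all_analysis.
From mathcomp Require Import measurable_realfun ess_sup_inf borel_hierarchy.

Set Implicit Arguments.
Unset Strict Implicit.
Unset Printing Implicit Defensive.

Import Order.TTheory GRing.Theory Num.Theory.
Import numFieldNormedType.Exports.
Import Normc.

Local Open Scope classical_set_scope.
Local Open Scope ring_scope.
Local Open Scope complex_scope.
Local Open Scope quotient_scope.

Section ComplexLfun.
Context d (T : measurableType d) (R : realType).
Variables (mu : {measure set T -> \bar R}) (p : \bar R).

Definition cmeasurable (f : T -> R[i]) :=
  measurable_fun [set: T] (@complex.Re R \o f) /\
  measurable_fun [set: T] (@complex.Im R \o f).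

Definition cLnorm (f : T -> R[i]) : \bar R :=
  ('N[mu]_p[EFin \o (@normc R \o f)])%E.

Definition cLfun : {pred T -> R[i]} :=
  mem [set f : T -> R[i] | cmeasurable f /\ (cLnorm f < +oo)%E].

End ComplexLfun.

Section ComplexLfunTheory.
Context d (T : measurableType d) (R : realType).
Variables (mu : {measure set T -> \bar R}) (p : \bar R) (p1 : (1 <= p)%E).
Local Notation C := R[i].

Lemma Re_scaleD (a u v : C) : complex.Re (a * u + v) =
  complex.Re a * complex.Re u - complex.Im a * complex.Im u + complex.Re v.
Proof. by case: a u v => [? ?] [? ?] [? ?]. Qed.

Lemma Im_scaleD (a u v : C) : complex.Im (a * u + v) =
  complex.Re a * complex.Im u + complex.Im a * complex.Re u + complex.Im v.
Proof. by case: a u v => [? ?] [? ?] [? ?]. Qed.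

Lemma cmeasurable_lin (a : C) (f g : T -> C) :
  cmeasurable f -> cmeasurable g -> cmeasurable (fun x => a * f x + g x).
Proof.
move=> [f1 f2] [g1 g2]; split.
- rewrite (_ : _ \o _ = (fun x => complex.Re a * complex.Re (f x)
      - complex.Im a * complex.Im (f x) + complex.Re (g x))); last first.
    by apply/funext => x; exact: Re_scaleD.
  by apply: measurable_funD => //; apply: measurable_funB;
    apply: measurable_funM => //; exact: measurable_cst.
- rewrite (_ : _ \o _ = (fun x => complex.Re a * complex.Im (f x)
      + complex.Im a * complex.Re (f x) + complex.Im (g x))); last first.
    by apply/funext => x; exact: Im_scaleD.
  by apply: measurable_funD => //; apply: measurable_funD;
    apply: measurable_funM => //; exact: measurable_cst.
Qed.

Lemma normc_ge0 (x : C) : 0 <= normc x.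
Proof. by case: x => a b /=; exact: sqrtr_ge0. Qed.

Lemma measurable_normc (f : T -> C) :
  cmeasurable f -> measurable_fun [set: T] (@normc R \o f).
Proof.
move=> [f1 f2].
rewrite (_ : _ \o _ = @Num.sqrt R \o
    (fun x => complex.Re (f x) ^+ 2 + complex.Im (f x) ^+ 2)); last first.
  by apply/funext => x /=; case: (f x).
apply: measurableT_comp.
  by apply: continuous_measurable_fun => x; exact: sqrt_continuous.
by apply: measurable_funD; apply: measurable_funX.
Qed.

Lemma cLnorm_ge0 (f : T -> C) : (0 <= cLnorm mu p f)%E.
Proof. exact: Lnorm_ge0. Qed.

Lemma le_Lnorm (u v : T -> R) :
  measurable_fun [set: T] u -> measurable_fun [set: T] v ->
  (forall x, 0 <= u x <= v x) ->
  ('N[mu]_p[EFin \o u] <= 'N[mu]_p[EFin \o v])%E.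
Proof.
move=> mu' mv uv; rewrite unlock; case: p p1 => [r r1| |//] /=.
  have r0 : 0 <= r by rewrite -lee_fin (le_trans _ r1)// lee01.
  apply: gt0_ler_poweR.
  - by rewrite invr_ge0.
  - by rewrite in_itv /= leey andbT integral_ge0// => x _; rewrite poweR_ge0.
  - by rewrite in_itv /= leey andbT integral_ge0// => x _; rewrite poweR_ge0.
  apply: ge0_le_integral => //.
  - apply/measurable_EFinP; apply: (measurableT_comp (measurable_powR _)).
    exact: measurableT_comp.
  - apply/measurable_EFinP; apply: (measurableT_comp (measurable_powR _)).
    exact: measurableT_comp.
  move=> x _; have /andP[u0 uvx] := uv x.
  rewrite lee_fin ge0_ler_powR ?nnegrE//.
  by rewrite !ger0_norm// (le_trans u0).
case: ifPn => // _ _; apply: le_ess_sup; apply: nearW => x /=.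
have /andP[u0 uvx] := uv x.
by rewrite lee_fin !ger0_norm// (le_trans u0).
Qed.

Lemma ae_eq_cLnorm (f g : T -> C) : cmeasurable f -> cmeasurable g ->
  {ae mu, forall x, f x = g x} -> cLnorm mu p f = cLnorm mu p g.
Proof.
move=> mf mg fg; rewrite /cLnorm unlock; case: p p1 => [r r1| |//] /=.
  congr poweR; apply: ae_eq_integral => //.
  - apply/measurable_EFinP; apply: (measurableT_comp (measurable_powR _)).
    by apply: measurableT_comp => //; exact: measurable_normc.
  - apply/measurable_EFinP; apply: (measurableT_comp (measurable_powR _)).
    by apply: measurableT_comp => //; exact: measurable_normc.
  - by apply: filterS fg => x fgx _ /=; rewrite fgx.
case: ifPn => // _ _; apply: eq_ess_sup.
by apply: filterS fg => x fgx /=; rewrite fgx.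
Qed.

Lemma cLnormD (f g : T -> C) : cmeasurable f -> cmeasurable g ->
  (cLnorm mu p (fun x => f x + g x)%R <= cLnorm mu p f + cLnorm mu p g)%E.
Proof.
move=> mf mg; have /measurable_normc mfg : cmeasurable (fun x => f x + g x).
  rewrite (_ : (fun x => _) = fun x => 1 * f x + g x); last first.
    by apply/funext => x; rewrite mul1r.
  exact: cmeasurable_lin.
apply: (@le_trans _ _
  ('N[mu]_p[EFin \o ((@normc R \o f) \+ (@normc R \o g))%R])%E).
  apply: le_Lnorm => //; first by apply: measurable_funD; exact: measurable_normc.
  by move=> x /=; rewrite normc_ge0 le_normcD.
by apply: eminkowski => //; exact: measurable_normc.
Qed.

Lemma cLnorm_EFin (u : T -> R) : (forall x, 0 <= u x) ->
  cLnorm mu p (fun x => (u x)%:C) = ('N[mu]_p[EFin \o u])%E.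
Proof.
move=> u0; rewrite /cLnorm; apply: eq_Lnorm => x /=.
by rewrite expr0n/= addr0 sqrtr_sqr ger0_norm.
Qed.

Lemma cLnormZ (a : C) (f : T -> C) : cmeasurable f -> (cLnorm mu p f < +oo)%E ->
  cLnorm mu p (fun x => a * f x) = ((normc a)%:E * cLnorm mu p f)%E.
Proof.
move=> mf ff.
have lf : (@normc R \o f) \in Lfun mu p.
  by apply/andP; rewrite !inE/=; split => //; exact: measurable_normc.
have := LnormZ (Lfun_Sub p1 lf) (normc a).
rewrite ger0_norm ?normc_ge0// => <-; apply: eq_Lnorm => x /=.
by rewrite normcM.
Qed.

Lemma cmeasurable0 : cmeasurable (fun _ : T => 0 : C).
Proof. by split; exact: measurable_cst. Qed.

Lemma cLnorm0 : cLnorm mu p (fun=> 0) = 0%E.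
Proof.
rewrite /cLnorm (_ : _ \o _ = cst 0%E) ?Lnorm0 ?gt_eqF ?(lt_le_trans _ p1)//.
by apply/funext => x; congr EFin; exact: normc0.
Qed.

Lemma cLfun_submod_closed : submod_closed (cLfun mu p).
Proof.
split; first by rewrite inE; split; [exact: cmeasurable0|rewrite cLnorm0].
move=> a f g; rewrite !inE => -[mf ff] [mg fg].
split; first exact: cmeasurable_lin.
have maf : cmeasurable (fun x => a * f x).
  rewrite (_ : (fun x => _) = fun x => a * f x + 0); last first.
    by apply/funext => x; rewrite addr0.
  by apply: cmeasurable_lin => //; exact: cmeasurable0.
apply: (le_lt_trans (cLnormD maf mg)).
by rewrite lte_add_pinfty// cLnormZ// lte_mul_pinfty// lee_fin normc_ge0.
Qed.

End ComplexLfunTheory.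

(* The proof that 1 <= p is an index of these types because the vector space
   structure and the norm depend on it, as for LfunType in the library. *)
Definition cLfunType d (T : measurableType d) (R : realType)
    (mu : {measure set T -> \bar R}) (p : \bar R) (p1 : (1 <= p)%E) : Type :=
  {f : T -> R[i] | f \in cLfun mu p}.

Section ComplexLspace.
Context d (T : measurableType d) (R : realType).
Variables (mu : {measure set T -> \bar R}) (p : \bar R) (p1 : (1 <= p)%E).
Local Notation C := R[i].
Local Notation F := (cLfunType mu p1).

HB.instance Definition _ :=
  GRing.isSubmodClosed.Build _ _ (cLfun mu p) (cLfun_submod_closed mu p1).

HB.instance Definition _ := [isSub of F for @sval _ _].
HB.instance Definition _ := [Choice of F by <:].
HB.instance Definition _ := [SubChoice_isSubLmodule of F by <:].

Definition cnull : {pred F} :=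
  mem [set f : F | {ae mu, forall x, \val f x = 0}].

Lemma cnull_zmod_closed : zmod_closed cnull.
Proof.
split; first by rewrite inE; exact: aeW.
move=> f g; rewrite !inE => f0 g0.
apply: filterS2 f0 g0 => x f0 g0.
by rewrite raddfB -[LHS]/(\val f x - \val g x) f0 g0 subr0.
Qed.

HB.instance Definition _ := GRing.isZmodClosed.Build F cnull cnull_zmod_closed.

Definition cLspace : Type := Quotient.quot cnull.
HB.instance Definition _ := GRing.Zmodule.on cLspace.
HB.instance Definition _ := EqQuotient.on cLspace.


Definition cLscale (a : C) : cLspace -> cLspace := lift_op1 cLspace ( *:%R a).

Lemma pi_cLscale a : {morph \pi_cLspace : f / a *: f >-> cLscale a f}.
Proof.
move=> f; rewrite /cLscale; unlock; apply/eqP.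
rewrite -Quotient.idealrBE -scalerBr inE.
have : f - repr (\pi_cLspace f) \in cnull by rewrite Quotient.idealrBE reprK.
rewrite inE; apply: filterS => x h.
by rewrite linearZ -[LHS]/(a * \val (f - repr (\pi_cLspace f)) x) h mulr0.
Qed.

Lemma cLscaleA a b f : cLscale a (cLscale b f) = cLscale (a * b) f.
Proof. by rewrite -[f]reprK -!pi_cLscale scalerA. Qed.

Lemma cLscale1 : left_id 1 cLscale.
Proof. by move=> f; rewrite -[f]reprK -!pi_cLscale scale1r. Qed.

Lemma cLscaleDr : right_distributive cLscale +%R.
Proof.
move=> a f g; rewrite -[f]reprK -[g]reprK -!(rmorphD, raddfD).
by rewrite -!pi_cLscale scalerDr raddfD.
Qed.

Lemma cLscaleDl f : {morph cLscale^~ f : a b / a + b}.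
Proof. by move=> a b; rewrite -[f]reprK -!pi_cLscale scalerDl raddfD. Qed.

HB.instance Definition _ := GRing.Zmodule_isLmodule.Build C cLspace
  cLscaleA cLscale1 cLscaleDr cLscaleDl.

Definition cLspace_fun (f : cLspace) : T -> C := \val (repr f).

Definition cLspace_norm (f : cLspace) : C :=
  (fine (cLnorm mu p (cLspace_fun f)))%:C.

Lemma cLfunType_measurable (f : F) : cmeasurable (\val f).
Proof. by have := valP f; rewrite inE => -[]. Qed.

Lemma cLfunType_fin_num (f : F) : cLnorm mu p (\val f) \is a fin_num.
Proof.
by have := valP f; rewrite inE => -[_ ?]; rewrite ge0_fin_numE// cLnorm_ge0.
Qed.

Lemma cLspace_fun_pi (f : F) :
  {ae mu, forall x, cLspace_fun (\pi_cLspace f) x = \val f x}.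
Proof.
have : f - repr (\pi_cLspace f) \in cnull by rewrite Quotient.idealrBE reprK.
rewrite inE; apply: filterS => x; rewrite raddfB => /subr0_eq; exact: esym.
Qed.

Lemma cLspace_norm_pi (f : F) :
  cLspace_norm (\pi_cLspace f) = (fine (cLnorm mu p (\val f)))%:C.
Proof.
congr (fine _)%:C; apply: ae_eq_cLnorm => //; last exact: cLspace_fun_pi.
- exact: cLfunType_measurable.
- exact: cLfunType_measurable.
Qed.

Lemma ler_cLspace_normD (f g : cLspace) :
  cLspace_norm (f + g) <= cLspace_norm f + cLspace_norm g.
Proof.
rewrite -[f]reprK -[g]reprK -raddfD !cLspace_norm_pi -rmorphD lecR.
rewrite -fineD ?cLfunType_fin_num// fine_le ?fin_numD ?cLfunType_fin_num//.
by apply: cLnormD => //; exact: cLfunType_measurable.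
Qed.

Lemma cLspace_normZ (a : C) (f : cLspace) :
  cLspace_norm (a *: f) = `|a| * cLspace_norm f.
Proof.
rewrite -[f]reprK -[_ *: _]/(cLscale a _) -pi_cLscale !cLspace_norm_pi.
rewrite (_ : `|a| = (normc a)%:C)// -rmorphM; congr _%:C.
rewrite -[normc a]/(fine (normc a)%:E) -fineM ?cLfunType_fin_num//.
congr fine; rewrite -cLnormZ//; first exact: cLfunType_measurable.
by rewrite -ge0_fin_numE ?cLfunType_fin_num// cLnorm_ge0.
Qed.

Lemma cLspace_norm_eq0 (f : cLspace) : cLspace_norm f = 0 -> f = 0.
Proof.
rewrite -[f]reprK cLspace_norm_pi => /(congr1 (@complex.Re R))/= nf0.
have {}nf0 : cLnorm mu p (\val (repr f)) = 0%E.
  by rewrite -[LHS]fineK ?cLfunType_fin_num// nf0.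
have := Lnorm_eq0_eq0 _ _ nf0 => /(_ _ (lt_le_trans lte01 p1)).
have mf : measurable_fun [set: T] (EFin \o (@normc R \o \val (repr f))).
  by apply/measurable_EFinP/measurable_normc/cLfunType_measurable.
move=> /(_ mf) f0.
rewrite -(raddf0 \pi_cLspace); apply/eqP; rewrite -Quotient.idealrBE subr0 inE.
by apply: filterS f0 => x /= /(_ I) [] /eq0_normc.
Qed.

HB.instance Definition _ := Lmodule_isNormed.Build C cLspace
  ler_cLspace_normD cLspace_normZ cLspace_norm_eq0.

End ComplexLspace.

Coercion cLspace_fun : cLspace >-> Funclass.

Section PositivityDuality.
Context d (T : measurableType d) (R : realType).
Variables (mu : {measure set T -> \bar R}).

(* The order of R[i] is the partial one: 0 <= z means that z is a nonnegative
   real number. *)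
Definition cLspace_ge0 (p : \bar R) (p1 : (1 <= p)%E) (f : cLspace mu p1) :=
  {ae mu, forall x, 0 <= f x}.

Definition positive_map (p : \bar R) (p1 : (1 <= p)%E)
    (A : cLspace mu p1 -> cLspace mu p1) :=
  forall f, cLspace_ge0 f -> cLspace_ge0 (A f).

(* The bilinear pairing, without complex conjugation, so that the adjoint below
   is the Banach space adjoint. *)
Definition cpairing (f g : T -> R[i]) : R[i] :=
  (\int[mu]_x complex.Re (f x * g x)) +i* (\int[mu]_x complex.Im (f x * g x)).

(* For q conjugate to p with 1 < p < +oo and mu finite, the Riesz representation
   theorem gives, for every bounded A and every g, exactly one h as below, so
   that the default value 0 is never used. *)
Definition cLadjoint (p q : \bar R) (p1 : (1 <= p)%E) (q1 : (1 <= q)%E)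
    (A : cLspace mu p1 -> cLspace mu p1) : cLspace mu q1 -> cLspace mu q1 :=
  fun g => xget 0 [set h : cLspace mu q1 |
    forall f : cLspace mu p1, cpairing (A f) g = cpairing f h].

End PositivityDuality.

Arguments cLadjoint {d T R mu p q p1} q1 A.

Section OperatorTopologies.
Context (K : numFieldType) (E F : normedModType K).

Record boundedOp := BoundedOp {
  bop_linear :> {linear E -> F} ;
  bop_continuous : continuous bop_linear }.

HB.instance Definition _ := gen_eqMixin boundedOp.
HB.instance Definition _ := gen_choiceMixin boundedOp.

End OperatorTopologies.

Definition dual_space (K : numFieldType) (E : normedModType K) :=
  boundedOp E K^o.

Definition WOT (K : numFieldType) (E F : normedModType K) :
    Topological (boundedOp E F) :=
  Topological.on (initial_topology (fun A : boundedOp E F =>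
    (fun xphi : E * dual_space F => xphi.2 (A xphi.1))
      : {ptws (E * dual_space F) -> K^o})).

Definition SOT (K : numFieldType) (E F : normedModType K) :
    Topological (boundedOp E F) :=
  Topological.on (initial_topology (fun A : boundedOp E F =>
    (A : E -> F) : {ptws E -> F})).

Arguments WOT {K E F}.
Arguments SOT {K E F}.

Definition topology_on (X : choiceType) (A : set X) (tau : Topological X) :
    topologicalType :=
  @set_type (Topological.Pack tau) A.

(* topology_on A tau1 and topology_on A tau2 have the same carrier, so the
   topologies of the source and target of the identity map must be explicit. *)
Definition identity_map (X : choiceType) (A : set X) (tau1 tau2 : Topological X) :
    topology_on A tau1 -> topology_on A tau2 :=
  fun x => x.

Definition cont_points (X : choiceType) (A : set X) (tau1 tau2 : Topological X) :
    set X :=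
  set_val @` [set x : topology_on A tau1 |
    @continuous_at (topology_on A tau1) (topology_on A tau2) x
      (@identity_map X A tau1 tau2)].

Definition dense_Gdelta_in (X : choiceType) (A : set X) (tau : Topological X)
    (S : set X) :=
  let S' : set (topology_on A tau) := set_val @^-1` S in
  dense S' /\ Gdelta S'.

Section Lp01.
Context (R : realType).

(* L^p[0,1] is obtained as L^p of the real line for Lebesgue measure restricted
   to [0,1]: the values outside [0,1] are forgotten in the a.e. classes. *)
Definition lebesgue01 : {measure set (measurableTypeR R) -> \bar R} :=
  mrestr lebesgue_measure (measurable_itv `[0%R, 1%R]).

Variables (p : R) (p1 : 1 < p).

Lemma exponent_ge1 : (1 <= p%:E)%E.
Proof. by rewrite lee_fin ltW. Qed.

Definition Lp01 : normedModType R[i] := cLspace lebesgue01 exponent_ge1.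

Definition Lp01' : normedModType R[i] :=
  cLspace lebesgue01 (hoelder_conj_ge1 exponent_ge1).

Definition SOTstar : Topological (boundedOp Lp01 Lp01) :=
  Topological.on (initial_topology (fun A : boundedOp Lp01 Lp01 =>
    ((A : Lp01 -> Lp01),
     (cLadjoint (hoelder_conj_ge1 exponent_ge1) (A : Lp01 -> Lp01)
       : Lp01' -> Lp01'))
    : ({ptws Lp01 -> Lp01} * {ptws Lp01' -> Lp01'})%type)).

Definition positive_contractions : set (boundedOp Lp01 Lp01) :=
  [set A : boundedOp Lp01 Lp01 |
    positive_map (A : Lp01 -> Lp01) /\ forall f, `|A f| <= `|f|].

Definition positive_isometries : set (boundedOp Lp01 Lp01) :=
  [set A : boundedOp Lp01 Lp01 |
    positive_map (A : Lp01 -> Lp01) /\ forall f, `|A f| = `|f|].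

Definition positive_invertible_isometries : set (boundedOp Lp01 Lp01) :=
  [set A : boundedOp Lp01 Lp01 |
    positive_isometries A /\ forall g, exists f, A f = g].

Definition Cont (tau1 tau2 : Topological (boundedOp Lp01 Lp01)) :
    set (boundedOp Lp01 Lp01) :=
  cont_points positive_contractions tau1 tau2.

End Lp01.

Arguments positive_contractions {R p} p1.
Arguments positive_isometries {R p} p1.
Arguments positive_invertible_isometries {R p} p1.
Arguments SOTstar {R p p1}.
Arguments Cont {R p} p1 tau1 tau2.

(* Main.v *)
(** The heart of the matter is that the positive invertible isometries are dense
    in the positive contractions for WOT.  Cut [0,1] into n+1 equal cells with
    indicators 1_i, and put t_ij = theta <T 1_i, 1_j> for i, j < n, theta < 1.  As
    theta T is a strict contraction, iterating the Schur test produces weights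
    c, b > 0 with sum_j b_j t_ij <= c_i^(p-1) / (n+1) and
    sum_i c_i t_ij <= b_j^(q-1) / (n+1).  Hence K_ij = c_i b_j t_ij can be
    completed, using the last cell as an extra row and column, to a matrix with
    marginals c_i^p / (n+1) and d_j^p / (n+1), where d_j = b_j^(q-1).  Moving
    affinely a subinterval of length K_ij / c_i^p of the i-th cell onto a
    subinterval of length K_ij / d_j^p of the j-th cell, with weight d_j / c_i,
    defines a positive invertible isometry U with <U 1_i, 1_j> = t_ij, and
    such U converge weakly to T by density of step functions.

    Continuity at an isometry is the Radon-Riesz property of L^p; the adjoint of
    an invertible isometry is an isometry of L^q, which gives SOT*.  Conversely
    density forces a continuity point T to be a limit of invertible isometries,
    so T is isometric, and for SOT* so is its adjoint; then T is onto, because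
    T f = h as soon as f norms T* g, where g norms h.  Finally { |T f| > a } and
    { |T* g| > a } are WOT-open, and countably many f, g suffice. *)

From HB Require Import structures.
Require Import Defs.
From mathcomp Require Import all_boot all_order all_algebra.
From mathcomp Require Import generic_quotient ring_quotient complex.
From mathcomp Require Import all_classical all_reals all_analysis.
From mathcomp Require Import measurable_realfun borel_hierarchy.
From mathcomp Require Import ring lra.

Set Implicit Arguments.
Unset Strict Implicit.
Unset Printing Implicit Defensive.

Import Order.TTheory GRing.Theory Num.Theory.
Import numFieldNormedType.Exports.
Import Normc.

Local Open Scope classical_set_scope.
Local Open Scope ring_scope.
Local Open Scope complex_scope.
Local Open Scope quotient_scope.

(** * The Radon-Riesz property of L^p *)

(** For an extremal pair of the bilinear form of [t], the two Schur inequalities would be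
    Euler-Lagrange equations, up to a factor. Since [theta < 1], inequalities with slack are reached
    in finitely many iterations, and no extremal pair has to be found. An isometry tolerates no
    slack. An affine piece of weight [w] preserves the p-norm only if [w ^ p] times the target
    length equals the source length, so the pieces must fill the cells exactly. The spare cell
    absorbs the slack; its source weight and its target weight are chosen separately, so the row and
    column deficits may have different totals. Its index is kept out of the step functions, which
    still become dense as the mesh tends to 0. Two analytic facts come first. Radon-Riesz is
    obtained by integrating a pointwise gap in Young's inequality, which for complex values must
    control both modulus and phase. Riesz representation, derived from Radon-Nikodym, is
    indispensable because WOT tests against all bounded functionals and the adjoint is a chosen
    solution of an equation. *)

Section ConjugateExponents.
Context (R : realType).
Implicit Types (p q r s x y : R).

(** The relation is written without inverses, a form in which [nra] and [lra] can use it. *)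
Definition conjugates p q := [/\ 1 < p, 1 < q & p * q = p + q].

Lemma conjugatesC p q : conjugates p q -> conjugates q p.
Proof. by case=> p1 q1 pq; split => //; rewrite mulrC addrC. Qed.

Lemma conjugates_gt1 p q : conjugates p q -> 1 < p.
Proof. by case. Qed.

Lemma conjugates_gt0 p q : conjugates p q -> 0 < p.
Proof. by move=> /conjugates_gt1; exact: lt_trans. Qed.

Lemma conjugates_inv p q : conjugates p q -> p^-1 + q^-1 = 1.
Proof.
case=> p1 q1 pq; have p0 : p != 0 by lra.
have q0 : q != 0 by lra.
have : p^-1 + q^-1 = (p + q) / (p * q) by field; rewrite p0 q0.
by move=> ->; rewrite -pq divff// mulf_neq0.
Qed.

Lemma one_powR x : 1 `^ x = 1 :> R.
Proof. by rewrite powR1. Qed.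

Lemma powR_conj p q x : conjugates p q -> (x `^ (p - 1)) `^ q = x `^ p.
Proof. by case=> p1 q1 pq; rewrite -powRrM; congr (_ `^ _); nra. Qed.

Lemma powR_conjK p q x : conjugates p q -> 0 <= x ->
  (x `^ (p - 1)) `^ (q - 1) = x.
Proof.
case=> p1 q1 pq x0; rewrite -powRrM (_ : _ * _ = 1) ?powRr1//; nra.
Qed.

Lemma powRB1 p x : 1 < p -> 0 <= x -> x `^ p = x * x `^ (p - 1).
Proof.
move=> p1 x0; have [->|xn0] := eqVneq x 0.
  by rewrite mul0r powR0//; lra.
rewrite -[X in X * _](powRr1 x0) -powRD; last by rewrite xn0 implybT.
by congr (_ `^ _); lra.
Qed.

(** The defect in Young's inequality for the product of [x] and 1. *)
Definition young_gap p q x := x `^ p / p + q^-1 - x.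

Lemma young_gap_ge0 p q x : conjugates p q -> 0 <= x -> 0 <= young_gap p q x.
Proof.
move=> pq x0; have [p1 q1 _] := pq.
have := @conjugate_powR R x 1 p q x0 ler01 (lt_trans ltr01 p1)
  (lt_trans ltr01 q1) (conjugates_inv pq).
by rewrite powR1 mulr1 mul1r /young_gap; lra.
Qed.

(** Strictness comes from squaring: the weak inequality at [a = sqrt x] is Bernoulli's
    [1 + p (a - 1) <= a ^ p], and its square beats the required bound by [p (p - 1) (a - 1) ^ 2]. If
    the left side of Bernoulli is negative, then [p x <= p a < p - 1] already suffices. *)
Lemma young_gap_gt0 p q x : conjugates p q -> 0 <= x < 1 -> 0 < young_gap p q x.
Proof.
move=> pq /andP[x0 x1]; have [p1 q1 pqe] := pq.
set a := Num.sqrt x; have a0 : 0 <= a by exact: sqrtr_ge0.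
have ax : a ^+ 2 = x by exact: sqr_sqrtr.
have a1 : a < 1 by rewrite -[ltRHS]sqrtr1 ltr_sqrt.
have := young_gap_ge0 pq a0; rewrite /young_gap.
have -> : x `^ p = (a `^ p) ^+ 2.
  by rewrite -ax expr2 powRM// -expr2.
have qE : q^-1 = 1 - p^-1 by rewrite -(conjugates_inv pq); lra.
rewrite qE; set A := a `^ p => bern.
have A0 : 0 <= A by exact: powR_ge0.
have {}bern : 1 + p * (a - 1) <= A.
  have : 0 <= p * (A / p + (1 - p^-1) - a) by rewrite mulr_ge0//; lra.
  have -> : p * (A / p + (1 - p^-1) - a) = A + p - 1 - p * a by field; lra.
  lra.
suff : 0 < A ^+ 2 + p - 1 - p * x.
  have -> : A ^+ 2 / p + (1 - p^-1) - x = (A ^+ 2 + p - 1 - p * x) / p.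
    by field; lra.
  by move=> h; rewrite divr_gt0//; lra.
rewrite -ax.
have [h|h] := leP 0 (1 + p * (a - 1)).
  have : (1 + p * (a - 1)) ^+ 2 <= A ^+ 2 by rewrite lerXn2r ?nnegrE.
  have : 0 < p * (p - 1) * (a - 1) ^+ 2.
    rewrite pmulr_rgt0 ?exprn_even_gt0//= ?subr_eq0 ?lt_eqF//.
    by rewrite mulr_gt0; lra.
  lra.
have : 0 <= p * a * (1 - a) by rewrite !mulr_ge0; lra.
have : 0 <= A ^+ 2 by exact: sqr_ge0.
lra.
Qed.

(** Young's inequality for [x] and [y ^ (p - 1)] is the tangent inequality at [y]; it leaves the
    difference of the gaps at least [(1 - y ^ (p - 1)) (y - x)]. *)
Lemma young_gap_decr p q x y : conjugates p q -> 0 <= x <= y -> y <= 1 ->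
  young_gap p q y <= young_gap p q x.
Proof.
move=> pq /andP[x0 xy] y1; have [p1 q1 _] := pq.
have y0 : 0 <= y by exact: le_trans xy.
have := @conjugate_powR R x (y `^ (p - 1)) p q x0 (powR_ge0 _ _)
  (lt_trans ltr01 p1) (lt_trans ltr01 q1) (conjugates_inv pq).
rewrite powR_conj// /young_gap.
have qE : q^-1 = 1 - p^-1 by rewrite -(conjugates_inv pq); lra.
rewrite qE mulrBr mulr1 [y `^ p]powRB1//.
have : y `^ (p - 1) <= 1.
  by rewrite -[leRHS](one_powR (p - 1)) ge0_ler_powR ?nnegrE//; lra.
set Y := y `^ _; set X := x `^ _ => Y1.
have : 0 <= (1 - Y) * (y - x) by rewrite mulr_ge0//; lra.
lra.
Qed.

(** Exchanging the exponents carries arguments above 1 to arguments below 1, where the gap is known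
    to be monotone. *)
Lemma young_gap_inv p q x : conjugates p q -> 0 < x ->
  young_gap p q x = x `^ p * young_gap q p ((x^-1) `^ (p - 1)).
Proof.
move=> pq x0; have [p1 q1 _] := pq.
rewrite /young_gap powR_conj// -[x^-1]powR_inv1 ?ltW// -!powRrM mulrBr mulrDr.
rewrite mulrA -!powRD ?(gt_eqF x0) ?implybT//.
rewrite (_ : p + -1 * p = 0); last by ring.
rewrite (_ : p + -1 * (p - 1) = 1); last by ring.
by rewrite powRr0 powRr1 ?ltW// mul1r [q^-1 + _]addrC.
Qed.

(** Below 1 monotonicity gives the bound, above 1 the exchange of exponents does. The halves in [c1]
    and [c2] come from [x ^ p + 1 <= 2 max(1, x ^ p)]. *)
Lemma young_gap_lb p q e : conjugates p q -> 0 < e < 1 ->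
  exists2 c, 0 < c & forall x, 0 <= x -> e <= `|x - 1| ->
    c * (x `^ p + 1) <= young_gap p q x.
Proof.
move=> pq /andP[e0 e1]; have [p1 q1 _] := pq.
pose t := ((1 + e)^-1) `^ (p - 1).
have i1 : 0 < (1 + e)^-1 < 1 by rewrite invr_gt0 invf_lt1; lra.
have t01 : 0 <= t < 1.
  rewrite powR_ge0/= -[ltRHS](one_powR (p - 1)) gt0_ltr_powR ?nnegrE//; lra.
pose c1 := young_gap p q (1 - e) / 2.
pose c2 := young_gap q p t / 2.
have c10 : 0 < c1 by rewrite divr_gt0// young_gap_gt0//; lra.
have c20 : 0 < c2 by rewrite divr_gt0// young_gap_gt0//; exact: conjugatesC.
exists (Num.min c1 c2); first by rewrite lt_min c10 c20.
move=> x x0 ex; have [x1|x1] := leP x 1.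
  have xe : x <= 1 - e by move: ex; rewrite ler0_norm; lra.
  have : young_gap p q (1 - e) <= young_gap p q x by rewrite young_gap_decr//; lra.
  have : x `^ p <= 1.
    by rewrite -[leRHS](one_powR p) ge0_ler_powR ?nnegrE//; lra.
  have : Num.min c1 c2 <= c1 by rewrite ge_min lexx.
  have := powR_ge0 x p.
  rewrite -[young_gap p q (1 - e)](@divfK _ 2)// -/c1.
  have : 0 < Num.min c1 c2 by rewrite lt_min c10 c20.
  nra.
have xe : 1 + e <= x by move: ex; rewrite ger0_norm; lra.
have xp : 0 < x by lra.
rewrite young_gap_inv//.
have : young_gap q p t <= young_gap q p ((x^-1) `^ (p - 1)).
  rewrite young_gap_decr//; first exact: conjugatesC; last by lra.
  rewrite powR_ge0/= ge0_ler_powR ?nnegrE ?invr_ge0//; try lra.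
  by rewrite lef_pV2// posrE; lra.
have : 1 <= x `^ p.
  by rewrite -[leLHS](one_powR p) ge0_ler_powR ?nnegrE//; lra.
have : Num.min c1 c2 <= c2 by rewrite ge_min lexx orbT.
rewrite -[young_gap q p t](@divfK _ 2)// -/c2.
have : 0 < Num.min c1 c2 by rewrite lt_min c10 c20.
nra.
Qed.

Lemma powRD_le p x y : 0 <= p -> 0 <= x -> 0 <= y ->
  (x + y) `^ p <= 2 `^ p * (x `^ p + y `^ p).
Proof.
move=> p0 x0 y0; wlog xy : x y x0 y0 / x <= y => [hw|].
  have [xy|/ltW yx] := leP x y; first exact: hw.
  by rewrite addrC [x `^ p + _]addrC; exact: hw.
rewrite (@le_trans _ _ ((2 * y) `^ p))//.
  by rewrite ge0_ler_powR ?nnegrE//; lra.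
by rewrite powRM// ler_pM2l ?powR_gt0// lerDr powR_ge0.
Qed.

End ConjugateExponents.

(** * Complex modulus, duality map and the quantitative Young inequality *)

Section ComplexModulus.
Context (R : realType).
Local Notation C := R[i].
Implicit Types (z u h : C) (p q : R).

Lemma sqr_normc z : normc z ^+ 2 = complex.Re z ^+ 2 + complex.Im z ^+ 2.
Proof. by case: z => a b /=; rewrite sqr_sqrtr// addr_ge0// sqr_ge0. Qed.

Lemma Re_le_normc z : complex.Re z <= normc z.
Proof.
rewrite (le_trans (ler_norm _))// -ler_sqr ?nnegrE ?normc_ge0//.
by rewrite sqr_normc real_normK ?num_real// lerDl sqr_ge0.
Qed.

Lemma abs_Re_le_normc z : `|complex.Re z| <= normc z.
Proof.
rewrite -ler_sqr ?nnegrE ?normc_ge0//.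
by rewrite sqr_normc real_normK ?num_real// lerDl sqr_ge0.
Qed.

Lemma abs_Im_le_normc z : `|complex.Im z| <= normc z.
Proof.
rewrite -ler_sqr ?nnegrE ?normc_ge0//.
by rewrite sqr_normc real_normK ?num_real// lerDr sqr_ge0.
Qed.

Lemma normc_real (x : R) : normc x%:C = `|x|.
Proof. by rewrite /= expr0n/= addr0 sqrtr_sqr. Qed.

Lemma normcN z : normc (- z) = normc z.
Proof. by case: z => a b /=; rewrite !sqrrN. Qed.

Lemma normc_conj z : normc (conjc z) = normc z.
Proof. by case: z => a b /=; rewrite sqrrN. Qed.

(* The duality map: [h * jmap p h = |h| ^ p]. *)
Definition jmap p h : C := (normc h `^ (p - 2))%:C * conjc h.

Lemma Re_jmap p u h : complex.Re (u * jmap p h) =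
  normc h `^ (p - 2) * (complex.Re u * complex.Re h + complex.Im u * complex.Im h).
Proof. by rewrite /jmap; case: u h => [a b] [c d] /=; ring. Qed.

Lemma normc_jmap p h : 1 < p -> normc (jmap p h) = normc h `^ (p - 1).
Proof.
move=> p1; rewrite /jmap normcM normc_real normc_conj ger0_norm ?powR_ge0//.
have [->|h0] := eqVneq h 0.
  by rewrite normc0 mulr0 powR0//; lra.
have nh0 : normc h != 0 by apply: contra_neq h0; exact: eq0_normc.
rewrite -[X in _ * X](powRr1 (normc_ge0 h)) -powRD ?nh0 ?implybT//.
by congr (_ `^ _); ring.
Qed.

Lemma mul_jmap p h : 1 < p -> h * jmap p h = (normc h `^ p)%:C.
Proof.
move=> p1; have [->|h0] := eqVneq h 0.
  by rewrite mul0r normc0 powR0//; lra.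
have nh0 : normc h != 0 by apply: contra_neq h0; exact: eq0_normc.
have -> : normc h `^ p = normc h `^ (p - 2) * normc h ^+ 2.
  rewrite -powR_mulrn ?normc_ge0// -powRD ?nh0 ?implybT//.
  by congr (_ `^ _); ring.
rewrite sqr_normc /jmap; case: h {h0 nh0} => a b /=.
apply/eqP; rewrite eq_complex /=; apply/andP; split; apply/eqP; ring.
Qed.

(** The case [h = 1] of the estimate below. The term in [eta] settles every [z] close to 1.
    Otherwise either the modulus of [z] is far from 1, and [young_gap_lb] applies, or the modulus is
    close to 1 and the phase must be off, which makes [r - Re z] large. *)
Lemma uniform_gap_one p q eta : conjugates p q -> 0 < eta ->
  exists2 K, 0 < K & forall z, normc (z - 1) `^ p <=
    K * (normc z `^ p / p + q^-1 - complex.Re z) + eta * (normc z `^ p + 1).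
Proof.
move=> pq eta0; have [p1 q1 _] := pq.
pose k := eta `^ p^-1; have k0 : 0 < k by exact: powR_gt0.
pose e := Num.min (2^-1) (k / 2).
have e2 : e <= 2^-1 by rewrite ge_min lexx.
have ek : e <= k / 2 by rewrite ge_min lexx orbT.
have e01 : 0 < e < 1.
  by rewrite lt_min invr_gt0 ltr0n divr_gt0//=; lra.
have [c1 c10 hc1] := young_gap_lb pq e01.
have p2 : 0 < 2 `^ p :> R by rewrite powR_gt0.
pose c2 := k ^+ 2 / 4 / (2 `^ p + 1).
have c20 : 0 < c2 by rewrite !divr_gt0 ?exprn_gt0//; lra.
pose c := Num.min c1 c2.
have c0 : 0 < c by rewrite lt_min c10 c20.
exists (2 `^ p / c); first by rewrite divr_gt0.
move=> z; set r := normc z; have r0 : 0 <= r by exact: normc_ge0.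
have rp0 : 0 <= r `^ p by exact: powR_ge0.
have rx : complex.Re z <= r by exact: Re_le_normc.
have psi0 := young_gap_ge0 pq r0.
have phi0 : 0 <= r `^ p / p + q^-1 - complex.Re z by move: psi0; rewrite /young_gap; lra.
have A0 : 0 <= normc (z - 1) by exact: normc_ge0.
have Kphi0 : 0 <= 2 `^ p / c * (r `^ p / p + q^-1 - complex.Re z).
  by rewrite mulr_ge0// divr_ge0// ltW.
have [h|h] := leP (normc (z - 1) `^ p) (eta * (r `^ p + 1)).
  by rewrite (le_trans h)// lerDr.
have Ap : normc (z - 1) `^ p <= 2 `^ p * (r `^ p + 1).
  rewrite -[X in _ <= _ * (_ + X)](one_powR p).
  apply: le_trans (powRD_le _ r0 ler01); last by lra.
  rewrite ge0_ler_powR ?nnegrE ?addr_ge0//; first lra.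
  rewrite (le_trans (le_normcD _ _))// lerD2l.
  by rewrite normcN (normc_real 1) normr1.
suff gap : c * (r `^ p + 1) <= r `^ p / p + q^-1 - complex.Re z.
  apply: (le_trans Ap); rewrite -[leLHS]addr0 lerD//; last first.
    by rewrite mulr_ge0// ?addr_ge0// ltW.
  rewrite -mulrA ler_pM2l// -(ler_pM2l c0) mulVKf ?gt_eqF//.
have cc1 : c <= c1 by rewrite ge_min lexx.
have cc2 : c <= c2 by rewrite ge_min lexx orbT.
have [he|he] := leP e `|r - 1|.
  have := hc1 _ r0 he; rewrite /young_gap.
  have : c * (r `^ p + 1) <= c1 * (r `^ p + 1) by rewrite ler_pM2r//; lra.
  lra.
have kA : k < normc (z - 1).
  rewrite -(@powRr1 _ (normc (z - 1)))// -(@mulfV _ p) ?powRrM; last by lra.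
  rewrite /k gt0_ltr_powR ?invr_gt0 ?nnegrE ?powR_ge0//; first lra.
    exact: ltW.
  apply: le_lt_trans h.
  have : 0 <= eta * r `^ p by rewrite mulr_ge0// ltW.
  by lra.
have k2 : k ^+ 2 < normc (z - 1) ^+ 2 by rewrite ltrXn2r ?nnegrE// ltW.
(* The modulus and phase contributions to the distance. The first is at most [k ^ 2 / 4] since
   [e <= k / 2], so the phase term exceeds [3 k ^ 2 / 4]. *)
have AE : normc (z - 1) ^+ 2 = (r - 1) ^+ 2 + 2 * (r - complex.Re z).
  have := sqr_normc z; rewrite -/r sqr_normc => rE.
  rewrite !raddfB/= subr0 !sqrrB rE; ring.
have r2 : (r - 1) ^+ 2 <= (k / 2) ^+ 2.
  by rewrite -real_normK ?num_real// lerXn2r ?nnegrE ?divr_ge0//; lra.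
have rle2 : r <= 2 by move: he; rewrite ltr_norml; lra.
have : r `^ p <= 2 `^ p by rewrite ge0_ler_powR ?nnegrE//; lra.
move: psi0; rewrite /young_gap => psi0 rp2.
have : c * (r `^ p + 1) <= c2 * (2 `^ p + 1) by rewrite ler_pM//; lra.
have -> : c2 * (2 `^ p + 1) = k ^+ 2 / 4 by rewrite /c2 divfK//; lra.
move: AE k2 r2; rewrite expr_div_n; lra.
Qed.

(* A quantitative form of the equality case of Young's inequality; integrated,
   it replaces uniform convexity. *)
Lemma uniform_gap p q eta : conjugates p q -> 0 < eta ->
  exists2 K, 0 < K & forall u h, normc (u - h) `^ p <=
    K * (normc u `^ p / p + normc h `^ p / q - complex.Re (u * jmap p h))
    + eta * (normc u `^ p + normc h `^ p).
Proof.
move=> pq eta0; have [p1 q1 _] := pq.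
have [K K0 hK] := uniform_gap_one pq eta0.
(* The alternative [p] serves [h = 0], where the bracket is just [|u| ^ p / p]; for other [h] the
   estimate at [u / h] is rescaled. *)
exists (Num.max K p) => [|u h]; first by rewrite lt_max K0.
have [->|h0] := eqVneq h 0.
  rewrite subr0 normc0 Re_jmap/= !mulr0 addr0 mulr0 subr0 powR0; last by lra.
  rewrite mul0r !addr0 -[leLHS]addr0 lerD ?mulr_ge0 ?powR_ge0//; last exact: ltW.
  rewrite mulrCA -[leLHS]mulr1 ler_wpM2l ?powR_ge0// ler_pdivlMr ?mul1r; last by lra.
  by rewrite le_max lexx orbT.
have nh0 : 0 < normc h.
  rewrite lt_neqAle normc_ge0 andbT eq_sym; apply: contra_neq h0; exact: eq0_normc.
have := hK (u / h).
have hp : 0 < normc h `^ p by rewrite powR_gt0.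
rewrite -(ler_pM2r hp) -powRM ?normc_ge0// -normcM mulrBl divfK// mul1r.
move=> /le_trans; apply.
have uE : normc (u / h) `^ p * normc h `^ p = normc u `^ p.
  by rewrite -powRM ?normc_ge0// -normcM divfK.
have ReE : complex.Re (u / h) * normc h `^ p = complex.Re (u * jmap p h).
  have -> : u * jmap p h = u / h * (normc h `^ p)%:C by rewrite -mul_jmap// mulrA divfK.
  by case: (u / h) => a b /=; ring.
have phi0 : 0 <= normc u `^ p / p + normc h `^ p / q - complex.Re (u * jmap p h).
  rewrite -uE -ReE.
  have := young_gap_ge0 pq (normc_ge0 (u / h)); rewrite /young_gap.
  have := Re_le_normc (u / h) => a1 a2.
  have : 0 <= (normc (u / h) `^ p / p + q^-1 - complex.Re (u / h)) * normc h `^ p.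
    by rewrite mulr_ge0 ?powR_ge0//; lra.
  lra.
rewrite mulrDl -!mulrA !mulrDl mul1r mulNr uE ReE.
rewrite mulrAC uE [q^-1 * _]mulrC lerD2r.
by rewrite ler_wpM2r// le_max lexx.
Qed.

End ComplexModulus.

(** * Functions with integrable p-th power *)

Section LpFunctions.
Context d (T : measurableType d) (R : realType).
Variables (mu : {measure set T -> \bar R}).
Local Notation C := R[i].
Local Notation Rint f := (mu.-integrable [set: T] (EFin \o f)).

Lemma Rint_le (f g : T -> R) : measurable_fun [set: T] f ->
  (forall x, `|f x| <= g x) -> Rint g -> Rint f.
Proof.
move=> mf fg ig; apply: (le_integrable measurableT _ _ ig).
  exact/measurable_EFinP.
move=> x _ /=; by rewrite lee_fin (le_trans (fg x))// ler_norm.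
Qed.

Lemma measurable_normc_powR (f : T -> C) (p : R) : cmeasurable f ->
  measurable_fun [set: T] (fun x => normc (f x) `^ p).
Proof.
move=> mf; apply: (measurableT_comp (measurable_powR p)).
exact: measurable_normc.
Qed.

Lemma integral_normc_powR (f : T -> C) (p : R) (p0 : p != 0) :
  (cLnorm mu p%:E f `^ p)%E = (\int[mu]_x (normc (f x) `^ p)%:E)%E.
Proof.
rewrite /cLnorm (powR_Lnorm mu _ p0); apply: eq_integral => x _.
by rewrite -[(EFin \o _) x]/((normc (f x))%:E) gee0_abs ?lee_fin ?normc_ge0.
Qed.

Lemma cLfunP (f : T -> C) (p : R) : 0 < p ->
  (f \in cLfun mu p%:E) <->
  cmeasurable f /\ Rint (fun x => normc (f x) `^ p).
Proof.
move=> p0; rewrite inE /=; split => -[mf h]; split => //.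
  apply/integrableP; split.
    exact/measurable_EFinP/measurable_normc_powR.
  under eq_integral do rewrite /= ger0_norm ?powR_ge0//.
  rewrite -integral_normc_powR ?gt_eqF//.
  by rewrite poweR_lty.
move/integrableP : h => [_].
under eq_integral do rewrite /= ger0_norm ?powR_ge0//.
rewrite -integral_normc_powR ?gt_eqF//.
have := Lnorm_ge0 mu p%:E (EFin \o (@normc R \o f)); rewrite -/(cLnorm mu p%:E f).
case: (cLnorm _ _ _) => [r _ _|_|]; first exact: ltry.
  by rewrite /poweR gt_eqF.
by rewrite leNgt ltNyr.
Qed.

(** Real-valued, for real arithmetic; [fine] sends an infinite norm to 0, whence the membership
    hypotheses in the lemmas on it. *)
Definition nrm (P : \bar R) (f : T -> C) : R := fine (cLnorm mu P f).

Lemma nrm_ge0 P f : 0 <= nrm P f.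
Proof. by rewrite fine_ge0// cLnorm_ge0. Qed.

Lemma nrmE P f : f \in cLfun mu P -> cLnorm mu P f = (nrm P f)%:E.
Proof. by rewrite inE => -[_ h]; rewrite /nrm fineK// ge0_fin_numE// cLnorm_ge0. Qed.

Lemma nrm_powR (p : R) f : 0 < p -> f \in cLfun mu p%:E ->
  nrm p%:E f `^ p = \int[mu]_x (normc (f x) `^ p).
Proof.
move=> p0 h; rewrite /Rintegral -integral_normc_powR ?gt_eqF//.
by rewrite nrmE.
Qed.

Lemma cLfun_lin P (a : C) (f g : T -> C) : (1 <= P)%E ->
  f \in cLfun mu P -> g \in cLfun mu P ->
  (fun x => a * f x + g x) \in cLfun mu P.
Proof.
by move=> P1 hf hg; have [_ /(_ a f g hf hg)] := cLfun_submod_closed mu P1.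
Qed.

Lemma cLfunD P (f g : T -> C) : (1 <= P)%E ->
  f \in cLfun mu P -> g \in cLfun mu P ->
  (fun x => f x + g x) \in cLfun mu P.
Proof.
move=> P1 hf hg; have := cLfun_lin 1 P1 hf hg.
by under eq_fun do rewrite mul1r.
Qed.

Lemma cLfun0 P : (1 <= P)%E -> (fun=> 0) \in cLfun mu P.
Proof. by move=> P1; have [] := cLfun_submod_closed mu P1. Qed.

Lemma cLfunZ P (a : C) (f : T -> C) : (1 <= P)%E ->
  f \in cLfun mu P -> (fun x => a * f x) \in cLfun mu P.
Proof.
move=> P1 hf; have := cLfun_lin a P1 hf (cLfun0 P1).
by under eq_fun do rewrite addr0.
Qed.

Lemma cLfunB P (f g : T -> C) : (1 <= P)%E ->
  f \in cLfun mu P -> g \in cLfun mu P ->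
  (fun x => f x - g x) \in cLfun mu P.
Proof.
move=> P1 hf hg; have := cLfun_lin (-1) P1 hg hf.
by under eq_fun do rewrite mulN1r addrC.
Qed.

Lemma cLfun_cmeasurable P f : f \in cLfun mu P -> cmeasurable f.
Proof. by rewrite inE => -[]. Qed.

Lemma nrmD P f g : (1 <= P)%E -> f \in cLfun mu P -> g \in cLfun mu P ->
  nrm P (fun x => f x + g x) <= nrm P f + nrm P g.
Proof.
move=> P1 hf hg; rewrite -lee_fin EFinD -!nrmE//; last exact: cLfunD.
by apply: cLnormD => //; [exact: (cLfun_cmeasurable hf)|exact: (cLfun_cmeasurable hg)].
Qed.

Lemma nrmZ P a f : (1 <= P)%E -> f \in cLfun mu P ->
  nrm P (fun x => a * f x) = normc a * nrm P f.
Proof.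
move=> P1 hf; apply: EFin_inj; rewrite EFinM -!nrmE//; last exact: cLfunZ.
by move: hf; rewrite inE => -[mf hf]; rewrite cLnormZ.
Qed.

Lemma ae_eq_nrm P f g : (1 <= P)%E -> cmeasurable f -> cmeasurable g ->
  {ae mu, forall x, f x = g x} -> nrm P f = nrm P g.
Proof. by move=> P1 mf mg fg; rewrite /nrm (ae_eq_cLnorm P1 mf mg fg). Qed.

Lemma cLfun_ae P f g : (1 <= P)%E -> cmeasurable g ->
  {ae mu, forall x, f x = g x} -> f \in cLfun mu P -> g \in cLfun mu P.
Proof.
move=> P1 mg fg; rewrite !inE => -[mf hf]; split => //.
by rewrite -(ae_eq_cLnorm P1 mf mg fg).
Qed.

Lemma cLfun_dom (p : R) f (g : T -> R) : 0 < p -> cmeasurable f ->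
  (forall x, normc (f x) `^ p <= g x) -> Rint g -> f \in cLfun mu p%:E.
Proof.
move=> p0 mf fg ig; apply/cLfunP => //; split => //.
apply: Rint_le ig => //; first exact: measurable_normc_powR.
by move=> x; rewrite ger0_norm ?powR_ge0.
Qed.

Lemma nrm_le_dom (p : R) f (g : T -> R) : 0 < p -> cmeasurable f ->
  (forall x, normc (f x) `^ p <= g x) -> Rint g ->
  nrm p%:E f `^ p <= \int[mu]_x g x.
Proof.
move=> p0 mf fg ig; have hf := cLfun_dom p0 mf fg ig.
rewrite nrm_powR//; apply: le_Rintegral => //.
by have [_] := (cLfunP f p0).1 hf.
Qed.

Lemma cmeasurable_mul (f g : T -> C) : cmeasurable f -> cmeasurable g ->
  cmeasurable (fun x => f x * g x).
Proof.
move=> [f1 f2] [g1 g2]; split.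
- rewrite (_ : _ \o _ = (fun x => complex.Re (f x) * complex.Re (g x)
      - complex.Im (f x) * complex.Im (g x))); last first.
    by apply/funext => x /=; case: (f x) (g x) => [? ?] [? ?].
  by apply: measurable_funB; apply: measurable_funM.
- rewrite (_ : _ \o _ = (fun x => complex.Re (f x) * complex.Im (g x)
      + complex.Im (f x) * complex.Re (g x))); last first.
    by apply/funext => x /=; case: (f x) (g x) => [? ?] [? ?].
  by apply: measurable_funD; apply: measurable_funM.
Qed.

Lemma cmeasurable_sum (I : Type) (s : seq I) (F : I -> T -> C) :
  (forall i, cmeasurable (F i)) -> cmeasurable (fun x => \sum_(i <- s) F i x).
Proof.
move=> mF; elim: s => [|i s IH].
  by under eq_fun do rewrite big_nil; exact: cmeasurable0.
under eq_fun do rewrite big_cons -[F i _]mul1r.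
exact: cmeasurable_lin.
Qed.

Lemma cmeasurable_real (u : T -> R) : measurable_fun [set: T] u ->
  cmeasurable (fun x => (u x)%:C).
Proof. by move=> mu'; split => //; exact: measurable_cst. Qed.

Lemma cmeasurable_conj (f : T -> C) : cmeasurable f ->
  cmeasurable (fun x => conjc (f x)).
Proof.
move=> [f1 f2]; split.
  by rewrite (_ : _ \o _ = @complex.Re R \o f)//; apply/funext => x /=; case: (f x).
rewrite (_ : _ \o _ = \- (@complex.Im R \o f)); last first.
  by apply/funext => x /=; case: (f x).
exact: measurableT_comp.
Qed.

Lemma cmeasurable_jmap (p : R) (f : T -> C) : cmeasurable f ->
  cmeasurable (fun x => jmap p (f x)).
Proof.
move=> mf; apply: cmeasurable_mul; last exact: cmeasurable_conj.
exact/cmeasurable_real/measurable_normc_powR.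
Qed.

End LpFunctions.

(** * The pairing of L^p with L^q and the Radon-Riesz estimate *)

Section Pairing.
Context d (T : measurableType d) (R : realType).
Variables (mu : {measure set T -> \bar R}) (p q : R) (pq : conjugates p q).
Local Notation C := R[i].
Local Notation Rint f := (mu.-integrable [set: T] (EFin \o f)).
Local Notation Lp := (cLfun mu p%:E).
Local Notation Lq := (cLfun mu q%:E).

Let p0 := conjugates_gt0 pq.
Let q0 := conjugates_gt0 (conjugatesC pq).
Let p1 := conjugates_gt1 pq.

Lemma Rint_normcM f g : f \in Lp -> g \in Lq ->
  Rint (fun x => normc (f x) * normc (g x)).
Proof.
move=> /(cLfunP mu f p0)[mf If] /(cLfunP mu g q0)[mg Ig].
have I : Rint (fun x => p^-1 * normc (f x) `^ p + q^-1 * normc (g x) `^ q).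
  have := integrableD measurableT (integrableZl measurableT p^-1 If)
    (integrableZl measurableT q^-1 Ig).
  by apply: eq_integrable => // x _.
apply: Rint_le I.
  by apply: measurable_funM; exact: measurable_normc.
move=> x; rewrite ger0_norm ?mulr_ge0 ?normc_ge0//.
rewrite mulrC [q^-1 * _]mulrC [p^-1 * _]mulrC mulrC.
by apply: conjugate_powR; rewrite ?normc_ge0//; exact: conjugates_inv.
Qed.

Lemma Rint_ReM f g : f \in Lp -> g \in Lq ->
  Rint (fun x => complex.Re (f x * g x)).
Proof.
move=> hf hg; apply: Rint_le (Rint_normcM hf hg).
  by have [] := cmeasurable_mul (cLfun_cmeasurable hf) (cLfun_cmeasurable hg).
by move=> x; rewrite -normcM abs_Re_le_normc.
Qed.

Lemma Rint_ImM f g : f \in Lp -> g \in Lq ->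
  Rint (fun x => complex.Im (f x * g x)).
Proof.
move=> hf hg; apply: Rint_le (Rint_normcM hf hg).
  by have [] := cmeasurable_mul (cLfun_cmeasurable hf) (cLfun_cmeasurable hg).
by move=> x; rewrite -normcM abs_Im_le_normc.
Qed.

Lemma hoelder_normc f g : f \in Lp -> g \in Lq ->
  \int[mu]_x (normc (f x) * normc (g x)) <= nrm mu p%:E f * nrm mu q%:E g.
Proof.
move=> hf hg; rewrite -lee_fin EFinM -!nrmE// /Rintegral fineK; last first.
  by apply: integrable_fin_num => //; exact: Rint_normcM.
have := hoelder mu (measurable_normc (cLfun_cmeasurable hf))
  (measurable_normc (cLfun_cmeasurable hg)) p0 q0 (conjugates_inv pq).
apply: le_trans; rewrite Lnorm1 le_eqVlt; apply/orP; left; apply/eqP.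
apply: eq_integral => x _.
by rewrite /= ger0_norm// mulr_ge0// normc_ge0.
Qed.

Lemma cpairing_linl a f f' g : f \in Lp -> f' \in Lp -> g \in Lq ->
  cpairing mu (fun x => a * f x + f' x) g = a * cpairing mu f g + cpairing mu f' g.
Proof.
move=> hf hf' hg; rewrite /cpairing.
have I1 := Rint_ReM hf hg; have I2 := Rint_ImM hf hg.
have I1' := Rint_ReM hf' hg; have I2' := Rint_ImM hf' hg.
apply/eqP; rewrite eq_complex Re_scaleD Im_scaleD; apply/andP; split; apply/eqP => /=.
  rewrite -!RintegralZl// -RintegralB//; last 2 first.
  - by have := integrableZl measurableT (complex.Re a) I1; apply: eq_integrable.
  - by have := integrableZl measurableT (complex.Im a) I2; apply: eq_integrable.
  rewrite -RintegralD//; last first.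
    have := integrableB measurableT (integrableZl measurableT (complex.Re a) I1)
      (integrableZl measurableT (complex.Im a) I2).
    by apply: eq_integrable.
  apply: eq_Rintegral => x _; case: a (f x) (f' x) (g x) => [? ?] [? ?] [? ?] [? ?] /=.
  by ring.
rewrite -!RintegralZl// -RintegralD//; last 2 first.
- by have := integrableZl measurableT (complex.Re a) I2; apply: eq_integrable.
- by have := integrableZl measurableT (complex.Im a) I1; apply: eq_integrable.
rewrite -RintegralD//; last first.
  have := integrableD measurableT (integrableZl measurableT (complex.Re a) I2)
    (integrableZl measurableT (complex.Im a) I1).
  by apply: eq_integrable.
apply: eq_Rintegral => x _; case: a (f x) (f' x) (g x) => [? ?] [? ?] [? ?] [? ?] /=.
by ring.
Qed.

Lemma cpairing0l g : cpairing mu (fun=> 0) g = 0.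
Proof.
rewrite /cpairing; under eq_Rintegral do rewrite mul0r.
under [X in _ +i* X]eq_Rintegral do rewrite mul0r.
by rewrite /= Rintegral_cst// mul0r.
Qed.

Lemma cpairingC f g : cpairing mu f g = cpairing mu g f.
Proof.
rewrite /cpairing; under eq_Rintegral do rewrite mulrC.
by under [X in _ +i* X]eq_Rintegral do rewrite mulrC.
Qed.

Lemma cpairingZl a f g : f \in Lp -> g \in Lq ->
  cpairing mu (fun x => a * f x) g = a * cpairing mu f g.
Proof.
move=> hf hg; have h0 : (fun=> 0 : C) \in Lp by apply: cLfun0; rewrite lee_fin ltW.
have := cpairing_linl a hf h0 hg; rewrite cpairing0l addr0 => <-.
by under [in RHS]eq_fun do rewrite addr0.
Qed.

(** Multiplying [f] by the conjugate of the pairing makes the pairing real and nonnegative, so that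
    Hoelder's inequality for moduli applies. *)
Lemma cpairing_le f g : f \in Lp -> g \in Lq ->
  normc (cpairing mu f g) <= nrm mu p%:E f * nrm mu q%:E g.
Proof.
move=> hf hg; set z := cpairing mu f g.
have [->|z0] := eqVneq z 0; first by rewrite normc0 mulr_ge0// nrm_ge0.
have nz0 : 0 < normc z.
  by rewrite lt_neqAle normc_ge0 andbT eq_sym; apply: contra_neq z0; exact: eq0_normc.
have hf' : (fun x => conjc z * f x) \in Lp by apply: cLfunZ => //; rewrite lee_fin ltW.
have e : complex.Re (cpairing mu (fun x => conjc z * f x) g) = normc z ^+ 2.
  rewrite cpairingZl// -/z sqr_normc; case: (z) => a b /=; ring.
rewrite -(ler_pM2l nz0) -expr2 -e mulrA -(normc_conj z) -nrmZ//; last by rewrite lee_fin ltW.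
apply: le_trans (hoelder_normc hf' hg); rewrite /cpairing.
apply: le_Rintegral => //; [exact: Rint_ReM|exact: Rint_normcM|move=> x _].
by rewrite -normcM Re_le_normc.
Qed.

Lemma ae_eq_cpairing f f' g : cmeasurable f -> cmeasurable f' -> cmeasurable g ->
  {ae mu, forall x, f x = f' x} -> cpairing mu f g = cpairing mu f' g.
Proof.
move=> mf mf' mg ff'; rewrite /cpairing /Rintegral.
have [m1 m2] := cmeasurable_mul mf mg; have [m1' m2'] := cmeasurable_mul mf' mg.
congr (fine _ +i* fine _).
  apply: ae_eq_integral => //; [exact/measurable_EFinP|exact/measurable_EFinP|].
  by apply: filterS ff' => x -> _.
apply: ae_eq_integral => //; [exact/measurable_EFinP|exact/measurable_EFinP|].
by apply: filterS ff' => x -> _.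
Qed.

Lemma normc_jmap_powR h : normc (jmap p h) `^ q = normc h `^ p.
Proof. by rewrite normc_jmap// powR_conj. Qed.

Lemma cLfun_jmap f : f \in Lp -> (fun x => jmap p (f x)) \in Lq.
Proof.
move=> /(cLfunP mu f p0)[mf If]; apply/cLfunP => //; split.
  exact: cmeasurable_jmap.
by under eq_fun do rewrite normc_jmap_powR.
Qed.

Lemma nrm_jmap f : f \in Lp ->
  nrm mu q%:E (fun x => jmap p (f x)) = nrm mu p%:E f `^ (p - 1).
Proof.
move=> hf; have := nrm_powR q0 (cLfun_jmap hf).
under eq_Rintegral do rewrite normc_jmap_powR.
rewrite -nrm_powR// -(powR_conj _ pq) => /(congr1 (fun x => x `^ q^-1)).
by rewrite -!powRrM mulfV ?gt_eqF// !powRr1 ?nrm_ge0 ?powR_ge0// mulr1.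
Qed.

Lemma cpairing_jmap f : f \in Lp ->
  cpairing mu f (fun x => jmap p (f x)) = (nrm mu p%:E f `^ p)%:C.
Proof.
move=> hf; rewrite /cpairing nrm_powR//.
under eq_Rintegral do rewrite mul_jmap//=.
under [X in _ +i* X]eq_Rintegral do rewrite mul_jmap//=.
by rewrite Rintegral_cst// mul0r.
Qed.

(** The integral of [uniform_gap] over the space. As [delta] is chosen before [f] and [g], the
    estimate is uniform over the unit ball. *)
Lemma radon_riesz eta : 0 < eta -> exists2 delta, 0 < delta &
  forall f g, f \in Lp -> g \in Lp -> nrm mu p%:E f <= 1 -> nrm mu p%:E g = 1 ->
  1 - delta < complex.Re (cpairing mu f (fun x => jmap p (g x))) ->
  nrm mu p%:E (fun x => f x - g x) < eta.
Proof.
(* With [delta = e / K] the integrated bound is less than [e + 2 e]: one [e] from the pairing, two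
   from the error terms of [f] and [g]. This stays below [4 e = eta ^ p]. *)
move=> eta0; pose e := eta `^ p / 4.
have e0 : 0 < e by rewrite divr_gt0// powR_gt0.
have [K K0 hK] := uniform_gap pq e0.
exists (e / K) => [|f g hf hg f1 g1 hd]; first by rewrite divr_gt0.
have P1 : (1 <= p%:E)%E by rewrite lee_fin ltW.
have hj := cLfun_jmap hg.
have [mf If] := (cLfunP mu f p0).1 hf; have [mg Ig] := (cLfunP mu g p0).1 hg.
have IRe := Rint_ReM hf hj.
pose a := K / p + e; pose b := K / q + e.
have Iab : Rint (fun x => a * normc (f x) `^ p + b * normc (g x) `^ p).
  have := integrableD measurableT (integrableZl measurableT a If)
    (integrableZl measurableT b Ig).
  by apply: eq_integrable.
have I : Rint (fun x => a * normc (f x) `^ p + b * normc (g x) `^ p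
    - K * complex.Re (f x * jmap p (g x))).
  have := integrableB measurableT Iab (integrableZl measurableT K IRe).
  by apply: eq_integrable.
have mfg := cLfun_cmeasurable (cLfunB P1 hf hg).
have := nrm_le_dom p0 mfg (_ : forall x, _ <= (a * normc (f x) `^ p
  + b * normc (g x) `^ p - K * complex.Re (f x * jmap p (g x)))) I.
have {}hK x : normc (f x - g x) `^ p <= a * normc (f x) `^ p
  + b * normc (g x) `^ p - K * complex.Re (f x * jmap p (g x)).
  by apply: (le_trans (hK (f x) (g x))); rewrite /a /b le_eqVlt; apply/orP; left; apply/eqP; ring.
move=> /(_ hK); rewrite RintegralB//; last first.
  by have := integrableZl measurableT K IRe; apply: eq_integrable.
rewrite RintegralD//; last 2 first.
- by have := integrableZl measurableT a If; apply: eq_integrable.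
- by have := integrableZl measurableT b Ig; apply: eq_integrable.
rewrite !RintegralZl// -!nrm_powR// g1 one_powR.
move: hd; rewrite [complex.Re _]/=; set r := Rintegral _ _ _ => hd hle.
have f1p : nrm mu p%:E f `^ p <= 1.
  by rewrite -[leRHS](one_powR p) ge0_ler_powR ?nnegrE ?nrm_ge0// ltW.
have : a * nrm mu p%:E f `^ p <= a.
  by rewrite ler_piMr// ltW// addr_gt0// divr_gt0.
have ab : a + b = K + 2 * e.
  by rewrite /a /b addrACA -mulrDr (conjugates_inv pq); ring.
have : K * (1 - e / K) < K * r by rewrite ltr_pM2l.
rewrite mulrBr mulr1 mulrCA divff ?gt_eqF// mulr1 => h1 h2.
have h3 : nrm mu p%:E (fun x => f x - g x) `^ p < eta `^ p.
  have : eta `^ p = 4 * e by rewrite /e mulrC divfK.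
  lra.
rewrite ltNge; apply/negP => h4; move: h3; rewrite ltNge => /negP; apply.
by rewrite ge0_ler_powR ?nnegrE ?nrm_ge0// ltW.
Qed.

End Pairing.

(** * Truncation of functions and bounded functions *)

Section Restriction.
Context d (T : measurableType d) (R : realType).
Variables (mu : {measure set T -> \bar R}) (p : R) (p1 : 1 < p).
Local Notation C := R[i].
Local Notation Rint f := (mu.-integrable [set: T] (EFin \o f)).
Local Notation Lp := (cLfun mu p%:E).
Let p0 : 0 < p. Proof. exact: lt_trans p1. Qed.

Definition crestr (A : set T) (f : T -> C) : T -> C :=
  fun x => (\1_A x)%:C * f x.

Lemma cmeasurable_crestr A f : measurable A -> cmeasurable f ->
  cmeasurable (crestr A f).
Proof.
by move=> mA mf; apply: cmeasurable_mul => //; apply: cmeasurable_real.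
Qed.

Lemma normc_crestr_powR A f x :
  normc (crestr A f x) `^ p = \1_A x * normc (f x) `^ p.
Proof.
rewrite /crestr normcM normc_real indicE; case: (x \in A) => /=.
  by rewrite normr1 !mul1r.
by rewrite normr0 !mul0r powR0// gt_eqF.
Qed.

Lemma crestr_Lp A f : measurable A -> f \in Lp -> crestr A f \in Lp.
Proof.
move=> mA hf; have [mf If] := (cLfunP mu f p0).1 hf.
apply: (cLfun_dom p0 (cmeasurable_crestr mA mf) _ If) => x.
by rewrite normc_crestr_powR ler_piMl ?powR_ge0// indicE.
Qed.

Lemma crestrC A f x : f x = crestr A f x + crestr (~` A) f x.
Proof.
rewrite /crestr !indicE in_setC; case: (x \in A) => /=.
  by rewrite mul1r mul0r addr0.
by rewrite mul1r mul0r add0r.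
Qed.

Lemma measurable_normc_le f (M : R) : cmeasurable f ->
  d.-measurable [set x : T | normc (f x) <= M].
Proof.
move=> mf; have := measurable_fun_le measurableT (measurable_normc mf)
  (@measurable_cst _ _ T R setT M).
by rewrite setTI.
Qed.

(** Dominated convergence: at each point the tail is eventually 0, and its p-th power is dominated
    by that of [f]. *)
Lemma crestr_tail f (e : R) : f \in Lp -> 0 < e ->
  exists n : nat, nrm mu p%:E (crestr (~` [set x | normc (f x) <= n%:R]) f) < e.
Proof.
move=> hf e0; have [mf If] := (cLfunP mu f p0).1 hf.
pose A (n : nat) := [set x | normc (f x) <= n%:R].
have mA n : measurable (~` A n) by apply: measurableC; exact: measurable_normc_le.
pose u (n : nat) x := (\1_(~` A n) x * normc (f x) `^ p)%:E.
have := @dominated_cvg _ T R mu setT measurableT u (fun=> 0%E)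
  (fun x => (normc (f x) `^ p)%:E).
rewrite integral0 => /(_ _ _ _ _ _)/fine_cvg/cvgr_lt => h.
have {h} : \forall n \near \oo, (fine \o (fun n => \int[mu]_(x in setT) u n x)%E) n < e `^ p.
  apply: h; last by rewrite powR_gt0.
  - move=> n; apply/measurable_EFinP; apply: measurable_funM => //.
    exact: measurable_normc_powR.
  - move=> x _; apply: cvg_near_cst.
    have [N hN] : exists N : nat, normc (f x) <= N%:R.
      by exists (Num.truncn (normc (f x))).+1; rewrite ltW// truncnS_gt.
    exists N => // n /= Nn; rewrite /u indicE memNset ?mul0r//; apply; rewrite /A /=.
    by rewrite (le_trans hN)// ler_nat.
  - by [].
  - exact: If.
  - move=> n x _; rewrite /u lee_fin ger0_norm ?mulr_ge0 ?powR_ge0//.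
    by rewrite ler_piMl ?powR_ge0// indicE; case: (_ \in _).
move=> [n _ /(_ n (leqnn n)) /= hn]; exists n.
have -> : nrm mu p%:E (crestr (~` A n) f) < e =
    (nrm mu p%:E (crestr (~` A n) f) `^ p < e `^ p).
  apply/idP/idP => h; first by rewrite gt0_ltr_powR ?nnegrE ?nrm_ge0// ltW.
  rewrite ltNge; apply/negP => h2; move: h; rewrite ltNge => /negP; apply.
  by rewrite ge0_ler_powR ?nnegrE ?nrm_ge0// ltW.
rewrite nrm_powR//; last exact: crestr_Lp.
by under eq_Rintegral do rewrite normc_crestr_powR.
Qed.

End Restriction.

Section Bounded.
Context d (T : measurableType d) (R : realType).
Variables (mu : {measure set T -> \bar R}) (p : R) (p1 : 1 < p).
Hypothesis fin_mu : (mu [set: T] < +oo)%E.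
Local Notation C := R[i].
Local Notation Rint f := (mu.-integrable [set: T] (EFin \o f)).
Local Notation Lp := (cLfun mu p%:E).
Let p0 : 0 < p. Proof. exact: lt_trans p1. Qed.

Lemma Rint_cst (M : R) : Rint (fun=> M).
Proof.
apply/integrableP; split; first exact: measurable_cst.
rewrite integral_cst//= lte_mul_pinfty//.
Qed.

Lemma Rint_bounded (f : T -> R) (M : R) : measurable_fun [set: T] f ->
  (forall x, `|f x| <= M) -> Rint f.
Proof. by move=> mf fM; apply: Rint_le mf fM _; exact: Rint_cst. Qed.

Lemma cLfun_bounded (f : T -> C) (M : R) : cmeasurable f ->
  (forall x, normc (f x) <= M) -> f \in Lp.
Proof.
move=> mf fM; apply: (@cLfun_dom _ _ _ mu p f (fun=> M `^ p)) => // [x|].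
  have M0 : 0 <= M := le_trans (normc_ge0 _) (fM x).
  by rewrite ge0_ler_powR ?nnegrE ?normc_ge0// ltW.
exact: Rint_cst.
Qed.

(** The p-norm of the constant 1, whence the root. *)
Definition total_mass : R := fine (mu [set: T]) `^ p^-1.

Lemma nrm_bounded (f : T -> C) (M : R) : 0 <= M -> cmeasurable f ->
  (forall x, normc (f x) <= M) -> nrm mu p%:E f <= M * total_mass.
Proof.
move=> M0 mf fM; have hf := cLfun_bounded mf fM.
have : nrm mu p%:E f `^ p <= (M * total_mass) `^ p.
  rewrite /total_mass powRM ?powR_ge0// -powRrM mulVf ?gt_eqF// powRr1 ?fine_ge0//.
  rewrite -(Rintegral_cst mu measurableT).
  apply: nrm_le_dom => // [x|]; last exact: Rint_cst.
  by rewrite ge0_ler_powR ?nnegrE ?normc_ge0// ltW.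
apply: contraTT; rewrite -!ltNge => h.
by rewrite gt0_ltr_powR ?nnegrE ?nrm_ge0 ?mulr_ge0 ?powR_ge0.
Qed.

Lemma nrm_indic (A : set T) : measurable A ->
  nrm mu p%:E (fun x => (\1_A x)%:C) = fine (mu A) `^ p^-1.
Proof.
move=> mA; have mI : cmeasurable (fun x => (\1_A x)%:C : C).
  by apply: cmeasurable_real.
have hI : (fun x => (\1_A x)%:C : C) \in Lp.
  apply: (cLfun_bounded (M := 1)) => // x; rewrite normc_real indicE.
  by case: (_ \in _); rewrite ?normr0 ?normr1.
have := nrm_powR p0 hI.
have -> : \int[mu]_x normc ((\1_A x)%:C : C) `^ p = fine (mu A).
  rewrite -[RHS]/(fine (mu A)) -[X in _ = fine (mu X)]setIT -integral_indic//.
  congr fine; apply: eq_integral => x _; rewrite normc_real indicE.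
  by case: (_ \in _); rewrite ?normr0 ?normr1 ?one_powR// powR0// gt_eqF.
move=> <-; rewrite -powRrM mulfV ?gt_eqF// powRr1//; exact: nrm_ge0.
Qed.

End Bounded.

(** * Riesz representation and adjoints *)

Section RieszReal.
Context d (T : measurableType d) (R : realType).
Variables (mu : {finite_measure set T -> \bar R}) (p q : R) (pq : conjugates p q).
Local Notation C := R[i].
Local Notation Rint f := (mu.-integrable [set: T] (EFin \o f)).
Local Notation creal u := (fun x => (u x)%:C : C).
Local Notation rLp u := (creal u \in cLfun mu p%:E).
Local Notation rLq u := (creal u \in cLfun mu q%:E).
Variables (l : (T -> R) -> R) (K : R).
Hypothesis l_lin : forall a u v, rLp u -> rLp v ->
  l (fun x => a * u x + v x) = a * l u + l v.
Hypothesis l_bd : forall u, rLp u -> `|l u| <= K * nrm mu p%:E (creal u).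

Let p0 := conjugates_gt0 pq.
Let q0 := conjugates_gt0 (conjugatesC pq).
Let p1 := conjugates_gt1 pq.
Let q1 := conjugates_gt1 (conjugatesC pq).

Let fin_mu : (mu [set: T] < +oo)%E.
Proof. by rewrite -ge0_fin_numE// fin_num_measure. Qed.

Let rLp_bounded (u : T -> R) (M : R) : measurable_fun [set: T] u -> (forall x, `|u x| <= M) -> rLp u.
Proof.
move=> mu' uM; apply: (cLfun_bounded p1 fin_mu (M := M)); first exact: cmeasurable_real.
by move=> x; rewrite normc_real.
Qed.

Let rLp_indic A : measurable A -> rLp (\1_A : T -> R).
Proof.
move=> mA; apply: (@rLp_bounded _ 1) => // x.
by rewrite indicE; case: (_ \in _); rewrite ?normr0 ?normr1.
Qed.

Let l0 : l (fun=> 0) = 0.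
Proof.
have h0 : rLp (fun=> 0 : R) by apply: (@rLp_bounded _ 0) => // x; rewrite normr0.
have := l_lin 1 h0 h0; under eq_fun do rewrite mulr0 addr0.
by rewrite mul1r; lra.
Qed.

Let lD u v : rLp u -> rLp v -> l (fun x => u x + v x) = l u + l v.
Proof.
move=> hu hv; rewrite -[l u]mul1r -l_lin//.
by under [in RHS]eq_fun do rewrite mul1r.
Qed.

Let l_sum (I : Type) (s : seq I) (c : I -> R) (A : I -> set T) :
  (forall i, measurable (A i)) ->
  rLp (fun x => \sum_(i <- s) c i * \1_(A i) x) /\
  l (fun x => \sum_(i <- s) c i * \1_(A i) x) = \sum_(i <- s) c i * l (\1_(A i)).
Proof.
move=> mA; elim: s => [|i s [IH1 IH2]].
  rewrite big_nil; under eq_fun do rewrite big_nil.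
  under [X in l X]eq_fun do rewrite big_nil.
  by split; [apply: (@rLp_bounded _ 0) => // x; rewrite normr0|exact: l0].
under eq_fun do rewrite big_cons; under [X in l X]eq_fun do rewrite big_cons.
rewrite big_cons l_lin//; last exact: rLp_indic.
rewrite IH2; split => //.
have P1 : (1 <= p%:E)%E by rewrite lee_fin ltW.
have := cLfun_lin (c i)%:C P1 (rLp_indic (mA i)) IH1.
by under eq_fun do rewrite -rmorphM -rmorphD.
Qed.

(** The set function whose Radon-Nikodym density will represent [l]. *)
Let nu (A : set T) : \bar R := (l (\1_A))%:E.

Let l_indicU A B : measurable A -> measurable B -> A `&` B = set0 ->
  l (\1_(A `|` B)) = l (\1_A) + l (\1_B).
Proof.
move=> mA mB AB0; rewrite -lD; try exact: rLp_indic.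
congr l; apply/funext => x; rewrite !indicE in_setU.
have [xA|xA] := boolP (x \in A); have [xB|xB] := boolP (x \in B); rewrite ?addr0 ?add0r//.
by move: xA xB; rewrite !inE => xA xB; have : (A `&` B) x by []; rewrite AB0.
Qed.

Let l_indic_small (e : R) : 0 < e -> exists2 del : R, 0 < del &
  forall A, measurable A -> fine (mu A) < del -> `|l (\1_A)| < e.
Proof.
(* [K] is an arbitrary real, so [|K| + 1] replaces it as a positive divisor. The threshold is a p-th
   power because an indicator has norm [mu A ^ (1 / p)]. *)
move=> e0; pose K' := `|K| + 1; have K'0 : 0 < K' by rewrite ltr_wpDl.
exists ((e / K') `^ p); first by rewrite powR_gt0// divr_gt0.
move=> A mA hA; apply: (le_lt_trans (l_bd (rLp_indic mA))).
rewrite (nrm_indic p1 fin_mu mA).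
have hm : fine (mu A) `^ p^-1 < e / K'.
  rewrite -[ltRHS]powRr1 ?divr_ge0 ?ltW// -(mulfV (lt0r_neq0 p0)) powRrM.
  by rewrite gt0_ltr_powR ?invr_gt0 ?nnegrE ?fine_ge0 ?powR_ge0.
apply: (@le_lt_trans _ _ (K' * fine (mu A) `^ p^-1)).
  by rewrite ler_wpM2r ?powR_ge0// /K' (le_trans (ler_norm K))// lerDl.
by rewrite mulrC -ltr_pdivlMr.
Qed.

Let nu0 : nu set0 = 0%E.
Proof.
rewrite /nu (_ : \1_set0 = fun=> 0) ?l0//.
by apply/funext => x; rewrite indicE in_set0.
Qed.

Let nu_fin A : measurable A -> nu A \is a fin_num.
Proof. by []. Qed.

(** By finite additivity the error of a partial sum is [nu (D n)]. The remainders [D n] decrease to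
    the empty set, so their measures tend to 0, and [l] is small on indicators of small sets. *)
Let nu_sigma : semi_sigma_additive nu.
Proof.
move=> F mF tF mUF.
pose D n := (\bigcup_i F i) `\` \big[setU/set0]_(i < n) F i.
have mB n : measurable (\big[setU/set0]_(i < n) F i) by apply: bigsetU_measurable => i _.
have mD n : measurable (D n) by exact: measurableD.
have sumE n : (\sum_(0 <= i < n) nu (F i) = nu (\big[setU/set0]_(i < n) F i))%E.
  elim: n => [|n IH]; first by rewrite big_nil big_ord0 nu0.
  rewrite big_nat_recr//= IH big_ord_recr/= /nu -EFinD (l_indicU (mB n) (mF n))//.
  rewrite -bigcup_mkord -subset0 => x [[i /= im Fix] Fnx]; move: im.
  by rewrite (tF i n I I) ?ltnn//; exists x.
have nuE n : nu (\bigcup_i F i) = (nu (\big[setU/set0]_(i < n) F i) + nu (D n))%E.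
  rewrite /nu -EFinD -l_indicU//; last by rewrite setIC setDKI.
  by rewrite setDUK// -bigcup_mkord => x [i _ Fx]; exists i.
have muD : (mu (D n) @[n --> \oo] --> 0)%E.
  rewrite -(measure0 mu) (_ : set0 = \bigcap_n D n).
    apply: nonincreasing_cvg_mu => //.
    - by rewrite -ge0_fin_numE// fin_num_measure.
    - exact: bigcapT_measurable.
    - move=> m n mn; apply/subsetPset; apply: setDS.
      by rewrite -!bigcup_mkord => x [i /= im Fx]; exists i => //=; exact: leq_trans mn.
  apply/esym; rewrite -subset0 => x Dx; have [[i _ Fix] _] := Dx 0%N I.
  have [_] := Dx i.+1 I; apply; rewrite -bigcup_mkord; exists i => //=.
have {}muD : fine (mu (D n)) @[n --> \oo] --> (0 : R) by exact: fine_cvg muD.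
apply/fine_cvgP; split; first by apply: nearW => n; rewrite sumE.
apply/cvgrPdist_lt => e e0; have [del del0 hdel] := l_indic_small e0.
move/cvgr_lt : muD => /(_ _ del0); apply: filterS => n hn.
have [nuE'] := nuE n.
rewrite -[(fine \o _) n]/(fine (\sum_(0 <= i < n) nu (F i))) sumE nuE' /= addrAC subrr add0r.
exact: hdel.
Qed.

Let ex_density : exists w : T -> R, [/\ measurable_fun [set: T] w, Rint w &
  forall A, measurable A -> l (\1_A) = \int[mu]_x (\1_A x * w x)].
Proof.
pose ch : {charge set T -> \bar R} :=
  HB.pack nu (isCharge.Build _ _ _ nu nu0 nu_fin nu_sigma).
have dom : ch `<< mu.
  apply/null_content_dominatesP => A mA A0; rewrite -[LHS]/((l (\1_A))%:E).
  have := l_bd (rLp_indic mA); rewrite (nrm_indic p1 fin_mu mA) A0/=.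
  by rewrite powR0 ?invr_eq0 ?gt_eqF// mulr0 normr_le0 => /eqP ->.
pose w0 := Radon_Nikodym ch mu.
have w0fin x : w0 x \is a fin_num by exact: Radon_Nikodym_fin_num.
have w0E : w0 = EFin \o (fun x => fine (w0 x)).
  by apply/funext => x /=; rewrite fineK.
have Iw0 : mu.-integrable [set: T] w0 by exact: Radon_Nikodym_integrable.
exists (fun x => fine (w0 x)); split.
- by apply/measurable_EFinP; move: (measurable_int _ Iw0); rewrite {1}w0E.
- by move: Iw0; rewrite {1}w0E.
move=> A mA; have := Radon_Nikodym_integral dom mA; rewrite -[LHS]/((l (\1_A))%:E).
rewrite integral_mkcond => h; apply: EFin_inj; rewrite h /Rintegral fineK.
  apply: eq_integral => x _; rewrite patchE indicE.
  by case: (x \in A); rewrite ?mul1r ?mul0r// fineK.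
have := integrableS measurableT mA (@subsetT _ _) Iw0.
move=> /(integrable_mkcond _ mA) /(integrable_fin_num measurableT).
congr (_ \is a fin_num); apply: eq_integral => x _; rewrite patchE indicE.
by case: (x \in A); rewrite ?mul1r ?mul0r// fineK.
Qed.

Section Density.
Variable w : T -> R.
Hypothesis mw : measurable_fun [set: T] w.
Hypothesis Iw : Rint w.
Hypothesis wE : forall A, measurable A -> l (\1_A) = \int[mu]_x (\1_A x * w x).

Let RintM (v : T -> R) (M : R) : measurable_fun [set: T] v -> (forall x, `|v x| <= M) ->
  Rint (fun x => v x * w x).
Proof.
move=> mv vM; have IMw : Rint (fun x => M * `|w x|).
  have := integrableZl measurableT M (integrable_norm Iw).
  by apply: eq_integrable.
apply: Rint_le IMw; first exact: measurable_funM.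
by move=> x; rewrite normrM ler_wpM2r.
Qed.

Let l_simple (I : Type) (s : seq I) (c : I -> R) (A : I -> set T) :
  (forall i, measurable (A i)) ->
  l (fun x => \sum_(i <- s) c i * \1_(A i) x) =
    \int[mu]_x ((\sum_(i <- s) c i * \1_(A i) x) * w x).
Proof.
move=> mA; rewrite (l_sum _ _ mA).2.
have bd i x : `|\1_(A i) x : R| <= 1.
  by rewrite indicE; case: (_ \in _); rewrite ?normr0 ?normr1.
elim: s => [|i s IH].
  rewrite big_nil; under eq_Rintegral do rewrite big_nil mul0r.
  by rewrite Rintegral_cst// mul0r.
rewrite big_cons IH wE//; under [in RHS]eq_Rintegral do rewrite big_cons mulrDl -mulrA.
have I1 : Rint (fun x => \1_(A i) x * w x) by apply: (@RintM _ 1).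
have I2 : Rint (fun x => (\sum_(j <- s) c j * \1_(A j) x) * w x).
  apply: (@RintM _ (\sum_(j <- s) `|c j|)).
    by apply: measurable_sum => j; apply: measurable_funM.
  move=> x; rewrite (le_trans (ler_norm_sum _ _ _))// ler_sum// => j _.
  by rewrite normrM ler_piMr.
rewrite RintegralD//; last by have := integrableZl measurableT (c i) I1; apply: eq_integrable.
by rewrite RintegralZl.
Qed.

Let le_inv_eq0 (x B : R) : (forall n : nat, `|x| <= B / n.+1%:R) -> x = 0.
Proof.
move=> h; apply/eqP; rewrite -normr_eq0 eq_le normr_ge0 andbT leNgt.
apply/negP => x0; have B0 : 0 <= B by have := h 0%N; rewrite divr1; exact: le_trans.
have := h (Num.truncn (B / `|x|)).
rewrite ler_pdivlMr// leNgt mulrC -ltr_pdivrMr// => /negP; apply.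
exact: truncnS_gt.
Qed.

(** Rounding [u] down to a multiple of [1 / (n + 1)] gives a simple function within [1 / (n + 1)] of
    [u]; the strict bound [u < M] leaves only [(n + 1) M] levels. Both sides of the claim move by
    O(1/n), so their difference is 0. *)
Let l_bounded_ge0 (u : T -> R) (M : nat) : measurable_fun [set: T] u ->
  (forall x, 0 <= u x < M%:R) -> l u = \int[mu]_x (u x * w x).
Proof.
move=> mu' uM.
have ubd x : `|u x| <= M%:R by have /andP[a b] := uM x; rewrite ger0_norm// ltW.
have hu : rLp u by exact: rLp_bounded ubd.
apply: subr0_eq; apply: (@le_inv_eq0 _ (`|K| * total_mass mu p + \int[mu]_x `|w x|)) => n.
pose A (k : nat) := (fun x => n.+1%:R * u x) @^-1` `[k%:R, k.+1%:R[%classic.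
have mA k : measurable (A k).
  rewrite -[A k]setTI; apply: measurable_funM => //.
pose c (k : nat) : R := k%:R / n.+1%:R.
pose v x := \sum_(k <- iota 0 (n.+1 * M)) c k * \1_(A k) x.
have vE x : v x = (Num.truncn (n.+1%:R * u x))%:R / n.+1%:R.
  have /andP[u0 u1] := uM x.
  have nu0' : 0 <= n.+1%:R * u x by rewrite mulr_ge0.
  have tE k : \1_(A k) x = (k == Num.truncn (n.+1%:R * u x))%:R :> R.
    rewrite indicE /A; congr (nat_of_bool _)%:R; apply/idP/idP.
      by rewrite inE /= in_itv/= => /truncn_def ->.
    by move=> /eqP ->; rewrite inE /= in_itv/= truncn_le// truncnS_gt andbT.
  rewrite /v (bigD1_seq (Num.truncn (n.+1%:R * u x))) ?iota_uniq//=.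
    rewrite tE eqxx mulr1 big1 ?addr0// => k kn.
    by rewrite tE (negbTE kn) mulr0.
  rewrite mem_iota /= add0n truncn_lt_nat// natrM ltr_pM2l//.
have uv x : `|u x - v x| <= n.+1%:R^-1.
  have /andP[u0 u1] := uM x.
  have nu0' : 0 <= n.+1%:R * u x by rewrite mulr_ge0.
  have h1 : (Num.truncn (n.+1%:R * u x))%:R <= n.+1%:R * u x by rewrite truncn_le.
  have h2 : n.+1%:R * u x < (Num.truncn (n.+1%:R * u x)).+1%:R by exact: truncnS_gt.
  have -> : u x - v x = (n.+1%:R * u x - (Num.truncn (n.+1%:R * u x))%:R) / n.+1%:R.
    by rewrite vE mulrBl mulrAC mulfV ?mul1r.
  rewrite ger0_norm ?divr_ge0 ?subr_ge0// -[leRHS]mul1r ler_pM2r ?invr_gt0//.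
  by move: h2; rewrite -natr1; lra.
have mv : measurable_fun [set: T] v.
  by apply: measurable_sum => j; apply: measurable_funM.
have [hv lv] := l_sum (iota 0 (n.+1 * M)) c mA.
have Iu : Rint (fun x => u x * w x) by exact: RintM ubd.
have Iv : Rint (fun x => v x * w x).
  apply: (@RintM _ (M%:R + n.+1%:R^-1)) => // x.
  rewrite -[v x](subKr (u x)) (le_trans (ler_normB _ _))// lerD//.
have huv : rLp (fun x => u x - v x).
  by apply: (@rLp_bounded _ n.+1%:R^-1) => //; exact: measurable_funB.
have -> : l u = l v + l (fun x => u x - v x).
  rewrite -lD//; congr l; apply/funext => x; by rewrite addrC subrK.
rewrite [l v]l_simple// -/v.
have -> : \int[mu]_x (u x * w x) = \int[mu]_x (v x * w x) + \int[mu]_x ((u x - v x) * w x).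
  rewrite -RintegralD//; first by apply: eq_Rintegral => x _; ring.
  by apply: RintM uv; exact: measurable_funB.
rewrite -[X in `|X + _ - _|]/(\int[mu]_x (v x * w x)) opprD addrACA subrr add0r.
rewrite (le_trans (ler_normB _ _))// mulrDl lerD//.
  rewrite (le_trans (l_bd huv))// -mulrA.
  apply: (@le_trans _ _ (`|K| * nrm mu p%:E (creal (fun x => u x - v x)))).
    by rewrite ler_wpM2r ?nrm_ge0// ler_norm.
  rewrite ler_wpM2l// mulrC nrm_bounded// ?invr_ge0//.
    exact/cmeasurable_real/measurable_funB.
  by move=> x; rewrite normc_real.
rewrite (le_trans (le_normr_Rintegral _ _))//; first by apply: RintM uv; exact: measurable_funB.
rewrite mulrC -RintegralZl//; last exact: integrable_norm Iw.
apply: le_Rintegral => //.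
- have /integrable_norm : Rint (fun x => (u x - v x) * w x) by apply: RintM uv; exact: measurable_funB.
  exact.
- by have := integrableZl measurableT (n.+1%:R^-1) (integrable_norm Iw); apply: eq_integrable.
by move=> x _; rewrite normrM ler_wpM2r.
Qed.

Let l_bounded (u : T -> R) (M : R) : measurable_fun [set: T] u ->
  (forall x, `|u x| <= M) -> l u = \int[mu]_x (u x * w x).
Proof.
move=> mu' uM; pose N := (Num.truncn `|M|).+1.
have MN : M < N%:R by rewrite (le_lt_trans (ler_norm M))// truncnS_gt.
have hN : rLp (fun=> N%:R : R) by apply: (@rLp_bounded _ N%:R) => // x; rewrite ger0_norm.
have hu : rLp u by exact: rLp_bounded uM.
have muN : measurable_fun [set: T] (fun x => u x + N%:R) by exact: measurable_funD.
have e1 : l (fun x => u x + N%:R) = \int[mu]_x ((u x + N%:R) * w x).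
  apply: (@l_bounded_ge0 _ (N + N)) => // x.
  by have := uM x; rewrite ler_norml natrD => /andP[a b]; apply/andP; split; lra.
have e2 : l (fun=> N%:R) = \int[mu]_x (N%:R * w x).
  apply: (@l_bounded_ge0 _ N.+1) => // x.
  by rewrite ler0n ltr_nat ltnSn.
move: e1; rewrite lD// e2 => /(canRL (addrK _)) ->.
rewrite -RintegralB//.
- by apply: eq_Rintegral => x _; ring.
- by apply: (@RintM _ (M + N%:R)) => // x; rewrite (le_trans (ler_normD _ _))// lerD// ger0_norm.
- by apply: (@RintM _ N%:R) => // x; rewrite ger0_norm.
Qed.

Let An n := [set x | normc ((w x)%:C : C) <= n%:R].
Let wn n := crestr (An n) (creal w).

Let mAn n : measurable (An n).
Proof. by apply: measurable_normc_le => //; exact: cmeasurable_real. Qed.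

Let wn_bounded n x : normc (wn n x) <= n%:R.
Proof.
rewrite /wn /crestr indicE.
have [|_] := boolP (x \in An n); first by rewrite inE /An mul1r.
by rewrite mul0r normc0.
Qed.

Let wn_Lq n : wn n \in cLfun mu q%:E.
Proof.
apply: (cLfun_bounded q1 fin_mu (M := n%:R)) => //.
by apply: cmeasurable_crestr => //; exact: cmeasurable_real.
Qed.

(** Testing [l] on the duality image of [wn n] gives [|wn| ^ q <= K |wn| ^ (q - 1)]. Truncation
    makes the test function bounded, where the integral formula is already known, and makes the norm
    finite, so that a power of it can be cancelled. *)
Let nrm_wn n : nrm mu q%:E (wn n) <= `|K|.
Proof.
pose u x : R := complex.Re (jmap q (wn n x)).
have uE x : (u x)%:C = jmap q (wn n x).
  apply/eqP; rewrite eq_complex eqxx /= /wn /crestr /jmap /=.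
  by apply/eqP; ring.
have qp := conjugatesC pq.
have hu : rLp u by under eq_fun do rewrite uE; exact: (cLfun_jmap qp (wn_Lq n)).
have nu_ : nrm mu p%:E (creal u) = nrm mu q%:E (wn n) `^ (q - 1).
  by under [X in nrm _ _ X]eq_fun do rewrite uE; rewrite (nrm_jmap qp).
have lu : l u = nrm mu q%:E (wn n) `^ q.
  rewrite (@l_bounded _ (n%:R `^ (q - 1))).
  - rewrite -[RHS]/(complex.Re (_)%:C) -(cpairing_jmap qp (wn_Lq n)).
    apply: eq_Rintegral => x _; rewrite -uE; have [xA|xA] := boolP (x \in An n).
      have -> : wn n x = (w x)%:C by rewrite /wn /crestr indicE xA mul1r.
      by rewrite /=; ring.
    have wn0 : wn n x = 0 by rewrite /wn /crestr indicE (negbTE xA) mul0r.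
    by rewrite /u wn0 /jmap /= !(mul0r, mulr0, oppr0, subr0).
  - by have [] := cLfun_cmeasurable hu.
  - move=> x; rewrite -normc_real uE normc_jmap// ge0_ler_powR ?nnegrE ?normc_ge0//.
    by rewrite subr_ge0 ltW.
have := l_bd hu; rewrite lu nu_ ger0_norm ?powR_ge0//.
have [->|n0] := eqVneq (nrm mu q%:E (wn n)) 0; first by rewrite normr_ge0.
rewrite powRB1 ?nrm_ge0// ler_pM2r ?powR_gt0 ?lt_neqAle ?nrm_ge0 ?andbT 1?eq_sym//.
by move=> /le_trans; apply; exact: ler_norm.
Qed.

(** Monotone convergence along the truncations, whose norms are uniformly bounded by [nrm_wn]. *)
Let w_Lq : rLq w.
Proof.
apply/cLfunP => //; split; first exact: cmeasurable_real.
have mwq : measurable_fun [set: T] (fun x => normc ((w x)%:C : C) `^ q).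
  by apply: measurable_normc_powR; exact: cmeasurable_real.
apply/integrableP; split; first exact/measurable_EFinP.
under eq_integral do rewrite /= ger0_norm ?powR_ge0//.
pose g n x := (normc (wn n x) `^ q)%:E.
have mg n : measurable_fun [set: T] (g n).
  by apply/measurable_EFinP/measurable_normc_powR; exact: cLfun_cmeasurable (wn_Lq n).
have gE n x : g n x = (\1_(An n) x * normc ((w x)%:C : C) `^ q)%:E.
  by rewrite /g normc_crestr_powR.
have gnd x : [set: T] x -> {homo g^~ x : n m / (n <= m)%N >-> (n <= m)%E}.
  move=> _ n m nm; rewrite !gE lee_fin ler_wpM2r ?powR_ge0//.
  rewrite !indicE ler_nat; have [|//] := boolP (x \in An n).
  by rewrite inE => h; rewrite mem_set// /An /= (le_trans h)// ler_nat.
have glim x : limn (g^~ x) = (normc ((w x)%:C : C) `^ q)%:E.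
  apply/cvg_lim => //; apply: cvg_near_cst.
  exists (Num.truncn (normc ((w x)%:C : C))).+1 => // n /= hn.
  rewrite gE indicE mem_set ?mul1r// /An /=.
  by rewrite ltW// (lt_le_trans (truncnS_gt _))// ler_nat.
have g0 n x : [set: T] x -> (0 <= g n x)%E by move=> _; rewrite lee_fin powR_ge0.
have := @cvg_monotone_convergence _ T R mu setT measurableT g mg g0 gnd.
under [X in _ --> X -> _]eq_integral do rewrite glim.
move=> /cvg_lim <-//; apply: (@le_lt_trans _ _ (`|K| `^ q)%:E); last exact: ltry.
apply: lime_le.
  apply: ereal_nondecreasing_is_cvgn => m n mn.
  by apply: ge0_le_integral => // x _; first [exact: g0|exact: gnd].
apply: nearW => n; rewrite /g -integral_normc_powR ?gt_eqF// nrmE ?wn_Lq//.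
by rewrite lee_fin ge0_ler_powR ?nnegrE ?nrm_ge0// ltW.
Qed.

(** The formula holds for the truncation of [u]; the tail has small p-norm, which makes both its
    value under [l] and its integral against [w] small. *)
Let l_repr u : rLp u -> l u = \int[mu]_x (u x * w x).
Proof.
move=> hu; apply: subr0_eq.
have uw v : rLp v -> \int[mu]_x (v x * w x) = complex.Re (cpairing mu (creal v) (creal w)).
  by move=> hv; apply: eq_Rintegral => x _ /=; ring.
have P1 : (1 <= p%:E)%E by rewrite lee_fin ltW.
apply: (@le_inv_eq0 _ (`|K| + nrm mu q%:E (creal w))) => m.
have m0 : 0 < m.+1%:R^-1 :> R by rewrite invr_gt0.
have [n hn] := crestr_tail p1 hu m0.
set B := [set x | _] in hn.
have mB : measurable B by apply: measurable_normc_le => //; exact: cLfun_cmeasurable hu.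
pose u1 x := \1_B x * u x; pose u2 x := \1_(~` B) x * u x.
have hu1 : rLp u1.
  by have := crestr_Lp p1 mB hu; rewrite /crestr; under eq_fun do rewrite -rmorphM.
have u2E : creal u2 = crestr (~` B) (creal u).
  by apply/funext => x; rewrite /crestr -rmorphM.
have hu2 : rLp u2 by rewrite u2E crestr_Lp//; exact: measurableC.
have uE : u = (fun x => u1 x + u2 x).
  apply/funext => x; rewrite /u1 /u2 !indicE in_setC.
  by case: (x \in B) => /=; ring.
have u1_bd x : `|u1 x| <= n%:R.
  rewrite /u1 indicE; have [|_] := boolP (x \in B).
    by rewrite inE /B /= mul1r -normc_real.
  by rewrite mul0r normr0.
have l1 : l u1 = \int[mu]_x (u1 x * w x).
  by apply: l_bounded u1_bd; have [] := cLfun_cmeasurable hu1.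
have -> : l u - \int[mu]_x (u x * w x) = l u2 - \int[mu]_x (u2 x * w x).
  rewrite [u in l u]uE lD// l1 [in X in _ - X = _]uE.
  under [X in _ - X = _]eq_Rintegral do rewrite mulrDl.
  rewrite RintegralD//; first by ring.
    apply: (@RintM _ n%:R) => //.
    by have [] := cLfun_cmeasurable hu1.
  have := Rint_ReM pq hu2 w_Lq; apply: eq_integrable => // x _ /=.
  by congr EFin; ring.
rewrite (le_trans (ler_normB _ _))// mulrDl lerD//.
  rewrite (le_trans (l_bd hu2))//.
  apply: (@le_trans _ _ (`|K| * nrm mu p%:E (creal u2))).
    by rewrite ler_wpM2r ?nrm_ge0// ler_norm.
  by rewrite ler_wpM2l// u2E ltW.
rewrite uw// (le_trans (abs_Re_le_normc _))// (le_trans (cpairing_le pq hu2 w_Lq))//.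
by rewrite mulrC ler_wpM2l ?nrm_ge0// u2E ltW.
Qed.

Lemma riesz_density : rLq w /\ (forall u, rLp u -> l u = \int[mu]_x (u x * w x)).
Proof. by split; [exact: w_Lq|exact: l_repr]. Qed.

End Density.

Lemma riesz_real : exists w, rLq w /\
  (forall u, rLp u -> l u = \int[mu]_x (u x * w x)).
Proof. by have [w [mw Iw wE]] := ex_density; exists w; exact: riesz_density. Qed.

End RieszReal.

(** * Classes of functions and their representatives *)

Section Classes.
Context d (T : measurableType d) (R : realType).
Variables (mu : {measure set T -> \bar R}) (P : \bar R) (P1 : (1 <= P)%E).
Local Notation C := R[i].
Local Notation L := (cLspace mu P1).
Implicit Types f g : L.

Lemma cLspace_Lfun f : (f : T -> C) \in cLfun mu P.
Proof. exact: valP (repr f). Qed.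

Lemma cLspace_cmeasurable f : cmeasurable f.
Proof. exact: cLfun_cmeasurable (cLspace_Lfun f). Qed.

Lemma cLspace_ext f g : {ae mu, forall x, f x = g x} -> f = g.
Proof.
move=> fg; rewrite -[f]reprK -[g]reprK; apply/eqP.
rewrite -Quotient.idealrBE inE; apply: filterS fg => x fgx.
rewrite raddfB -[LHS]/(\val (repr f) x - \val (repr g) x); apply/eqP.
by rewrite subr_eq0; apply/eqP.
Qed.

Lemma cLspaceP_ae (a : C) f g :
  {ae mu, forall x, (a *: f + g : L) x = a * f x + g x}.
Proof.
have -> : a *: f + g = \pi_L (a *: repr f + repr g).
  by rewrite -{1}[f]reprK -{1}[g]reprK -[_ *: _]/(cLscale a _) -pi_cLscale -raddfD.
apply: filterS (cLspace_fun_pi (a *: repr f + repr g)) => x ->.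
by [].
Qed.

Lemma cLspace0_ae : {ae mu, forall x, (0 : L) x = 0}.
Proof.
have -> : (0 : L) = \pi_L 0 by rewrite raddf0.
by apply: filterS (cLspace_fun_pi (0 : cLfunType mu P1)) => x ->.
Qed.

Lemma cLspaceB_ae f g : {ae mu, forall x, (f - g : L) x = f x - g x}.
Proof.
rewrite addrC -scaleN1r; apply: filterS (cLspaceP_ae (-1) g f) => x ->.
by rewrite mulN1r addrC.
Qed.

(** A function outside [cLfun mu P] gets the default class 0. *)
Definition cls (f : T -> C) : L := \pi_L (insubd (0 : cLfunType mu P1) f).

Lemma cls_ae (f : T -> C) : f \in cLfun mu P -> {ae mu, forall x, cls f x = f x}.
Proof.
move=> hf; apply: filterS (cLspace_fun_pi (insubd (0 : cLfunType mu P1) f)) => x ->.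
by rewrite insubdK.
Qed.

Lemma cls_eq (f : T -> C) g : f \in cLfun mu P -> {ae mu, forall x, f x = g x} ->
  cls f = g.
Proof.
move=> hf fg; apply: cLspace_ext.
by apply: filterS2 (cls_ae hf) fg => x -> ->.
Qed.

Lemma clsK f : cls f = f.
Proof. by apply: cls_eq; [exact: cLspace_Lfun|exact: aeW]. Qed.

Lemma cls_lin a (f g : T -> C) : f \in cLfun mu P -> g \in cLfun mu P ->
  cls (fun x => a * f x + g x) = a *: cls f + cls g.
Proof.
move=> hf hg; apply: cls_eq; first exact: cLfun_lin.
apply: filterS3 (cLspaceP_ae a (cls f) (cls g)) (cls_ae hf) (cls_ae hg).
by move=> x -> -> ->.
Qed.

Definition lnrm f : R := nrm mu P f.

Lemma lnrm_cls (f : T -> C) : f \in cLfun mu P -> lnrm (cls f) = nrm mu P f.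
Proof.
move=> hf; apply: ae_eq_nrm => //; [exact: cLspace_cmeasurable|exact: cLfun_cmeasurable hf|].
exact: cls_ae.
Qed.

Lemma cLspace_normE f : `|f| = (lnrm f)%:C.
Proof. by []. Qed.

Lemma lnrm_ge0 f : 0 <= lnrm f.
Proof. exact: nrm_ge0. Qed.

Lemma lnrmD f g : lnrm (f + g) <= lnrm f + lnrm g.
Proof. by rewrite -lecR rmorphD /= -!cLspace_normE ler_normD. Qed.

Lemma lnrmB f g : lnrm (f - g) <= lnrm f + lnrm g.
Proof. by rewrite -lecR rmorphD /= -!cLspace_normE ler_normB. Qed.

Lemma lnrmBC f g : lnrm (f - g) = lnrm (g - f).
Proof. by apply: (@complexI R); rewrite -!cLspace_normE distrC. Qed.

Lemma lnrmZ a f : lnrm (a *: f) = normc a * lnrm f.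
Proof. by apply: (@complexI R); rewrite rmorphM /= -!cLspace_normE normrZ. Qed.

Lemma lnrmBE f g : lnrm (f - g) = nrm mu P (fun x => f x - g x).
Proof.
apply: ae_eq_nrm => //; last exact: cLspaceB_ae.
  exact: cLspace_cmeasurable.
by apply: (@cLfun_cmeasurable _ _ _ mu P); apply: cLfunB => //; exact: cLspace_Lfun.
Qed.

Lemma lnrm_eq0 f : lnrm f = 0 -> f = 0.
Proof. by move=> h; apply/normr0_eq0; rewrite cLspace_normE h. Qed.

Lemma lnrm0 : lnrm 0 = 0.
Proof. by apply: (@complexI R); rewrite -cLspace_normE normr0. Qed.

End Classes.

Section BoundedOperators.
Context (R : realType) (E F : normedModType R[i]).

Definition linear_of (f : E -> F) (lf : linear f) : {linear E -> F} :=
  HB.pack f (GRing.isLinear.Build _ E F *:%R f lf).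

Lemma linear_of_continuous (f : E -> F) (lf : linear f) (M : R) :
  (forall x, `|f x| <= M%:C * `|x|) -> continuous (linear_of lf).
Proof.
move=> fM; apply: bounded_linear_continuous; apply/linear_boundedP.
exists M%:C; split; first by rewrite complex_real eqxx.
by move=> r Mr x; rewrite (le_trans (fM x))// ler_wpM2r// ltW.
Qed.

Definition bounded_op_of (f : E -> F) (lf : linear f) (M : R)
    (fM : forall x, `|f x| <= M%:C * `|x|) : boundedOp E F :=
  BoundedOp (linear_of_continuous (lf := lf) fM).

Lemma bounded_op_bound (A : boundedOp E F) : exists2 M : R, 0 <= M &
  forall x, `|A x| <= M%:C * `|x|.
Proof.
have := @linear_bounded_continuous _ _ _ (bop_linear A).
case=> _ /(_ (bop_continuous (b:=A)))/linear_boundedP/pinfty_ex_gt0[M M0 hM].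
(* The bound [M] is a positive element of [R[i]], hence equal to its real part. *)
exists (complex.Re M).
  by move: M0; rewrite ltcE /= => /andP[_ /ltW].
by move=> x; rewrite (_ : _%:C = M)//; apply/RRe_real/gtr0_real.
Qed.

End BoundedOperators.

(** * Duality between spaces of classes *)

Section Duality.
Context d (T : measurableType d) (R : realType).
Variables (mu : {measure set T -> \bar R}) (p q : R) (pq : conjugates p q).
Variables (P Q : \bar R) (PE : P = p%:E) (QE : Q = q%:E).
Variables (P1 : (1 <= P)%E) (Q1 : (1 <= Q)%E).
Local Notation C := R[i].
Local Notation Lp := (cLspace mu P1).
Local Notation Lq := (cLspace mu Q1).
Implicit Types (f : Lp) (g : Lq).

Let f_Lp f : (f : T -> C) \in cLfun mu p%:E.
Proof. by rewrite -PE cLspace_Lfun. Qed.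

Let g_Lq g : (g : T -> C) \in cLfun mu q%:E.
Proof. by rewrite -QE cLspace_Lfun. Qed.

Let f_lnrm f : lnrm f = nrm mu p%:E f.
Proof. by congr (nrm mu _ _). Qed.

Let g_lnrm g : lnrm g = nrm mu q%:E g.
Proof. by congr (nrm mu _ _). Qed.

Let f_lnrmB f f' : lnrm (f - f') = nrm mu p%:E (fun x => f x - f' x).
Proof. by rewrite lnrmBE; congr (nrm mu _ _). Qed.

(** [P] and [Q] stay variables, tied to [p] and [q] by equations, because the dual exponent is given
    as a [hoelder_conjugate], equal to [q%:E] only propositionally, and the types of classes depend
    on it. *)
Definition lpair f g : C := cpairing mu f g.

Lemma lpair_linl a f f' g : lpair (a *: f + f') g = a * lpair f g + lpair f' g.
Proof.
rewrite /lpair -(cpairing_linl pq)//.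
apply: ae_eq_cpairing; last exact: cLspaceP_ae.
- exact: cLspace_cmeasurable.
- by apply: (@cLfun_cmeasurable _ _ _ mu P); apply: cLfun_lin => //; exact: cLspace_Lfun.
- exact: cLspace_cmeasurable.
Qed.

Lemma lpair0l g : lpair 0 g = 0.
Proof.
have := lpair_linl (-1) 0 0 g; rewrite scaler0 addr0 => ->; ring.
Qed.

Lemma lpairZl a f g : lpair (a *: f) g = a * lpair f g.
Proof. by rewrite -[a *: f]addr0 lpair_linl lpair0l addr0. Qed.

Lemma lpairBl f f' g : lpair (f - f') g = lpair f g - lpair f' g.
Proof. by rewrite addrC -scaleN1r lpair_linl mulN1r addrC. Qed.

Lemma lpair_le f g : normc (lpair f g) <= lnrm f * lnrm g.
Proof.
rewrite /lpair (le_trans (cpairing_le pq (f_Lp f) (g_Lq g)))//.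
by rewrite f_lnrm g_lnrm.
Qed.

Definition duality_map f : Lq := cls mu Q1 (fun x => jmap p (f x)).

Let j_Lq f : (fun x => jmap p (f x)) \in cLfun mu Q.
Proof. by rewrite QE (cLfun_jmap pq). Qed.

Lemma lnrm_duality_map f : lnrm (duality_map f) = lnrm f `^ (p - 1).
Proof.
by rewrite lnrm_cls// f_lnrm -(nrm_jmap pq)// QE.
Qed.

Lemma lpair_duality f f' :
  lpair f (duality_map f') = cpairing mu f (fun x => jmap p (f' x)).
Proof.
rewrite /lpair cpairingC [RHS]cpairingC; apply: ae_eq_cpairing.
- exact: cLspace_cmeasurable.
- exact: cLfun_cmeasurable (j_Lq f').
- exact: cLspace_cmeasurable.
- exact: cls_ae.
Qed.

Lemma lpair_duality_map f : lpair f (duality_map f) = (lnrm f `^ p)%:C.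
Proof. by rewrite lpair_duality (cpairing_jmap pq)// f_lnrm. Qed.

(** The witness is the duality image of [f] divided by its norm. *)
Lemma norming f : exists2 g, lnrm g <= 1 & lpair f g = (lnrm f)%:C.
Proof.
have [f0|f0] := eqVneq (lnrm f) 0.
  exists 0; first by rewrite lnrm0.
  by rewrite (lnrm_eq0 f0) lnrm0 lpair0l.
have fp : 0 < lnrm f by rewrite lt_neqAle eq_sym f0 lnrm_ge0.
set h := (lnrm f)^-1%:C *: f.
have h1 : lnrm h = 1.
  by rewrite lnrmZ normc_real ger0_norm ?invr_ge0 ?lnrm_ge0// mulVf.
exists (duality_map h); first by rewrite lnrm_duality_map h1 one_powR.
have fE : f = (lnrm f)%:C *: h.
  by rewrite /h scalerA -rmorphM mulfV// rmorph1 scale1r.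
rewrite {1}fE lpairZl lpair_duality_map h1 one_powR.
by rewrite mulr1.
Qed.

Lemma radon_riesz_space eta : 0 < eta -> exists2 delta, 0 < delta &
  forall f', lnrm f' = 1 -> exists2 g, lpair f' g = 1 &
  forall f, lnrm f <= 1 -> 1 - delta < complex.Re (lpair f g) -> lnrm (f - f') < eta.
Proof.
move=> eta0; have [delta d0 h] := radon_riesz mu pq eta0.
exists delta => // f' f'1; exists (duality_map f').
  by rewrite lpair_duality_map f'1 one_powR.
move=> f f1; rewrite lpair_duality f_lnrmB; apply: h => //; by rewrite -f_lnrm.
Qed.

(** Strict convexity, read off from Radon-Riesz: the pairing equals 1, hence exceeds [1 - delta] for
    every [delta], and the distance is below every [e]. *)
Lemma norming_unique f f' : lnrm f' = 1 -> lnrm f <= 1 ->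
  lpair f (duality_map f') = 1 -> f = f'.
Proof.
move=> f'1 f1 ff'; apply: subr0_eq; apply: lnrm_eq0; apply/eqP.
rewrite eq_le lnrm_ge0 andbT; apply/ler_addgt0Pr => e e0.
rewrite add0r ltW//; have [delta d0 h] := radon_riesz mu pq e0.
rewrite f_lnrmB; apply: h => //; try by rewrite -f_lnrm.
by rewrite -lpair_duality ff' /= ltrBlDr ltrDl.
Qed.

Lemma lpair_linear g : linear ((fun f => lpair f g) : Lp -> C^o).
Proof. by move=> a f f'; rewrite lpair_linl. Qed.

Lemma lpair_bounded g f : `|lpair f g : C^o| <= (lnrm g)%:C * `|f|.
Proof. by rewrite cLspace_normE -rmorphM /= mulrC lecR lpair_le. Qed.

Definition lpair_functional g : dual_space Lp :=
  bounded_op_of (lpair_linear g) (lpair_bounded g).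

End Duality.

(** * Riesz representation over the complex numbers and the adjoint *)

Section Riesz.
Context d (T : measurableType d) (R : realType).
Variables (mu : {finite_measure set T -> \bar R}) (p q : R) (pq : conjugates p q).
Variables (P Q : \bar R) (PE : P = p%:E) (QE : Q = q%:E).
Variables (P1 : (1 <= P)%E) (Q1 : (1 <= Q)%E).
Local Notation C := R[i].
Local Notation Lp := (cLspace mu P1).
Local Notation Lq := (cLspace mu Q1).
Local Notation creal u := (fun x => (u x)%:C : C).
Local Notation imag := (0 +i* 1 : C).

Let real_cLfun (u : T -> R) (f : T -> C) : f \in cLfun mu P ->
  measurable_fun [set: T] u -> (forall x, `|u x| <= normc (f x)) ->
  creal u \in cLfun mu P.
Proof.
have p0 := conjugates_gt0 pq.
rewrite PE => /(cLfunP mu f p0)[mf If] mu' uf.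
apply: (cLfun_dom p0 (cmeasurable_real mu') _ If) => x.
by rewrite normc_real ge0_ler_powR ?nnegrE ?normc_ge0// ltW.
Qed.

(** On real functions the real and imaginary parts of [phi] are real-linear and bounded, with
    densities [w1] and [w2]. Then [w1 + i w2] represents [phi] on real functions, and complex
    linearity does the rest. *)
Lemma riesz_representation (phi : dual_space Lp) :
  exists g : Lq, forall f : Lp, phi f = lpair f g.
Proof.
have [K K0 hK] := bounded_op_bound phi.
have {}hK f : normc (phi f) <= K * lnrm f.
  by have := hK f; rewrite cLspace_normE -rmorphM /= lecR.
have rlin a u v : creal u \in cLfun mu p%:E -> creal v \in cLfun mu p%:E ->
    phi (cls mu P1 (creal (fun x => a * u x + v x))) =
    a%:C * phi (cls mu P1 (creal u)) + phi (cls mu P1 (creal v)).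
  rewrite -PE => hu hv; rewrite -[RHS]linearP -cls_lin//.
  by congr (phi (cls _ _ _)); apply/funext => x; rewrite rmorphD rmorphM.
have bd u : creal u \in cLfun mu p%:E ->
    normc (phi (cls mu P1 (creal u))) <= K * nrm mu p%:E (creal u).
  by rewrite -PE => hu; rewrite (le_trans (hK _))// lnrm_cls.
have Rlin a u v : creal u \in cLfun mu p%:E -> creal v \in cLfun mu p%:E ->
    complex.Re (phi (cls mu P1 (creal (fun x => a * u x + v x)))) =
    a * complex.Re (phi (cls mu P1 (creal u))) + complex.Re (phi (cls mu P1 (creal v))).
  by move=> hu hv; rewrite rlin// Re_scaleD /= mul0r subr0.
have Ilin a u v : creal u \in cLfun mu p%:E -> creal v \in cLfun mu p%:E ->
    complex.Im (phi (cls mu P1 (creal (fun x => a * u x + v x)))) =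
    a * complex.Im (phi (cls mu P1 (creal u))) + complex.Im (phi (cls mu P1 (creal v))).
  by move=> hu hv; rewrite rlin// Im_scaleD /= mul0r addr0.
have [w1 [hw1 w1E]] := riesz_real pq Rlin
  (fun u hu => le_trans (abs_Re_le_normc _) (bd u hu)).
have [w2 [hw2 w2E]] := riesz_real pq Ilin
  (fun u hu => le_trans (abs_Im_le_normc _) (bd u hu)).
pose g0 x : C := imag * (w2 x)%:C + (w1 x)%:C.
have Q1' : (1 <= q%:E)%E by rewrite -QE.
have hg0 : g0 \in cLfun mu q%:E by exact: cLfun_lin.
have pairE u : creal u \in cLfun mu p%:E ->
    phi (cls mu P1 (creal u)) = cpairing mu (creal u) g0.
  move=> hu; apply/eqP; rewrite eq_complex w1E// w2E//; apply/andP; split; apply/eqP.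
    by apply: eq_Rintegral => x _; rewrite /g0 /=; ring.
  by apply: eq_Rintegral => x _; rewrite /g0 /=; ring.
exists (cls mu Q1 g0) => f.
have hf := cLspace_Lfun f; have [mf1 mf2] := cLspace_cmeasurable f.
pose u x := complex.Re (f x); pose v x := complex.Im (f x).
have hu : creal u \in cLfun mu P.
  by apply: real_cLfun hf _ _ => // x; exact: abs_Re_le_normc.
have hv : creal v \in cLfun mu P.
  by apply: real_cLfun hf _ _ => // x; exact: abs_Im_le_normc.
have fE : (f : T -> C) = (fun x => imag * (v x)%:C + (u x)%:C).
  apply/funext => x; rewrite /u /v; case: (f x) => a b; apply/eqP.
  by rewrite eq_complex /=; apply/andP; split; apply/eqP; ring.
have -> : lpair f (cls mu Q1 g0) = cpairing mu f g0.
  rewrite /lpair cpairingC [RHS]cpairingC; apply: ae_eq_cpairing.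
  - exact: cLspace_cmeasurable.
  - exact: cLfun_cmeasurable hg0.
  - exact: cLspace_cmeasurable.
  - by apply: cls_ae; rewrite QE.
rewrite {1}fE (cpairing_linl pq)//; try by rewrite -PE.
rewrite -!pairE; try by rewrite -PE.
rewrite -[RHS]linearP -cls_lin// -fE clsK.
by [].
Qed.

(** Riesz representation provides a solution of the equation that defines the adjoint, so [xget]
    returns a solution and not its default. *)
Lemma adjointP (A : boundedOp Lp Lp) (f : Lp) (g : Lq) :
  lpair (A f) g = lpair f (cLadjoint Q1 A g).
Proof.
have lA : linear ((fun f => lpair (A f) g) : Lp -> C^o).
  by move=> a u v; rewrite linearP (lpair_linl pq PE QE).
have [K K0 hK] := bounded_op_bound A.
have bA u : `|lpair (A u) g : C^o| <= (lnrm g * K)%:C * `|u|.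
  have := hK u; rewrite !cLspace_normE -!rmorphM /= !lecR => h.
  rewrite (le_trans (lpair_le pq PE QE _ _))// mulrC -mulrA.
  by rewrite ler_wpM2l// lnrm_ge0.
have [h hE] := riesz_representation (bounded_op_of lA bA).
rewrite /cLadjoint; set S := [set _ | _].
have : S (xget 0 S) by apply: (@xgetPex _ 0 S); exists h => u; exact: hE.
exact.
Qed.

End Riesz.

Section Lebesgue01.
Context (R : realType).
Local Notation mu := (lebesgue01 R).

Lemma lebesgue01T : mu [set: R] = 1%E.
Proof.
rewrite -[LHS]/(lebesgue_measure ([set: R] `&` `[0%R, 1%R])) setTI.
rewrite lebesgue_measure_itv /= lte_fin ltr01.
by rewrite oppr0 addr0.
Qed.

Lemma lebesgue01_fin_num : fin_num_fun mu.
Proof.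
move=> A mA; rewrite ge0_fin_numE//; apply: (@le_lt_trans _ _ (mu [set: R])).
  by apply: le_measure; rewrite ?inE.
by rewrite lebesgue01T ltry.
Qed.

(** The same set function packed with its finiteness, so that the Riesz results transfer to
    [lebesgue01] by conversion. *)
Definition lebesgue01_finite :
  {finite_measure set (measurableTypeR R) -> \bar R} :=
  HB.pack (Measure.sort mu) (Measure.on (Measure.sort mu))
    (Measure_isFinite.Build _ _ _ (Measure.sort mu) lebesgue01_fin_num).

End Lebesgue01.

(** * Operator topologies *)

Section CvgInitial.
Context (S : choiceType) (T : topologicalType) (w : S -> T).

Lemma cvg_initial (F : set_system S) (FF : Filter F) (x : S) :
  w @ F --> w x -> F --> (x : initial_topology w).
Proof.
move=> cv A; rewrite nbhsE => -[V [[B oB <-] Bx] sub].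
by apply: filterS sub _; apply: cv; exact: open_nbhs_nbhs.
Qed.

End CvgInitial.

Lemma cvg_ptws (I : Type) (K : topologicalType) (F : set_system (I -> K))
    (FF : Filter F) (f : I -> K) :
  (forall i, g i @[g --> F] --> f i) -> F --> (f : {ptws I -> K}).
Proof.
move=> cv; apply/cvg_sup => i.
by apply: (@cvg_initial _ _ (fun g : forall _ : I, K => g i)); exact: cv.
Qed.

Lemma ptws_eval_continuous (I : Type) (K : topologicalType) (i : I) :
  continuous (fun g : {ptws I -> K} => g i).
Proof.
move=> f; have /cvg_sup/(_ i) cv : nbhs f --> (f : {ptws I -> K}) by exact: cvg_id.
apply: cvg_trans (@initial_continuous _ _ (fun g : forall _ : I, K => g i) f).
by apply: cvg_app; exact: cv.
Qed.

Section TopologyOn.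
Context (X : choiceType) (A : set X) (tau : Topological X).
Local Notation XT := (Topological.Pack tau).

Lemma cvg_topology_on (F : set_system (topology_on A tau)) (FF : Filter F)
    (x : topology_on A tau) :
  (set_val : topology_on A tau -> XT) @ F --> (set_val x : XT) -> F --> x.
Proof. exact: (@cvg_initial _ XT set_val F FF x). Qed.

Lemma set_val_continuous :
  continuous (set_val : topology_on A tau -> XT).
Proof. exact: (@initial_continuous _ XT set_val). Qed.

End TopologyOn.

Section OperatorConvergence.
Context (K : numFieldType) (E F : normedModType K) (A : set (boundedOp E F)).
Local Notation ev y := (set_val y : boundedOp E F).

Lemma SOT_cvg (G : set_system (topology_on A SOT)) (FG : Filter G)
    (x : topology_on A SOT) :
  (forall f, ev y f @[y --> G] --> ev x f) -> G --> x.
Proof.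
move=> cv; apply: cvg_topology_on.
apply: (@cvg_initial _ _ (fun B : boundedOp E F => (B : E -> F) : {ptws E -> F})).
by apply: cvg_ptws; exact: cv.
Qed.

Lemma WOT_cvg (G : set_system (topology_on A WOT)) (FG : Filter G)
    (x : topology_on A WOT) :
  (forall f (phi : dual_space F), phi (ev y f) @[y --> G] --> (phi (ev x f) : K^o)) ->
  G --> x.
Proof.
move=> cv; apply: cvg_topology_on.
apply: (@cvg_initial _ _ (fun B : boundedOp E F =>
    (fun xphi : E * dual_space F => xphi.2 (B xphi.1))
      : {ptws (E * dual_space F) -> K^o})).
by apply: cvg_ptws => -[f phi]; exact: cv.
Qed.

Lemma SOT_eval_continuous (f : E) :
  continuous (fun y : topology_on A SOT => ev y f).
Proof.
move=> x; have := @set_val_continuous _ A SOT x.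
move=> /(@continuous_comp _ _ _ _ (fun B : initial_topology (fun B : boundedOp E F =>
   (B : E -> F) : {ptws E -> F}) => (B : {ptws E -> F})) x).
move=> /(_ (@initial_continuous _ _ _ _)) h.
exact: (continuous_comp h (@ptws_eval_continuous _ _ f _)).
Qed.

Lemma WOT_eval_continuous (f : E) (phi : dual_space F) :
  continuous (fun y : topology_on A WOT => (phi (ev y f) : K^o)).
Proof.
move=> x; have := @set_val_continuous _ A WOT x.
move=> /(@continuous_comp _ _ _ _ (fun B : initial_topology (fun B : boundedOp E F =>
   (fun xphi : E * dual_space F => xphi.2 (B xphi.1)) : {ptws E * dual_space F -> K^o})
     => ((fun xphi : E * dual_space F => xphi.2 ((B : boundedOp E F) xphi.1)) : {ptws E * dual_space F -> K^o})) x).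
move=> /(_ (@initial_continuous _ _ _ _)) h.
exact: (continuous_comp h (@ptws_eval_continuous _ _ (f, phi) _)).
Qed.

End OperatorConvergence.

Lemma powR_le (R : realType) (a x y : R) : 0 <= a -> 0 <= x -> x <= y ->
  x `^ a <= y `^ a.
Proof.
by move=> a0 x0 xy; rewrite ge0_ler_powR ?nnegrE//; exact: le_trans xy.
Qed.

(** * Density of the positive invertible isometries *)

Section SubinvariantWeights.
Context (R : realType) (p q : R) (pq : conjugates p q) (I : finType).
Variables (m : I -> R) (t : I -> I -> R) (theta : R).
Hypotheses (m0 : forall i, 0 < m i) (t0 : forall i j, 0 <= t i j).
Hypothesis theta1 : theta < 1.
Hypothesis t_contraction : forall c b : I -> R,
  (forall i, 0 <= c i) -> (forall j, 0 <= b j) ->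
  \sum_i \sum_j c i * b j * t i j <=
  theta * ((\sum_i c i `^ p * m i) / p + (\sum_j b j `^ q * m j) / q).

Let p0 := conjugates_gt0 pq.
Let q0 := conjugates_gt0 (conjugatesC pq).
Let p1 := conjugates_gt1 pq.
Let q1 := conjugates_gt1 (conjugatesC pq).

Let p10 : 0 <= p - 1. Proof. by rewrite subr_ge0 ltW. Qed.
Let q10 : 0 <= q - 1. Proof. by rewrite subr_ge0 ltW. Qed.
Let mge0 i : 0 <= m i. Proof. exact: ltW. Qed.

(* The term [1] keeps the weights positive.  The iterates increase and, since
   [theta < 1], stay bounded; so at some step all [c i ^ (p - 1) * m i] grow by
   at most [1], which gives both inequalities without passing to the limit. *)
Let bof (c : I -> R) j := ((\sum_i c i * t i j + 1) / m j) `^ (p - 1).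
Let cof (b : I -> R) i := ((\sum_j b j * t i j + 1) / m i) `^ (q - 1).
Let cs n := iter n (fun c => cof (bof c)) (fun=> 0).

Let sum_ge0 (c : I -> R) (s : I -> R) : (forall i, 0 <= c i) -> (forall i, 0 <= s i) ->
  0 <= \sum_i c i * s i.
Proof. by move=> c0 s0; apply: sumr_ge0 => i _; rewrite mulr_ge0. Qed.

Let bofE c j : (forall i, 0 <= c i) ->
  bof c j `^ (q - 1) * m j = \sum_i c i * t i j + 1.
Proof.
move=> c0; rewrite /bof (powR_conjK pq) ?divfK ?gt_eqF//.
by rewrite divr_ge0 ?addr_ge0 ?sum_ge0// ltW.
Qed.

Let cofE b i : (forall j, 0 <= b j) ->
  cof b i `^ (p - 1) * m i = \sum_j b j * t i j + 1.
Proof.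
move=> b0; rewrite /cof (powR_conjK (conjugatesC pq)) ?divfK ?gt_eqF//.
by rewrite divr_ge0 ?addr_ge0 ?sum_ge0// ltW.
Qed.

Let bof_le c c' : (forall i, 0 <= c i <= c' i) -> forall j, bof c j <= bof c' j.
Proof.
move=> cc' j; rewrite /bof.
have c0 i : 0 <= c i by have /andP[] := cc' i.
have c'0 i : 0 <= c' i by have /andP[] := cc' i; exact: le_trans.
rewrite powR_le// ?divr_ge0 ?addr_ge0 ?sum_ge0// ler_pM2r ?invr_gt0// lerD2r ler_sum// => i _.
by rewrite ler_wpM2r//; have /andP[] := cc' i.
Qed.

Let cof_le b b' : (forall i, 0 <= b i <= b' i) -> forall j, cof b j <= cof b' j.
Proof.
move=> bb' j; rewrite /cof.
have b0 i : 0 <= b i by have /andP[] := bb' i.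
have b'0 i : 0 <= b' i by have /andP[] := bb' i; exact: le_trans.
rewrite powR_le// ?divr_ge0 ?addr_ge0 ?sum_ge0// ler_pM2r ?invr_gt0// lerD2r ler_sum// => i _.
by rewrite ler_wpM2r//; have /andP[] := bb' i.
Qed.

Let cs_ge0 n i : 0 <= cs n i.
Proof. by case: n => [|n]; rewrite /cs//= powR_ge0. Qed.

Let bs_ge0 n j : 0 <= bof (cs n) j.
Proof. exact: powR_ge0. Qed.

Let cs_le n i : cs n i <= cs n.+1 i.
Proof.
elim: n i => [|n IH] i; first exact: cs_ge0.
apply: cof_le => j; rewrite bs_ge0/=; apply: bof_le => k.
by rewrite cs_ge0 IH.
Qed.

(** The constant is the threshold [k] at which [eta mi k ^ (a - 1) = 1]; beyond it the power
    dominates the identity. *)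
Let linear_bound (a b eta x mi : R) : conjugates a b -> 0 < eta -> 0 < mi -> 0 <= x ->
  x <= eta * (x `^ a * mi) + ((eta * mi)^-1) `^ (b - 1).
Proof.
move=> ab eta0 mi0 x0; have a1 := conjugates_gt1 ab.
set k := _ `^ (b - 1); have k0 : 0 <= k by exact: powR_ge0.
have em : 0 < eta * mi by rewrite mulr_gt0.
have [xk|kx] := leP x k.
  by rewrite (le_trans xk)// lerDr mulrCA mulr_ge0 ?powR_ge0// ltW.
rewrite -[leLHS]addr0 lerD// powRB1// -mulrA mulrCA ler_peMr//.
rewrite mulrC -mulrA mulrC -ler_pdivrMl ?mulr1 1?[mi * _]mulrC//.
rewrite -(powR_conjK (conjugatesC ab) (_ : 0 <= (eta * mi)^-1)); last first.
  by rewrite invr_ge0 ltW.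
by rewrite powR_le// ?subr_ge0 ltW.
Qed.

(** Let [X], [Y] be the p- and q-masses of an iterate and [B] its bilinear form. Monotonicity gives
    [X <= B + sum c], the recursion gives [Y = B + sum b], and the hypothesis bounds [B] by
    [theta (X / p + Y / q)]. The linear sums cost [eta (X / p + Y / q)] plus a constant. As [eta] is
    half of [1 - theta], another [eta (X / p + Y / q)] remains and is bounded by [D]. *)
Let cs_bounded : exists M, forall n i, cs n i <= M.
Proof.
pose eta := (1 - theta) / 2; have eta0 : 0 < eta by rewrite divr_gt0// subr_gt0.
pose D := (\sum_i ((eta * m i)^-1) `^ (q - 1)) / p + (\sum_i ((eta * m i)^-1) `^ (p - 1)) / q.
have D0 : 0 <= D.
  by rewrite addr_ge0// divr_ge0// ?(ltW p0) ?(ltW q0)//; apply: sumr_ge0 => i _; exact: powR_ge0.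
exists (eta * (p * (D / eta)) + \sum_i ((eta * m i)^-1) `^ (q - 1)) => n i.
pose X := \sum_i cs n i `^ p * m i; pose Y := \sum_j bof (cs n) j `^ q * m j.
pose B := \sum_i \sum_j cs n i * bof (cs n) j * t i j.
have X0 : 0 <= X by apply: sumr_ge0 => k _; rewrite mulr_ge0 ?powR_ge0.
have Y0 : 0 <= Y by apply: sumr_ge0 => k _; rewrite mulr_ge0 ?powR_ge0.
have XB : X <= B + \sum_i cs n i.
  rewrite /X /B -big_split; apply: ler_sum => k _ /=.
  rewrite powRB1// -mulrA.
  apply: (@le_trans _ _ (cs n k * (cs n.+1 k `^ (p - 1) * m k))).
    rewrite ler_wpM2l// ler_pM2r// powR_le//; exact: cs_le.
  rewrite [cs n.+1 k]/(cof (bof (cs n)) k) cofE// mulrDr mulr1 lerD2r.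
  by rewrite mulr_sumr ler_sum// => j _; rewrite mulrA.
have YB : Y = B + \sum_j bof (cs n) j.
  rewrite /Y /B exchange_big -big_split; apply: eq_bigr => k _ /=.
  rewrite powRB1// -mulrA bofE// mulrDr mulr1; congr (_ + _).
  by rewrite mulr_sumr; apply: eq_bigr => j _; rewrite mulrA [_ * bof _ _]mulrC.
have BE : B <= theta * (X / p + Y / q) by exact: t_contraction.
have cX : \sum_i cs n i <= eta * X + \sum_i ((eta * m i)^-1) `^ (q - 1).
  by rewrite /X mulr_sumr -big_split; apply: ler_sum => k _; exact: linear_bound.
have bY : \sum_i bof (cs n) i <= eta * Y + \sum_i ((eta * m i)^-1) `^ (p - 1).
  rewrite /Y mulr_sumr -big_split; apply: ler_sum => k _.
  by apply: linear_bound => //; exact: conjugatesC.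
have EE : eta * (X / p + Y / q) <= D.
  have h1 : X / p <= (B + (eta * X + \sum_i ((eta * m i)^-1) `^ (q - 1))) / p.
    by rewrite ler_pM2r ?invr_gt0// (le_trans XB)// lerD2l.
  have h2 : Y / q <= (B + (eta * Y + \sum_i ((eta * m i)^-1) `^ (p - 1))) / q.
    by rewrite ler_pM2r ?invr_gt0// {1}YB lerD2l.
  move: h1 h2; rewrite /D; set S1 := \sum_i _; set S2 := \sum_i _ => h1 h2.
  have hB : B / p + B / q = B by rewrite -mulrDr (conjugates_inv pq) mulr1.
  have : X / p + Y / q <= theta * (X / p + Y / q) + eta * (X / p + Y / q) + (S1 / p + S2 / q).
    apply: (le_trans (lerD h1 h2)).
    have -> : (B + (eta * X + S1)) / p + (B + (eta * Y + S2)) / q =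
      (B / p + B / q) + eta * (X / p + Y / q) + (S1 / p + S2 / q) by ring.
    by rewrite hB !lerD2r.
  rewrite -/eta; have -> : theta = 1 - 2 * eta by rewrite /eta mulrCA mulfV// mulr1; ring.
  lra.
have XD : X <= p * (D / eta).
  rewrite -ler_pdivrMl// mulrC ler_pdivlMr// mulrC (le_trans _ EE)//.
  rewrite [leLHS]mulrC ler_pM2l// [leLHS]mulrC lerDl divr_ge0//.
  exact: ltW.
have : cs n i <= eta * (cs n i `^ p * m i) + ((eta * m i)^-1) `^ (q - 1).
  exact: linear_bound.
move=> /le_trans; apply; rewrite lerD//.
  rewrite ler_pM2l// (le_trans _ XD)// /X (bigD1 i)//= lerDl.
  by rewrite sumr_ge0// => k _; rewrite mulr_ge0 ?powR_ge0.
by rewrite (bigD1 i)//= lerDl sumr_ge0// => k _; exact: powR_ge0.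
Qed.

Lemma subinvariant_weights : exists c b : I -> R,
  [/\ forall i, 0 < c i, forall j, 0 < b j,
      forall i, \sum_j b j * t i j <= c i `^ (p - 1) * m i &
      forall j, \sum_i c i * t i j <= b j `^ (q - 1) * m j].
Proof.
pose x n i := cs n i `^ (p - 1) * m i.
have [M hM] := cs_bounded.
have xM n : \sum_i x n i <= \sum_i `|M| `^ (p - 1) * m i.
  apply: ler_sum => i _; rewrite ler_pM2r// powR_le//.
  by rewrite (le_trans (hM n i))// ler_norm.
have x_le n i : x n i <= x n.+1 i.
  by rewrite ler_pM2r//; apply: powR_le.
(* Otherwise the total of [x] would grow by more than 1 at each step, against [xM]. Indices start at
   [n.+1] because [cs 0] vanishes while weights must be positive. The 1 in the growth bound cancels
   the 1 of the recursion. *)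
have [n hn] : exists n, forall i, x n.+2 i <= x n.+1 i + 1.
  apply: contrapT => /forallNP h.
  have step n : n%:R <= \sum_i x n.+1 i.
    elim: n => [|n IH].
      by apply: sumr_ge0 => i _; rewrite mulr_ge0 ?powR_ge0.
    have /existsNP[i /negP] := h n; rewrite -ltNge => hi.
    have E (g : I -> R) : \sum_k g k = g i + \sum_(k | k != i) g k by rewrite (bigD1 i).
    rewrite -natr1 E; rewrite E in IH.
    have : \sum_(j | j != i) x n.+1 j <= \sum_(j | j != i) x n.+2 j.
      by apply: ler_sum => j _; exact: x_le.
    move=> le2; apply: (le_trans (lerD IH (lexx 1))); rewrite addrAC.
    by apply: lerD le2; exact: ltW.
  have := truncnS_gt (\sum_i `|M| `^ (p - 1) * m i).
  by rewrite ltNge => /negP; apply; rewrite (le_trans (step _)).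
have tpos b i : (forall j, 0 <= b j) -> 0 < (\sum_j b j * t i j + 1) / m i.
  by move=> b0; rewrite divr_gt0// ltr_wpDl// sum_ge0.
exists (cs n.+1), (bof (cs n.+1)); split.
- by move=> i; rewrite powR_gt0// tpos.
- by move=> j; rewrite powR_gt0// divr_gt0// ltr_wpDl// sum_ge0.
- move=> i; have := hn i.
  have -> : x n.+2 i = \sum_j bof (cs n.+1) j * t i j + 1 by exact: cofE (bs_ge0 n.+1).
  by rewrite lerD2r.
- move=> j; have -> : bof (cs n.+1) j `^ (q - 1) * m j = \sum_i cs n.+1 i * t i j + 1.
    exact: bofE (cs_ge0 n.+1).
  by rewrite lerDl.
Qed.

End SubinvariantWeights.

(** * Affine change of variables and tilings of the unit interval *)

Section AffineChange.
Context (R : realType).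
Local Notation leb := (@lebesgue_measure R).

(** By uniqueness of Lebesgue measure: [k] times its image under the affine map agrees with it on
    intervals. *)
Lemma integral_affine (k e : R) (A : set (measurableTypeR R))
    (f : measurableTypeR R -> \bar R) : 0 < k -> measurable A ->
  measurable_fun [set: measurableTypeR R] f -> (forall x, (0 <= f x)%E) ->
  (\int[leb]_(x in A) f x =
   k%:E * \int[leb]_(x in (fun x => k * x + e)%R @^-1` A) f (k * x + e)%R)%E.
Proof.
move=> k0 mA mf f0.
pose phi (x : measurableTypeR R) : measurableTypeR R := k * x + e.
have mphi : measurable_fun [set: measurableTypeR R] phi.
  by apply: measurable_funD => //; apply: measurable_funM.
pose nu0 := measure_function_pushforward__canonical__measure_function_Measure leb mphi.
pose nu := mscale (NngNum (ltW k0)) nu0.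
have nuE B : measurable B -> leb B = nu B.
  apply: lebesgue_measure_unique => _ [[a b] _ <-].
  rewrite -[RHS]/(k%:E * leb (phi @^-1` `]a, b]))%E.
  have -> : phi @^-1` `]a, b] = `](a - e) / k, (b - e) / k]%classic.
    apply/seteqP; split => x; rewrite /phi /= !in_itv/=.
      move=> /andP[h1 h2]; rewrite ltr_pdivrMr// ler_pdivlMr//.
      by apply/andP; split; lra.
    move=> /andP[]; rewrite ltr_pdivrMr// ler_pdivlMr// => h1 h2.
    by apply/andP; split; lra.
  rewrite !lebesgue_measure_itv/= !lte_fin ltr_pM2r ?invr_gt0// ltrD2r.
  case: ifPn => _; last by rewrite mule0.
  rewrite -!EFinB -EFinM; congr EFin; field; exact: lt0r_neq0.
rewrite (@eq_measure_integral _ _ _ _ nu); last by move=> B mB _; exact: nuE.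
rewrite ge0_integral_mscale//=; last exact: measurable_funTS.
rewrite ge0_integral_pushforward//; exact: measurable_funTS.
Qed.

Local Notation mu := (lebesgue01 R).

Lemma integral_lebesgue01 (F : measurableTypeR R -> \bar R) :
  measurable_fun [set: measurableTypeR R] F -> (forall x, (0 <= F x)%E) ->
  (\int[mu]_x F x = \int[leb]_(x in `[0%R, 1%R[) F x)%E.
Proof.
move=> mF F0; rewrite integral_itv_bndo_bndc; last exact: measurable_funTS.
have m01 : measurable (`[0%R, 1%R] : set (measurableTypeR R)) by [].
have h0 : (mu (~` `[0%R, 1%R]) = 0)%E.
  rewrite -[LHS]/(leb (~` `[0%R, 1%R] `&` `[0%R, 1%R])).
  by rewrite setICl measure0.
rewrite (ge0_negligible_integral (measurableC m01))// setTD setCK.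
apply: eq_measure_integral => B mB BA.
rewrite -[LHS]/(leb (B `&` `[0%R, 1%R])).
by rewrite setIidl.
Qed.

End AffineChange.

Section Tilings.
Context (R : realType).
Local Notation leb := (@lebesgue_measure R).
Local Notation mu := (lebesgue01 R).

(** Half-open tiles partition [[0, 1)] exactly, and length 0, which a zero entry of the matrix
    produces, gives an empty tile. *)
Definition in_tile (a len x : R) := a <= x < a + len.

Definition tiling (I : finType) (a len : I -> R) :=
  [/\ forall i x, in_tile (a i) (len i) x -> 0 <= x < 1,
      forall x, 0 <= x < 1 -> exists i, in_tile (a i) (len i) x &
      forall i j x, in_tile (a i) (len i) x -> in_tile (a j) (len j) x -> i = j].

Lemma integral_tiling (I : finType) (a len : I -> R) (F : measurableTypeR R -> \bar R) :
  tiling a len ->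
  measurable_fun [set: measurableTypeR R] F -> (forall x, (0 <= F x)%E) ->
  (\int[mu]_x F x = \sum_i \int[leb]_(x in `[a i, (a i + len i)%R[) F x)%E.
Proof.
move=> [t1 t2 t3] mF F0; rewrite integral_lebesgue01//.
have -> : `[0%R, 1%R[%classic =
    \big[setU/set0]_(i <- index_enum I) (`[a i, (a i + len i)[%classic : set R).
  rewrite -bigcup_seq; apply/seteqP; split => x /=.
    rewrite in_itv/= => /t2[i ix]; exists i => /=; first exact: mem_index_enum.
    by rewrite in_itv.
  by move=> [i _]; rewrite /= !in_itv/=; exact: t1.
rewrite ge0_integral_bigsetU//.
- exact: index_enum_uniq.
- move=> i j _ _ [x [/=]]; rewrite !in_itv/=; exact: t3.
- exact: measurable_funTS.
Qed.

End Tilings.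

(** * Weighted transport from one tiling to another *)

Section Transport.
Context (R : realType) (p : R) (p1 : 1 < p) (I : finType).
Variables (a la b lb w : I -> R).
Hypotheses (ta : tiling a la) (tb : tiling b lb).
Hypotheses (w0 : forall i, 0 < w i) (wE : forall i, w i `^ p * lb i = la i).
Local Notation C := R[i].
Local Notation leb := (@lebesgue_measure R).
Local Notation mu := (lebesgue01 R).

Let p0 : 0 < p. Proof. exact: lt_trans p1. Qed.

(* The affine map from the tile at [b i] onto the tile at [a i]; for an empty tile
   it is meaningless, but its indicator vanishes. *)
Definition tile_map i (x : R) := la i / lb i * x + (a i - la i / lb i * b i).

(** A weighted composition operator: the tile at [a i] is the source, the tile at [b i] the target.
    The result is 0 off [[0, 1)]. *)
Definition transport (f : measurableTypeR R -> C) (x : measurableTypeR R) : C :=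
  \sum_i (w i * \1_`[b i, (b i + lb i)%R[ x)%:C * f (tile_map i x).

Lemma tile_indic (c l x : R) :
  \1_`[c, (c + l)%R[ x = (in_tile c l x)%:R :> R.
Proof.
rewrite indicE; congr (nat_of_bool _)%:R; apply/idP/idP.
  by rewrite inE /= in_itv.
by move=> h; rewrite inE /= in_itv.
Qed.

Lemma transport_in i x f : in_tile (b i) (lb i) x ->
  transport f x = (w i)%:C * f (tile_map i x).
Proof.
move=> ix; have [_ _ t3] := tb.
rewrite /transport (bigD1 i)//= tile_indic ix mulr1 big1 ?addr0// => j ji.
rewrite tile_indic; have [jx|] := boolP (in_tile (b j) (lb j) x).
  by move: ji; rewrite (t3 _ _ _ jx ix) eqxx.
by rewrite mulr0 mul0r.
Qed.

Lemma tile_gt0 (c l x : R) : in_tile c l x -> 0 < l.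
Proof. by move=> /andP[]; lra. Qed.

Lemma la_gt0 i : (0 < la i) = (0 < lb i).
Proof. by rewrite -wE pmulr_rgt0// powR_gt0. Qed.

Lemma tile_mapP i x : in_tile (b i) (lb i) x -> in_tile (a i) (la i) (tile_map i x).
Proof.
move=> ix; have lb0 := tile_gt0 ix; have la0 : 0 < la i by rewrite la_gt0.
have k0 : 0 < la i / lb i by rewrite divr_gt0.
move: ix => /andP[h1 h2]; rewrite /in_tile /tile_map; set k := la i / lb i in k0 *.
have kE : la i = k * lb i by rewrite /k divfK// gt_eqF.
have : 0 <= k * (x - b i) by rewrite mulr_ge0 ?subr_ge0// ltW.
have : 0 < k * (b i + lb i - x) by rewrite mulr_gt0// subr_gt0.
by rewrite kE => h3 h4; apply/andP; split; lra.
Qed.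

Lemma measurable_tile_map i : measurable_fun [set: measurableTypeR R]
  (tile_map i : measurableTypeR R -> measurableTypeR R).
Proof. by apply: measurable_funD => //; apply: measurable_funM. Qed.

Lemma cmeasurable_transport f : cmeasurable f -> cmeasurable (transport f).
Proof.
move=> [m1 m2]; apply: cmeasurable_sum => i; apply: cmeasurable_mul.
  apply: cmeasurable_real; apply: measurable_funM => //.
split; [exact: (measurableT_comp m1 (measurable_tile_map i))|].
exact: (measurableT_comp m2 (measurable_tile_map i)).
Qed.

(** Tile by tile, [w i ^ p] is the Jacobian [la i / lb i] of the affine map. Empty tiles are set
    aside, since there the quotient is meaningless. *)
Lemma integral_transport f : cmeasurable f ->
  (\int[mu]_x (normc (transport f x) `^ p)%:E = \int[mu]_x (normc (f x) `^ p)%:E)%E.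
Proof.
move=> mf; have mfp := measurable_normc_powR p mf.
have mtp := measurable_normc_powR p (cmeasurable_transport mf).
have E0 (g : measurableTypeR R -> C) x : (0 <= (normc (g x) `^ p)%:E)%E.
  by rewrite lee_fin powR_ge0.
rewrite (integral_tiling tb); [|exact/measurable_EFinP|exact: E0].
rewrite [RHS](integral_tiling ta); [|exact/measurable_EFinP|exact: E0].
apply: eq_bigr => i _; have [lb0|lb0] := ltP 0 (lb i); last first.
  have la0 : la i <= 0 by rewrite leNgt la_gt0 -leNgt.
  have T0 (c l : R) : l <= 0 -> `[c, c + l[%classic = set0 :> set R.
    by move=> l0; rewrite -subset0 => x; rewrite /= in_itv/= => /andP[]; lra.
  by rewrite (T0 _ _ lb0) (T0 _ _ la0) !integral_set0.
have la0 : 0 < la i by rewrite la_gt0.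
set k := la i / lb i; have k0 : 0 < k by rewrite divr_gt0.
have kE : la i = k * lb i by rewrite /k divfK// gt_eqF.
have wk : w i `^ p = k by rewrite /k -wE mulfK// gt_eqF.
rewrite (@integral_affine _ k (a i - k * b i) `[a i, a i + la i[)//; [|exact/measurable_EFinP].
have -> : (fun x : R => k * x + (a i - k * b i)) @^-1` `[a i, a i + la i[ =
    `[b i, b i + lb i[%classic.
  apply/seteqP; split => x; rewrite /= !in_itv/= kE.
    move=> /andP[h1 h2]; apply/andP; split.
      by rewrite -(ler_pM2l k0); lra.
    by rewrite -(ltr_pM2l k0); lra.
  move=> /andP[h1 h2].
  have : k * b i <= k * x by rewrite ler_pM2l.
  have : k * x < k * (b i + lb i) by rewrite ltr_pM2l.
  by move=> h3 h4; apply/andP; split; lra.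
rewrite -ge0_integralZl//.
- apply: eq_integral => x; rewrite inE /= in_itv/= => ix.
  rewrite (transport_in _ ix) normcM normc_real gtr0_norm// powRM ?normc_ge0//; last exact: ltW.
  by rewrite wk EFinM /tile_map -/k.
- apply/measurable_EFinP; apply: measurable_funTS.
  exact: (measurableT_comp mfp (measurable_tile_map i)).
- by rewrite lee_fin ltW.
Qed.

Lemma transport_lin c f g x :
  transport (fun y => c * f y + g y) x = c * transport f x + transport g x.
Proof.
rewrite /transport mulr_sumr -big_split; apply: eq_bigr => i _ /=.
by ring.
Qed.

Lemma transport_Lp f : f \in cLfun mu p%:E -> transport f \in cLfun mu p%:E.
Proof.
rewrite !inE => -[mf hf]; split; first exact: cmeasurable_transport.
have pn0 : p != 0 by rewrite gt_eqF.
have h g : (cLnorm mu p%:E g < +oo)%E = (cLnorm mu p%:E g `^ p < +oo)%E.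
  have := cLnorm_ge0 mu p%:E g; case: (cLnorm mu p%:E g) => [r _|_|//].
    by rewrite !ltry.
  by rewrite /poweR (negbTE pn0).
by rewrite h integral_normc_powR// integral_transport// -integral_normc_powR// -h.
Qed.

Lemma nrm_transport f : f \in cLfun mu p%:E ->
  nrm mu p%:E (transport f) = nrm mu p%:E f.
Proof.
move=> hf; have mf := cLfun_cmeasurable hf; have ht := transport_Lp hf.
have : nrm mu p%:E (transport f) `^ p = nrm mu p%:E f `^ p.
  by rewrite (nrm_powR p0 ht) (nrm_powR p0 hf) /Rintegral integral_transport.
move=> /(congr1 (fun y => y `^ p^-1)).
by rewrite -!powRrM mulfV ?gt_eqF// !powRr1 ?nrm_ge0.
Qed.

Lemma transport_ge0 f x : (forall y, 0 <= f y) -> 0 <= transport f x.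
Proof.
move=> f0; apply: sumr_ge0 => i _; apply: mulr_ge0 => //.
by rewrite ler0c mulr_ge0// ltW.
Qed.

End Transport.

(** Transport back with inverse weights is a right inverse, the source of surjectivity. *)
Lemma transportK (R : realType) (p : R) (I : finType) (a la b lb w : I -> R)
    (f : measurableTypeR R -> R[i]) (x : measurableTypeR R) :
  tiling a la -> tiling b lb -> (forall i, 0 < w i) ->
  (forall i, w i `^ p * lb i = la i) -> 0 <= x < 1 ->
  transport a la b lb w (transport b lb a la (fun i => (w i)^-1) f) x = f x.
Proof.
move=> ta tb w0 wE x01; have [_ t2 _] := tb; have [i ix] := t2 _ x01.
have ia : in_tile (a i) (la i) (tile_map a la b lb i x).
  by apply: (tile_mapP _ w0 wE ix).
rewrite (transport_in _ _ _ tb _ ix) (transport_in _ _ _ ta _ ia).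
have lb0 := tile_gt0 ix; have la0 : 0 < la i by rewrite -wE mulr_gt0// powR_gt0.
have -> : tile_map b lb a la i (tile_map a la b lb i x) = x.
  by rewrite /tile_map; field; rewrite !gt_eqF.
by rewrite mulrA -rmorphM mulfV ?gt_eqF// mul1r.
Qed.

Lemma ae_lebesgue01 (R : realType) (P : R -> Prop) :
  (forall x, 0 <= x < 1 -> P x) -> {ae lebesgue01 R, forall x, P x}.
Proof.
move=> hP; exists (~` `[0%R, 1%R[); split.
- exact: measurableC.
- rewrite -[LHS]/(lebesgue_measure (~` `[0%R, 1%R[ `&` `[0%R, 1%R])).
  apply/eqP; rewrite -measure_le0 -(lebesgue_measure_set1 (1 : R)).
  apply: le_measure; rewrite ?inE//.
    by apply: measurableI => //; exact: measurableC.
  by move=> x [] /=; rewrite !in_itv/= => /negP; rewrite negb_and; lra.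
move=> x /= nP; rewrite in_itv/= => h; apply: nP; exact: hP.
Qed.

Section TransportOperator.
Context (R : realType) (p : R) (p1 : 1 < p) (I : finType).
Variables (a la b lb w : I -> R).
Hypotheses (ta : tiling a la) (tb : tiling b lb).
Hypotheses (w0 : forall i, 0 < w i) (wE : forall i, w i `^ p * lb i = la i).
Local Notation C := R[i].
Local Notation mu := (lebesgue01 R).
Local Notation L := (cLspace mu (exponent_ge1 p1)).

Definition transport_fun (f : L) : L := cls mu _ (transport a la b lb w f).

Let tr := transport a la b lb w.

Let L_Lp (f : L) : (f : measurableTypeR R -> C) \in cLfun mu p%:E.
Proof. exact: cLspace_Lfun. Qed.

(** Since transport is linear and preserves the norm, the difference is sent to a function of norm
    0; no preimage of a null set has to be studied. *)
Lemma cls_transport_eq (f g : measurableTypeR R -> C) : f \in cLfun mu p%:E -> g \in cLfun mu p%:E ->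
  {ae mu, forall x, f x = g x} ->
  cls mu (exponent_ge1 p1) (tr f) = cls mu (exponent_ge1 p1) (tr g).
Proof.
move=> hf hg fg; have P1 := exponent_ge1 p1.
have hfg : (fun x => -1 * g x + f x) \in cLfun mu p%:E by exact: cLfun_lin.
apply/eqP; rewrite -subr_eq0 addrC -scaleN1r -cls_lin ?transport_Lp//; apply/eqP.
apply: lnrm_eq0; rewrite lnrm_cls; last first.
  by apply: cLfun_lin => //; exact: transport_Lp.
under eq_fun do rewrite -transport_lin.
rewrite nrm_transport// (@ae_eq_nrm _ _ _ mu p%:E _ (fun=> 0))//.
- by rewrite /nrm cLnorm0.
- exact: cLfun_cmeasurable hfg.
- exact: cmeasurable0.
- by apply: filterS fg => x ->; rewrite mulN1r addNr.
Qed.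

Lemma transport_fun_linear : linear transport_fun.
Proof.
move=> c f g; rewrite /transport_fun -cls_lin ?transport_Lp//.
under [X in _ = cls _ _ X]eq_fun do rewrite -transport_lin.
apply: cls_transport_eq => //; last exact: cLspaceP_ae.
by apply: cLfun_lin => //; exact: exponent_ge1.
Qed.

Lemma lnrm_transport_fun f : lnrm (transport_fun f) = lnrm f.
Proof. by rewrite lnrm_cls ?transport_Lp// nrm_transport. Qed.

Lemma transport_fun_bounded f : `|transport_fun f| <= 1%:C * `|f|.
Proof. by rewrite mul1r !cLspace_normE lnrm_transport_fun. Qed.

Definition transport_op : boundedOp L L :=
  bounded_op_of transport_fun_linear transport_fun_bounded.

Lemma transport_op_invertible : positive_invertible_isometries p1 transport_op.
Proof.
split; first split.
(* The representative is nonnegative only almost everywhere, while [transport_ge0] asks for it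
   everywhere; the modulus of [f] is an equivalent representative that qualifies. *)
- move=> f f0; pose g x := (normc (f x))%:C : C.
  have fg : {ae mu, forall x, f x = g x}.
    apply: filterS f0 => x; rewrite /g; case: (f x) => u v.
    by rewrite lecE /= => /andP[/eqP -> u0]; rewrite expr0n addr0 sqrtr_sqr ger0_norm.
  have hg : g \in cLfun mu p%:E.
    apply: (cLfun_ae _ _ fg) => //; first exact: exponent_ge1.
    by apply: cmeasurable_real; apply: measurable_normc; exact: cLspace_cmeasurable.
  rewrite -[transport_op f]/(transport_fun f) /transport_fun.
  rewrite (cls_transport_eq (L_Lp f) hg fg).
  apply: filterS (cls_ae (exponent_ge1 p1) (transport_Lp p1 ta tb w0 wE hg)) => x ->.
  by apply: transport_ge0 => // y; rewrite ler0c normc_ge0.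
- by move=> f; rewrite !cLspace_normE -[transport_op f]/(transport_fun f) lnrm_transport_fun.
move=> g; have w'0 i : 0 < (w i)^-1 by rewrite invr_gt0.
have w'E i : (w i)^-1 `^ p * la i = lb i.
  rewrite -wE -powR_inv1 ?ltW// -powRrM mulrA -powRD ?(gt_eqF (w0 i)) ?implybT//.
  by rewrite mulN1r addNr powRr0 mul1r.
have hg := transport_Lp p1 tb ta w'0 w'E (L_Lp g).
exists (cls mu (exponent_ge1 p1) (transport b lb a la (fun i => (w i)^-1) (g : L))).
rewrite -[LHS]/(transport_fun _) /transport_fun.
rewrite (cls_transport_eq _ hg)//; last exact: cls_ae.
apply: cls_eq; first exact: transport_Lp.
by apply: ae_lebesgue01 => x x01; exact: transportK x01.
Qed.

End TransportOperator.

(** * Equal cells, their subdivision and the resulting isometries *)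

Section Grid.
Context (R : realType) (N : nat).
Hypothesis N0 : (0 < N)%N.

Definition in_cell (i : nat) (x : R) := in_tile (i%:R / N%:R) N%:R^-1 x.

Let NR : 0 < N%:R :> R. Proof. by rewrite ltr0n. Qed.

Lemma in_cellE i x : in_cell i x = (i%:R <= x * N%:R < i.+1%:R).
Proof.
rewrite /in_cell /in_tile -[X in _ + X]mul1r -mulrDl natr1.
by rewrite ler_pdivrMr// ltr_pdivlMr.
Qed.

Lemma in_cell_inj i j x : in_cell i x -> in_cell j x -> i = j.
Proof. by rewrite !in_cellE => /truncn_def <- /truncn_def <-. Qed.

Lemma in_cell_itv (i : 'I_N) x : in_cell i x -> 0 <= x < 1.
Proof.
rewrite in_cellE => /andP[h1 h2]; apply/andP; split.
  by rewrite -(pmulr_lge0 _ NR) (le_trans _ h1).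
rewrite -(ltr_pM2r NR) mul1r (lt_le_trans h2)// ler_nat; exact: ltn_ord.
Qed.

Lemma in_cell_ex x : 0 <= x < 1 -> exists i : 'I_N, in_cell i x.
Proof.
move=> /andP[x0 x1]; have xN : 0 <= x * N%:R by rewrite mulr_ge0.
have h : (Num.truncn (x * N%:R) < N)%N.
  by rewrite -(ltr_nat R) (@le_lt_trans _ _ (x * N%:R)) ?truncn_le// -[ltRHS]mul1r ltr_pM2r.
by exists (Ordinal h); rewrite in_cellE /= truncn_le// truncnS_gt andbT.
Qed.

Section Subdivide.
Variable l : 'I_N -> R.
Hypothesis l0 : forall i, 0 <= l i.

Definition psum (m : nat) := \sum_(k < N | (k < m)%N) l k.

Lemma psumS (j : 'I_N) : psum j.+1 = psum j + l j.
Proof.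
rewrite /psum (bigD1 j)//= addrC; congr (_ + _); apply: eq_bigl => k.
by rewrite ltnS [in RHS]ltn_neqAle andbC.
Qed.

Lemma psum_le m n : (m <= n)%N -> psum m <= psum n.
Proof.
move=> mn; rewrite /psum [leRHS]big_mkcond [leLHS]big_mkcond; apply: ler_sum => k _.
by case: ifPn => [km|_]; [rewrite (leq_trans km)|case: ifPn].
Qed.

Lemma psum0 : psum 0 = 0.
Proof. by rewrite /psum big_pred0. Qed.

Lemma psumN : psum N = \sum_k l k.
Proof. by apply: eq_bigl => k; rewrite ltn_ord. Qed.

Lemma psum_cover m x : (m <= N)%N -> 0 <= x < psum m ->
  exists j : 'I_N, in_tile (psum j) (l j) x.
Proof.
elim: m => [|m IH] mN /andP[x0 xm].
  by move: xm; rewrite psum0 ltNge x0.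
have [xlt|xge] := ltP x (psum m); first by apply: IH; [exact: ltnW|rewrite x0].
exists (Ordinal mN); apply/andP; split => //.
by rewrite -(psumS (Ordinal mN)).
Qed.

Lemma psum_disjoint (i j : 'I_N) x :
  in_tile (psum i) (l i) x -> in_tile (psum j) (l j) x -> i = j.
Proof.
rewrite /in_tile -!psumS => /andP[i1 i2] /andP[j1 j2]; apply/val_inj/eqP => /=.
rewrite eqn_leq; apply/andP; split; rewrite leqNgt; apply/negP => h.
  by have := le_trans (psum_le h) i1; rewrite leNgt j2.
by have := le_trans (psum_le h) j1; rewrite leNgt i2.
Qed.

End Subdivide.

(** Cell [i] is cut from left to right into consecutive pieces of lengths [al i j], placed by
    partial sums; they fill it since the lengths add up to the cell length. *)
Lemma grid_tiling (al : 'I_N -> 'I_N -> R) :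
  (forall i j, 0 <= al i j) -> (forall i, \sum_j al i j = N%:R^-1) ->
  exists a : 'I_N * 'I_N -> R, tiling a (fun k => al k.1 k.2) /\
    forall k x, in_tile (a k) (al k.1 k.2) x -> in_cell k.1 x.
Proof.
move=> al0 alN; pose a (k : 'I_N * 'I_N) := k.1%:R / N%:R + psum (al k.1) k.2.
have aE k x : in_tile (a k) (al k.1 k.2) x =
    in_tile (psum (al k.1) k.2) (al k.1 k.2) (x - k.1%:R / N%:R).
  by rewrite /in_tile /a lerBrDl ltrBlDl addrA.
have acell k x : in_tile (a k) (al k.1 k.2) x -> in_cell k.1 x.
  rewrite aE /in_tile -psumS => /andP[h1 h2]; rewrite /in_cell /in_tile.
  have : psum (al k.1) 0 <= psum (al k.1) k.2 by exact: psum_le.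
  have : psum (al k.1) k.2.+1 <= psum (al k.1) N by apply: psum_le => //; exact: ltn_ord.
  rewrite psumN alN psum0 => h3 h4; apply/andP; split; lra.
exists a; split => //; split.
- by move=> k x /acell; exact: in_cell_itv.
- move=> x /in_cell_ex[i ix].
  have [|j jx] := @psum_cover (al i) N (x - i%:R / N%:R) (leqnn N).
    by rewrite psumN alN; move: ix; rewrite /in_cell /in_tile => /andP[h1 h2]; apply/andP; split; lra.
  by exists (i, j); rewrite aE.
move=> [i j] [i' j'] x hx hx'; have /val_inj ii := in_cell_inj (acell _ _ hx) (acell _ _ hx').
rewrite /= in ii; subst i'; congr (_, _).
by move: hx hx'; rewrite !aE /=; exact: psum_disjoint.
Qed.

End Grid.

Section Cells.
Context (R : realType).
Local Notation C := R[i].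
Local Notation mu := (lebesgue01 R).
Variables (N : nat) (N0 : (0 < N)%N).

Definition cell_fun (i : nat) (x : measurableTypeR R) : C := (in_cell N i x)%:R.

Lemma cell_funE i x : cell_fun i x =
  (\1_`[(i%:R / N%:R : R), (i%:R / N%:R + N%:R^-1)%R[ x)%:C.
Proof. by rewrite tile_indic /cell_fun /in_cell; case: in_tile. Qed.

Lemma cmeasurable_cell_fun i : cmeasurable (cell_fun i).
Proof.
rewrite (_ : cell_fun i = fun x => (\1_`[(i%:R / N%:R : R), (i%:R / N%:R + N%:R^-1)%R[ x)%:C).
  by apply: cmeasurable_real.
by apply/funext => x; exact: cell_funE.
Qed.

Lemma lebesgue01_fin : (mu [set: R] < +oo)%E.
Proof. by rewrite lebesgue01T ltry. Qed.

Lemma cell_fun_Lp (p : R) i : 1 < p -> cell_fun i \in cLfun mu p%:E.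
Proof.
move=> p1; apply: (cLfun_bounded p1 lebesgue01_fin (M := 1)).
  exact: cmeasurable_cell_fun.
move=> x; rewrite cell_funE normc_real tile_indic.
by case: in_tile; rewrite ?normr0 ?normr1.
Qed.

Lemma lebesgue01_tile (c l : R) : 0 <= l ->
  (forall x, in_tile c l x -> 0 <= x < 1) -> mu `[c, c + l[%classic = l%:E.
Proof.
move=> l0 h; rewrite -[LHS]/(lebesgue_measure (`[c, c + l[ `&` `[0%R, 1%R])).
rewrite setIidl; last first.
  by move=> x; rewrite /= !in_itv/= => /h /andP[-> /ltW].
rewrite lebesgue_measure_itv/= lte_fin ltrDl.
move: l0; rewrite le_eqVlt => /orP[/eqP <-|l0]; first by rewrite ltxx.
by rewrite l0 -EFinB addrAC subrr add0r.
Qed.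

End Cells.

Lemma lpair_cls d (T : measurableType d) (R : realType)
    (mu : {measure set T -> \bar R}) (P Q : \bar R) (P1 : (1 <= P)%E)
    (Q1 : (1 <= Q)%E) (f g : T -> R[i]) :
  f \in cLfun mu P -> g \in cLfun mu Q ->
  lpair (cls mu P1 f) (cls mu Q1 g) = cpairing mu f g.
Proof.
move=> hf hg; have mf := cLfun_cmeasurable hf; have mg := cLfun_cmeasurable hg.
rewrite /lpair (@ae_eq_cpairing _ _ _ mu _ f); last exact: cls_ae.
- rewrite cpairingC [RHS]cpairingC; apply: ae_eq_cpairing => //; last exact: cls_ae.
  exact: cLspace_cmeasurable.
- exact: cLspace_cmeasurable.
- by [].
- exact: cLspace_cmeasurable.
Qed.

Section Coupling.
Context (R : realType) (p : R) (p1 : 1 < p).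
Variables (q : R) (q1 : 1 < q) (Q : \bar R) (QE : Q = q%:E) (Q1 : (1 <= Q)%E).
Local Notation C := R[i].
Local Notation mu := (lebesgue01 R).
Local Notation L := (cLspace mu (exponent_ge1 p1)).
Variables (N : nat) (N0 : (0 < N)%N).

(** The marginal conditions say that the pieces fill source and target cells. The weight [e j / c i]
    is forced by the isometry condition [wE], and the pairing is this weight times the target length
    [K i j / e j ^ p]. *)
Lemma coupling_op (K : 'I_N -> 'I_N -> R) (c e : 'I_N -> R) :
  (forall i j, 0 <= K i j) -> (forall i, 0 < c i) -> (forall j, 0 < e j) ->
  (forall i, \sum_j K i j = c i `^ p / N%:R) ->
  (forall j, \sum_i K i j = e j `^ p / N%:R) ->
  exists U : boundedOp L L, positive_invertible_isometries p1 U /\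
  forall i j : 'I_N, lpair (U (cls mu (exponent_ge1 p1) (cell_fun N i)))
    (cls mu Q1 (cell_fun N j)) = (K i j / (c i * e j `^ (p - 1)))%:C.
Proof.
move=> K0 c0 e0 Kc Ke.
have cp0 i : 0 < c i `^ p by rewrite powR_gt0.
have ep0 i : 0 < e i `^ p by rewrite powR_gt0.
pose al i j := K i j / c i `^ p; pose be j i := K i j / e j `^ p.
have al0 i j : 0 <= al i j by rewrite divr_ge0// ltW.
have be0 i j : 0 <= be i j by rewrite divr_ge0// ltW.
have [|a [ta acell]] := grid_tiling N0 al0.
  by move=> i; rewrite -mulr_suml Kc mulrAC mulfV ?mul1r// gt_eqF.
have [|b' [tb' bcell']] := grid_tiling N0 be0.
  by move=> i; rewrite -mulr_suml Ke mulrAC mulfV ?mul1r// gt_eqF.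
(* [grid_tiling] puts the index of the subdivided cell first, here the target cell [j]; the swap
   lets source and target pieces share the index [(i, j)]. *)
pose b (k : 'I_N * 'I_N) := b' (k.2, k.1).
have tb : tiling b (fun k => be k.2 k.1).
  have [t1 t2 t3] := tb'; split.
  - by move=> [i j] x; exact: (t1 (j, i)).
  - by move=> x /t2[[j i] h]; exists (i, j).
  - by move=> [i j] [i' j'] x h h'; have [-> ->] := t3 (j, i) (j', i') x h h'.
have bcell k x : in_tile (b k) (be k.2 k.1) x -> in_cell N k.2 x.
  by move=> h; exact: (bcell' (k.2, k.1)).
pose w (k : 'I_N * 'I_N) := e k.2 / c k.1.
have w0 k : 0 < w k by rewrite divr_gt0.
have wE k : w k `^ p * be k.2 k.1 = al k.1 k.2.
  have ci : 0 <= (c k.1)^-1 by rewrite invr_ge0 ltW.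
  rewrite /w /be /al (powRM _ (ltW (e0 k.2)) ci).
  have -> : (c k.1)^-1 `^ p = (c k.1 `^ p)^-1.
    by rewrite -powR_inv1 ?ltW// -powRrM mulN1r powRN.
  by field; rewrite !gt_eqF.
exists (transport_op p1 ta tb w0 wE); split; first exact: transport_op_invertible.
move=> i j.
have hi := cell_fun_Lp N i p1; have hj : cell_fun N j \in cLfun mu Q by rewrite QE cell_fun_Lp.
rewrite -[transport_op _ _ _ _ _ _]/(transport_fun a _ b _ w _) /transport_fun.
rewrite (cls_transport_eq p1 ta tb w0 wE (cLspace_Lfun _) hi); last exact: cls_ae.
rewrite lpair_cls//; last exact: transport_Lp.
(* A target piece [(k1, k2)] lies in cell [k2] and is fed from cell [k1], so only the piece [(i, j)]
   contributes. *)
have prodE x : transport a (fun k => al k.1 k.2) b (fun k => be k.2 k.1) w (cell_fun N i) x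
    * cell_fun N j x = (w (i, j) * \1_`[b (i, j), (b (i, j) + be j i)%R[ x)%:C.
  have [_ _ t3] := tb.
  have [[k kx]|nx] := pselect (exists k, in_tile (b k) (be k.2 k.1) x).
    rewrite (transport_in _ _ _ tb _ kx) tile_indic /cell_fun.
    have ka := acell _ _ (tile_mapP a w0 wE kx); have kb := bcell _ _ kx.
    have [ij|ij] := eqVneq k (i, j).
      by move: ij kx ka kb => -> /= kx ka kb; rewrite ka kb kx !mulr1.
    have -> : in_tile (b (i, j)) (be j i) x = false.
      by apply/negP => h; move: ij; rewrite (t3 k (i, j) x kx h) eqxx.
    rewrite mulr0; have [ki|ki] := boolP (in_cell N i (tile_map a _ b _ k x)).
      have [kj|kj] := boolP (in_cell N j x); last by rewrite mulr0.
      have k1 : k.1 = i by apply: val_inj; exact: in_cell_inj ka ki.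
      have k2 : k.2 = j by apply: val_inj; exact: in_cell_inj kb kj.
      by move: ij; rewrite -k1 -k2 -surjective_pairing eqxx.
    by rewrite mulr0 mul0r.
  rewrite tile_indic (_ : in_tile _ _ _ = false); last first.
    by apply/negP => h; apply: nx; exists (i, j).
  rewrite mulr0 /transport big1 ?mul0r// => k _.
  rewrite tile_indic (_ : in_tile _ _ _ = false) ?mulr0 ?mul0r//.
  by apply/negP => h; apply: nx; exists k.
rewrite /cpairing; under eq_Rintegral do rewrite prodE /=.
under [X in _ +i* X]eq_Rintegral do rewrite prodE /=.
rewrite [X in _ +i* X]Rintegral_cst// mul0r.
have mB : measurable (`[b (i, j), (b (i, j) + be j i)%R[ : set (measurableTypeR R)) by [].
rewrite RintegralZl//; last by apply: (Rint_bounded (lebesgue01_fin R) (M := 1)) => // x;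
  rewrite tile_indic; case: in_tile; rewrite ?normr0 ?normr1.
rewrite /Rintegral integral_indic// setIT lebesgue01_tile//=; last first.
  by move=> x h; have [t1 _ _] := tb; exact: (t1 (i, j)).
congr (_%:C); rewrite /w /be /= (powRB1 p1 (ltW (e0 j))).
by field; rewrite !gt_eqF ?powR_gt0.
Qed.

End Coupling.

Section ClassSums.
Context d (T : measurableType d) (R : realType).
Variables (mu : {measure set T -> \bar R}) (P : \bar R) (P1 : (1 <= P)%E).
Local Notation C := R[i].
Variables (I : Type) (F : I -> T -> C) (hF : forall i, F i \in cLfun mu P).

Lemma cLfun_sum (r : seq I) : (fun x => \sum_(i <- r) F i x) \in cLfun mu P.
Proof.
elim: r => [|i r IH]; first by under eq_fun do rewrite big_nil; exact: cLfun0.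
by under eq_fun do rewrite big_cons; exact: cLfunD.
Qed.

End ClassSums.

Lemma cls_sum d (T : measurableType d) (R : realType)
    (mu : {measure set T -> \bar R}) (P : \bar R) (P1 : (1 <= P)%E) (I : Type)
    (r : seq I) (c : I -> R[i]) (F : I -> T -> R[i]) :
  (forall i, F i \in cLfun mu P) ->
  cls mu P1 (fun x => \sum_(i <- r) c i * F i x) = \sum_(i <- r) c i *: cls mu P1 (F i).
Proof.
move=> hF; elim: r => [|i r IH].
  rewrite big_nil; apply: cls_eq.
    by under eq_fun do rewrite big_nil; exact: cLfun0.
  apply: filterS (cLspace0_ae mu P1) => x ->; by rewrite big_nil.
rewrite big_cons -IH -cls_lin//; last by apply: cLfun_sum => // j; exact: cLfunZ.
by congr cls; apply/funext => x; rewrite big_cons.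
Qed.

(** * Density of step functions that vanish on the last cell *)

Section StepDensity.
Context (R : realType).
Local Notation C := R[i].
Local Notation leb := (@lebesgue_measure R).
Local Notation mu := (lebesgue01 R).
Local Notation T := (measurableTypeR R).
Local Notation Rint f := (mu.-integrable [set: T] (EFin \o f)).

Let fin_mu := lebesgue01_fin R.

Lemma continuous_approx (u : T -> R) (M del : R) : measurable_fun [set: T] u ->
  (forall x, `|u x| <= M) -> 0 < del ->
  exists h : R -> R, [/\ continuous h, forall x, `|h x| <= M &
    \int[mu]_x `|u x - h x| < del].
Proof.
move=> mu' uM del0; have M0 : 0 <= M := le_trans (normr_ge0 _) (uM 0).
pose E : set T := `[0%R, 1%R]%classic.
have mE : measurable E by exact: measurable_itv.
have closedE (F : T -> \bar R) : measurable_fun [set: T] F -> (forall x, (0 <= F x)%E) ->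
    (\int[mu]_x F x = \int[leb]_(x in E) F x)%E.
  by move=> mF F0; rewrite integral_lebesgue01// integral_itv_bndo_bndc//; exact: measurable_funTS.
have Iu : leb.-integrable E (EFin \o u).
  apply/integrableP; split; first by apply/measurable_EFinP; exact: measurable_funTS.
  rewrite -closedE//; last by apply/measurable_EFinP; exact: measurableT_comp.
  by have /integrableP[] := Rint_bounded fin_mu mu' uM.
have Efin : (leb E < +oo)%E by rewrite lebesgue_measure_itv/= lte_fin ltr01 -EFinB ltry.
have [g [cg _ /fine_cvg gu]] := approximation_continuous_integrable mE Efin Iu.
move/cvgr_lt : gu => /(_ _ del0)[n _ /(_ n (leqnn n)) /= hn].
(* Clamping to [[-M, M]] keeps the uniform bound and does not increase the distance to [u]. *)
pose h x := Num.max (- M) (Num.min M (g n x)).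
have ch : continuous h.
  move=> x; apply: (@continuous_max _ R (fun=> - M) (fun x => Num.min M (g n x))).
    exact: cst_continuous.
  apply: (@continuous_min _ R (fun=> M) (g n)); first exact: cst_continuous.
  exact: cg.
have hM x : `|h x| <= M.
  by rewrite ler_norml /h le_max lexx/= ge_max ge_min lexx/= andbT; lra.
have uhg x : `|u x - h x| <= `|u x - g n x|.
  have := uM x; rewrite ler_norml => /andP[u1 u2]; rewrite /h.
  have [gM|gM] := leP M (g n x).
    rewrite (max_idPr _); last by lra.
    by rewrite !ler0_norm; lra.
  have [gm|gm] := leP (- M) (g n x); first by [].
  by rewrite !ger0_norm; lra.
have mh : measurable_fun [set: T] h by exact: continuous_measurable_fun.
have mg : measurable_fun [set: T] (g n) by exact: continuous_measurable_fun.
exists h; split => //; apply: le_lt_trans hn; rewrite /Rintegral.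
have mug : measurable_fun [set: T] (fun x => `|u x - g n x|).
  by apply: measurableT_comp => //; exact: measurable_funB.
have muh : measurable_fun [set: T] (fun x => `|u x - h x|).
  by apply: measurableT_comp => //; exact: measurable_funB.
have fing : (\int[leb]_(x in E) `|(u x - g n x)%:E| < +oo)%E.
  have /integrableP[_ ] : leb.-integrable E (fun x => (u x)%:E - (g n x)%:E)%E.
    apply: integrableB => //; apply: continuous_compact_integrable => //.
      exact: segment_compact.
    by apply: continuous_subspaceT.
  by [].
rewrite fine_le//.
- rewrite ge0_fin_numE ?integral_ge0//.
  have uh2 x : `| `|u x - h x| | <= M + M.
    by rewrite normr_id (le_trans (ler_normB _ _))// lerD.
  have /integrableP[_] := Rint_bounded fin_mu muh uh2.
  by under eq_integral do rewrite /= normr_id.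
- by rewrite ge0_fin_numE ?integral_ge0.
rewrite -closedE//; last exact/measurable_EFinP.
by apply: ge0_le_integral => //; [exact/measurable_EFinP|exact/measurable_EFinP|move=> x _; rewrite lee_fin].
Qed.

(* The last of the [n.+1] cells is left out: it is the one on which the
   approximating isometries are not controlled. *)
Definition step_fun (n : nat) (c : 'I_n -> R) (x : T) : R :=
  \sum_(i < n) c i * (in_cell n.+1 i x)%:R.

Lemma step_fun_in n (c : 'I_n -> R) (i : 'I_n) x : in_cell n.+1 i x ->
  step_fun c x = c i.
Proof.
move=> ix; rewrite /step_fun (bigD1 i)//= ix mulr1 big1 ?addr0// => j ji.
have [jx|] := boolP (in_cell n.+1 j x); last by rewrite mulr0.
by move: ji; rewrite -(inj_eq val_inj) /= (in_cell_inj (ltn0Sn n) jx ix) eqxx.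
Qed.

Lemma step_fun_out n (c : 'I_n -> R) x :
  (forall i : 'I_n, ~~ in_cell n.+1 i x) -> step_fun c x = 0.
Proof. by move=> h; apply: big1 => i _; rewrite (negbTE (h i)) mulr0. Qed.

Lemma step_fun_bounded n (c : 'I_n -> R) M x : 0 <= M -> (forall i, `|c i| <= M) ->
  `|step_fun c x| <= M.
Proof.
move=> M0 cM; have [[i ix]|nx] := pselect (exists i : 'I_n, in_cell n.+1 i x).
  by rewrite (step_fun_in _ ix).
rewrite step_fun_out ?normr0// => i; apply/negP => h; apply: nx; by exists i.
Qed.

Lemma measurable_step_fun n (c : 'I_n -> R) : measurable_fun [set: T] (step_fun c).
Proof.
apply: measurable_sum => i; apply: measurable_funM => //.
rewrite (_ : (fun x => _) =
  \1_(`[(i%:R / n.+1%:R : R), (i%:R / n.+1%:R + n.+1%:R^-1)%R[%classic : set T)).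
  by apply: measurable_indic; exact: measurable_itv.
by apply/funext => x; rewrite tile_indic.
Qed.

(** Dominated convergence on [[0, 1)], with [M + M] as the majorant and continuity for the pointwise
    limit. *)
Lemma step_approx (h : R -> R) (M del : R) : continuous h ->
  (forall x, `|h x| <= M) -> 0 < del ->
  \forall n \near \oo,
    \int[mu]_x `|h x - step_fun (fun i : 'I_n => h (i%:R / n.+1%:R)) x| < del.
Proof.
move=> ch hM del0; have M0 : 0 <= M := le_trans (normr_ge0 _) (hM 0).
pose c n := (fun i : 'I_n => h (i%:R / n.+1%:R)).
pose D : set T := `[0%R, 1%R[%classic.
have mD : measurable D by exact: measurable_itv.
have mh : measurable_fun [set: T] h by exact: continuous_measurable_fun.
pose F n x := `|h x - step_fun (c n) x|.
have mF n : measurable_fun [set: T] (F n).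
  by apply: measurableT_comp => //; apply: measurable_funB => //; exact: measurable_step_fun.
have FM n x : `|F n x| <= M + M.
  rewrite normr_id (le_trans (ler_normB _ _))// lerD// step_fun_bounded// => i.
  exact: hM.
have FE n : (\int[mu]_x (F n x)%:E = \int[leb]_(x in D) (F n x)%:E)%E.
  apply: integral_lebesgue01; first exact/measurable_EFinP.
  by move=> x; rewrite lee_fin normr_ge0.
have cvF x : D x -> ((F n x)%:E @[n --> \oo] --> 0%E).
  rewrite /D /= in_itv/= => /andP[x0 x1].
  apply: cvg_EFin; first exact: nearW.
  apply/cvgrPdist_lt => e e0.
  have /cvgrPdist_lt/(_ _ e0) : h @ x --> h x by exact: ch.
  move=> [d /= d0 hd].
  near=> n.
  have n1 : 0 < n.+1%:R :> R by rewrite ltr0n.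
  have [i ix] := @in_cell_ex R n.+1 (ltn0Sn n) x (introT andP (conj x0 x1)).
  have /andP[i1 i2] : i%:R <= x * n.+1%:R < i.+1%:R by rewrite -in_cellE.
  (* Once [n] exceeds [x / (1 - x)], the cell of [x] is not the omitted last one. *)
  have iN : (i < n)%N.
    rewrite -(ltr_nat R) (le_lt_trans i1)// -natr1 mulrDr mulr1.
    have : x / (1 - x) < n%:R by near: n; exact: nbhs_infty_gtr.
    by rewrite ltr_pdivrMr ?subr_gt0//; lra.
  rewrite /F (step_fun_in (c n) (i := Ordinal iN) ix) /c /= sub0r normrN normr_id.
  apply: hd => /=; rewrite ger0_norm; last first.
    by rewrite subr_ge0 ler_pdivrMr.
  have : x - i%:R / n.+1%:R < n.+1%:R^-1.
    rewrite ltrBlDl -[X in _ + X]mul1r -mulrDl natr1 ltr_pdivlMr//.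
  move=> /lt_trans; apply; rewrite -[ltRHS]invrK ltf_pV2 ?posrE ?invr_gt0//.
  have : d^-1 < n%:R by near: n; exact: nbhs_infty_gtr.
  by rewrite -natr1; lra.
have := @dominated_cvg _ T R leb D mD (fun n x => (F n x)%:E) (fun=> 0%E) (fun=> (M + M)%:E).
rewrite integral0 => /(_ _ _ _ _ _)/fine_cvg/cvgr_lt hcv.
have {}hcv : \forall n \near \oo, fine (\int[leb]_(x in D) (F n x)%:E)%E < del.
  apply: hcv => //.
  - by move=> n; apply/measurable_EFinP; exact: measurable_funTS.
  - apply/integrableP; split; first exact: measurable_cst.
    rewrite integral_cst//= lebesgue_measure_itv/= lte_fin ltr01 -EFinB.
    by rewrite subr0 mule1 ltry.
  - by move=> n x _; rewrite /= lee_fin.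
by apply: filterS hcv => n; rewrite /Rintegral -FE.
Unshelve. all: by end_near. Qed.

Lemma real_step_approx (u : T -> R) (M del : R) : measurable_fun [set: T] u ->
  (forall x, `|u x| <= M) -> 0 < del ->
  \forall n \near \oo, exists c : 'I_n -> R, (forall i, `|c i| <= M) /\
    \int[mu]_x `|u x - step_fun c x| < del.
Proof.
move=> mu' uM del0; have M0 : 0 <= M := le_trans (normr_ge0 _) (uM 0).
have d2 : 0 < del / 2 by rewrite divr_gt0.
have [h [ch hM uh]] := continuous_approx mu' uM d2.
have mh : measurable_fun [set: T] h by exact: continuous_measurable_fun.
apply: filterS (step_approx ch hM d2) => n hn.
set c := (fun i : 'I_n => _) in hn; exists c; split; first by move=> i; exact: hM.
have ms := measurable_step_fun c.
have sM x : `|step_fun c x| <= M by apply: step_fun_bounded => // i; exact: hM.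
have dist_Rint (a b : T -> R) : measurable_fun [set: T] a -> measurable_fun [set: T] b ->
    (forall x, `|a x| <= M) -> (forall x, `|b x| <= M) -> Rint (fun x => `|a x - b x|).
  move=> ma mb aM bM; apply: (Rint_bounded fin_mu (M := M + M)).
    by apply: measurableT_comp => //; exact: measurable_funB.
  by move=> x; rewrite normr_id (le_trans (ler_normB _ _))// lerD.
have := ltrD uh hn; rewrite -splitr -RintegralD//; [|exact: dist_Rint|exact: dist_Rint].
apply: le_lt_trans; apply: le_Rintegral => //; first exact: dist_Rint.
  have := integrableD measurableT (dist_Rint u h mu' mh uM hM)
    (dist_Rint h (step_fun c) mh ms hM sM).
  by apply.
by move=> x _; rewrite (le_trans _ (ler_normD _ _))// addrA subrK.
Qed.

Definition cstep (n : nat) (c : 'I_n -> C) (x : T) : C :=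
  \sum_(i < n) c i * cell_fun n.+1 i x.

Lemma cstepE n (c : 'I_n -> C) x : cstep c x =
  step_fun (fun i => complex.Re (c i)) x +i* step_fun (fun i => complex.Im (c i)) x.
Proof.
have [[i ix]|nx] := pselect (exists i : 'I_n, in_cell n.+1 i x); last first.
  rewrite !step_fun_out//; try by move=> i; apply/negP => h; apply: nx; exists i.
  rewrite /cstep big1// => i _; rewrite /cell_fun (_ : in_cell _ _ _ = false) ?mulr0//.
  by apply/negP => h; apply: nx; exists i.
rewrite !(step_fun_in _ ix) /cstep (bigD1 i)//= /cell_fun ix mulr1 big1 ?addr0.
  by case: (c i).
move=> j ji; have [jx|] := boolP (in_cell n.+1 j x); last by rewrite mulr0.
by move: ji; rewrite -(inj_eq val_inj) /= (in_cell_inj (ltn0Sn n) jx ix) eqxx.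
Qed.

Lemma cmeasurable_cstep n (c : 'I_n -> C) : cmeasurable (cstep c).
Proof.
rewrite (_ : cstep c = fun x => step_fun (fun i => complex.Re (c i)) x
  +i* step_fun (fun i => complex.Im (c i)) x); last by apply/funext => x; exact: cstepE.
by split; exact: measurable_step_fun.
Qed.

Lemma normc_le_ReIm (z : C) : normc z <= `|complex.Re z| + `|complex.Im z|.
Proof.
case: z => a b /=; rewrite -[leRHS]ger0_norm ?addr_ge0// -sqrtr_sqr ler_sqrt ?sqr_ge0//.
rewrite sqrrD !real_normK ?num_real//.
have : 0 <= `|a| * `|b| by rewrite mulr_ge0.
by rewrite -mulr_natr; lra.
Qed.

Lemma bounded_step_density (p : R) (f : T -> C) (M e : R) : 1 < p -> cmeasurable f ->
  (forall x, normc (f x) <= M) -> 0 < e ->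
  \forall n \near \oo, exists c : 'I_n -> C,
    nrm mu p%:E (fun x => f x - cstep c x) < e.
Proof.
move=> p1 mf fM e0; have M0 : 0 <= M := le_trans (normc_ge0 _) (fM 0).
have p0 : 0 < p by lra.
have [m1 m2] := mf.
have uM x : `|complex.Re (f x)| <= M by rewrite (le_trans (abs_Re_le_normc _)).
have vM x : `|complex.Im (f x)| <= M by rewrite (le_trans (abs_Im_le_normc _)).
(* The error is at most [4 M] pointwise, so its p-th power is at most [A] times the error, and
   approximation in L^1 gives approximation in L^p. The added 1 keeps [A] positive when [M = 0]. *)
pose A := (4 * M + 1) `^ (p - 1).
have A0 : 0 < A by rewrite powR_gt0//; lra.
pose del := e `^ p / (2 * A).
have del0 : 0 < del by rewrite divr_gt0 ?powR_gt0//; lra.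
apply: filterS2 (real_step_approx m1 uM del0) (real_step_approx m2 vM del0).
move=> n [c1 [c1M h1]] [c2 [c2M h2]].
pose c i := c1 i +i* c2 i; exists c.
have sE x : cstep c x = step_fun c1 x +i* step_fun c2 x by rewrite cstepE.
pose g x := A * (`|complex.Re (f x) - step_fun c1 x| + `|complex.Im (f x) - step_fun c2 x|).
have dist_Rint (a : T -> R) (c' : 'I_n -> R) : measurable_fun [set: T] a ->
    (forall x, `|a x| <= M) -> (forall i, `|c' i| <= M) ->
    Rint (fun x => `|a x - step_fun c' x|).
  move=> ma aM cM; apply: (Rint_bounded fin_mu (M := M + M)).
    by apply: measurableT_comp => //; apply: measurable_funB => //; exact: measurable_step_fun.
  by move=> x; rewrite normr_id (le_trans (ler_normB _ _))// lerD// step_fun_bounded.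
have I1 := dist_Rint _ _ m1 uM c1M; have I2 := dist_Rint _ _ m2 vM c2M.
have I12 := integrableD measurableT I1 I2.
have Ig : Rint g by exact: (integrableZl measurableT A I12).
have md : cmeasurable (fun x => f x - cstep c x).
  have := cmeasurable_lin (-1) (cmeasurable_cstep c) mf.
  by under eq_fun do rewrite mulN1r addrC.
have le_g x : normc (f x - cstep c x) `^ p <= g x.
  have : normc (f x - cstep c x) <=
      `|complex.Re (f x) - step_fun c1 x| + `|complex.Im (f x) - step_fun c2 x|.
    by rewrite (le_trans (normc_le_ReIm _))// sE; case: (f x).
  set y := normc _; set z := _ + _ => yz.
  have zM : z <= 4 * M + 1.
    have a1 := le_trans (ler_normB (complex.Re (f x)) (step_fun c1 x))
      (lerD (uM x) (step_fun_bounded x M0 c1M)).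
    have a2 := le_trans (ler_normB (complex.Im (f x)) (step_fun c2 x))
      (lerD (vM x) (step_fun_bounded x M0 c2M)).
    by rewrite /z; lra.
  have y0 : 0 <= y by exact: normc_ge0.
  rewrite (powRB1 p1 y0) /g -/z mulrC ler_pM ?powR_ge0// ge0_ler_powR ?nnegrE//; lra.
have := nrm_le_dom p0 md le_g Ig.
rewrite /g RintegralZl// RintegralD// => hle.
have : nrm mu p%:E (fun x => f x - cstep c x) `^ p < e `^ p.
  rewrite (le_lt_trans hle)//.
  have -> : e `^ p = A * (del + del) by rewrite /del; field; rewrite gt_eqF.
  by rewrite ltr_pM2l// ltrD.
apply: contraTlt => le_e; rewrite -leNgt.
by apply: ge0_ler_powR; rewrite ?nnegrE ?nrm_ge0// ltW.
Qed.

Lemma step_density (p : R) (f : T -> C) (e : R) : 1 < p -> f \in cLfun mu p%:E -> 0 < e ->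
  \forall n \near \oo, exists c : 'I_n -> C,
    nrm mu p%:E (fun x => f x - cstep c x) < e.
Proof.
move=> p1 hf e0; have e2 : 0 < e / 2 by rewrite divr_gt0.
have mf := cLfun_cmeasurable hf.
have [m hm] := crestr_tail p1 hf e2.
set A := [set x | _] in hm.
have mA : measurable A by exact: measurable_normc_le.
have mr := cmeasurable_crestr mA mf.
have rM x : normc (crestr A f x) <= m%:R.
  rewrite /crestr normcM normc_real indicE; have [/set_mem xA|_] := boolP (x \in A).
    by rewrite normr1 mul1r.
  by rewrite normr0 mul0r.
apply: filterS (bounded_step_density p1 mr rM e2) => n [c hc]; exists c.
rewrite (splitr e) (le_lt_trans _ (ltrD hc hm))//.
have P1 : (1 <= p%:E)%E by rewrite lee_fin ltW.
have hs : cstep c \in cLfun mu p%:E.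
  by apply: cLfun_sum => // i; apply: cLfunZ => //; exact: cell_fun_Lp.
have hr := crestr_Lp p1 mA hf.
have hr' := crestr_Lp p1 (measurableC mA) hf.
rewrite (le_trans _ (nrmD P1 (cLfunB P1 hr hs) hr'))//.
rewrite (_ : (fun x => f x - _) = (fun x => crestr A f x - cstep c x + crestr (~` A) f x))//.
by apply/funext => x; rewrite {1}(crestrC A f x) addrAC.
Qed.

(** Stated for all large [n], because [f] in L^p and [g] in L^q will have to be approximated on one
    common grid. *)
Lemma cLspace_step_density (p : R) (P : \bar R) (PE : P = p%:E) (P1 : (1 <= P)%E)
    (f : cLspace mu P1) (e : R) : 1 < p -> 0 < e ->
  \forall n \near \oo, exists c : 'I_n -> C,
    lnrm (f - \sum_(i < n) c i *: cls mu P1 (cell_fun n.+1 i)) < e.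
Proof.
move=> p1 e0; have hf : (f : T -> C) \in cLfun mu p%:E by rewrite -PE cLspace_Lfun.
apply: filterS (step_density p1 hf e0) => n [c hc]; exists c.
have hF (i : 'I_n) : cell_fun n.+1 i \in cLfun mu P by rewrite PE cell_fun_Lp.
rewrite -cls_sum// -[X in X - _]clsK -scaleN1r addrC -cls_lin//; last 2 first.
- by apply: cLfun_sum => // i; apply: cLfunZ.
- exact: cLspace_Lfun.
rewrite lnrm_cls; last first.
  apply: cLfun_lin => //; last exact: cLspace_Lfun.
  by apply: cLfun_sum => // i; apply: cLfunZ.
rewrite -PE in hc; suff <- : (fun x => f x - cstep c x) =
  (fun x => -1 * (\sum_i c i * cell_fun n.+1 i x) + f x) by [].
by apply/funext => x; rewrite mulN1r addrC.
Qed.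

End StepDensity.

(** * Completion of the weighted matrix to exact marginals *)

Section CouplingMatrix.
Context (R : realType) (p q : R) (pq : conjugates p q).

(* The last index collects, as an extra row and an extra column, the mass that
   [c i * b j * t i j] leaves unused. *)
Lemma coupling_matrix (n : nat) (t : 'I_n -> 'I_n -> R) (c b : 'I_n -> R) :
  (forall i j, 0 <= t i j) -> (forall i, 0 < c i) -> (forall j, 0 < b j) ->
  (forall i, \sum_j b j * t i j <= c i `^ (p - 1) / n.+1%:R) ->
  (forall j, \sum_i c i * t i j <= b j `^ (q - 1) / n.+1%:R) ->
  exists K : 'I_n.+1 -> 'I_n.+1 -> R, exists c' e' : 'I_n.+1 -> R,
  [/\ (forall i j, 0 <= K i j), (forall i, 0 < c' i) /\ (forall j, 0 < e' j),
      (forall i, \sum_j K i j = c' i `^ p / n.+1%:R),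
      (forall j, \sum_i K i j = e' j `^ p / n.+1%:R)
    & forall i j, K (lift ord_max i) (lift ord_max j) /
        (c' (lift ord_max i) * e' (lift ord_max j) `^ (p - 1)) = t i j].
Proof.
move=> t0 c0 b0 hc hb.
have p1 := conjugates_gt1 pq; have q1 := conjugates_gt1 (conjugatesC pq).
have p0 := conjugates_gt0 pq; have q0 := conjugates_gt0 (conjugatesC pq).
have N0 : 0 < n.+1%:R :> R by rewrite ltr0n.
have [_ _ pqE] := pq.
pose e j := b j `^ (q - 1).
have e0 j : 0 < e j by rewrite powR_gt0.
have eB j : e j `^ (p - 1) = b j.
  by rewrite /e -powRrM (_ : _ * _ = 1) ?powRr1 ?ltW//; lra.
have ep j : e j `^ p = b j * e j by rewrite (powRB1 p1 (ltW (e0 j))) eB mulrC.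
pose r i := c i `^ p / n.+1%:R - \sum_j c i * b j * t i j.
pose s j := e j `^ p / n.+1%:R - \sum_i c i * b j * t i j.
have r0 i : 0 <= r i.
  rewrite subr_ge0; under eq_bigr do rewrite -mulrA.
  rewrite -mulr_sumr (powRB1 p1 (ltW (c0 i))) -mulrA.
  by apply: ler_wpM2l; [exact: ltW|exact: hc].
have s0 j : 0 <= s j.
  rewrite subr_ge0; under eq_bigr do rewrite -mulrA mulrCA.
  rewrite -mulr_sumr ep -mulrA.
  by apply: ler_wpM2l; [exact: ltW|exact: hb].
(* The corner entry 1 keeps the last row and column sums positive even if no slack is left
   elsewhere. *)
pose K i j := match unlift ord_max i, unlift ord_max j with
  | Some i', Some j' => c i' * b j' * t i' j'
  | Some i', None => r i' | None, Some j' => s j' | None, None => 1 end.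
have K0 i j : 0 <= K i j.
  by rewrite /K; case: unliftP => [i' _|_]; case: unliftP => [j' _|_] => //;
    rewrite !mulr_ge0// ltW.
have Kmax_gt0r : 0 < \sum_j K ord_max j.
  rewrite (bigD1_ord ord_max)//= {1}/K !unlift_none ltr_pwDl// sumr_ge0//.
have Kmax_gt0l : 0 < \sum_i K i ord_max.
  rewrite (bigD1_ord ord_max)//= {1}/K !unlift_none ltr_pwDl// sumr_ge0//.
(* On the last index the weights are read off from the row sum and the column sum, so the marginal
   conditions hold there by construction. *)
pose c' i := if unlift ord_max i is Some i' then c i' else
  (n.+1%:R * \sum_j K ord_max j) `^ p^-1.
pose e' j := if unlift ord_max j is Some j' then e j' else
  (n.+1%:R * \sum_i K i ord_max) `^ p^-1.
have pinv x : 0 < x -> (n.+1%:R * x) `^ p^-1 `^ p / n.+1%:R = x.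
  move=> x0; rewrite -powRrM mulVf ?gt_eqF// powRr1 ?mulr_ge0 ?ltW//.
  by rewrite mulrAC mulfV ?mul1r ?gt_eqF.
exists K, c', e'; split => //.
- split => i; [rewrite /c'|rewrite /e']; case: unliftP => // _;
    by rewrite powR_gt0// mulr_gt0.
- move=> i; rewrite /c'; case: unliftP => [i' ->|->]; last by rewrite pinv.
  rewrite (bigD1_ord ord_max)//= {1}/K unlift_none liftK /r.
  under eq_bigr do rewrite /K !liftK; by rewrite subrK.
- move=> j; rewrite /e'; case: unliftP => [j' ->|->]; last by rewrite pinv.
  rewrite (bigD1_ord ord_max)//= {1}/K unlift_none liftK /s.
  under eq_bigr do rewrite /K !liftK; by rewrite subrK.
- move=> i j; rewrite /K /c' /e' !liftK eB mulrAC mulfV ?mul1r//.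
  by rewrite gt_eqF// mulr_gt0.
Qed.

End CouplingMatrix.

Section PairingPositivity.
Context d (T : measurableType d) (R : realType).
Variables (mu : {measure set T -> \bar R}) (p q : R) (pq : conjugates p q).
Variables (P Q : \bar R) (PE : P = p%:E) (QE : Q = q%:E).
Variables (P1 : (1 <= P)%E) (Q1 : (1 <= Q)%E).
Local Notation C := R[i].
Local Notation Lp := (cLspace mu P1).
Local Notation Lq := (cLspace mu Q1).

Lemma lpairC (f : Lp) (g : Lq) : lpair f g = lpair g f.
Proof. exact: cpairingC. Qed.

Lemma lpair_suml (I : Type) (r : seq I) (c : I -> C) (F : I -> Lp) (g : Lq) :
  lpair (\sum_(i <- r) c i *: F i) g = \sum_(i <- r) c i * lpair (F i) g.
Proof.
elim: r => [|i r IH]; first by rewrite !big_nil (lpair0l pq PE QE).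
by rewrite !big_cons (lpair_linl pq PE QE) IH.
Qed.

(** The integral of an absolute value makes it evident that the pairing is real and nonnegative, as
    the matrix entries must be. *)
Lemma lpair_ge0 (f : Lp) (g : Lq) : cLspace_ge0 f -> cLspace_ge0 g ->
  lpair f g = (\int[mu]_x `|complex.Re (f x * g x)|)%:C.
Proof.
move=> f0 g0.
have [m1 m2] := cmeasurable_mul (cLspace_cmeasurable f) (cLspace_cmeasurable g).
have fg0 : {ae mu, forall x, 0 <= f x * g x}.
  by apply: filterS2 f0 g0 => x; exact: mulr_ge0.
rewrite /lpair /cpairing; congr (_ +i* _).
  rewrite /Rintegral; congr fine; apply: ae_eq_integral => //; try exact/measurable_EFinP.
    by apply/measurable_EFinP; apply: measurableT_comp.
  apply: filterS fg0 => x h _; congr EFin; rewrite ger0_norm//.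
  by move: h; rewrite lecE => /andP[].
transitivity (\int[mu]_x (0 : R)); last by rewrite Rintegral_cst// mul0r.
rewrite /Rintegral; congr fine; apply: ae_eq_integral => //; first exact/measurable_EFinP.
apply: filterS fg0 => x h _; congr EFin.
by move: h; rewrite lecE => /andP[/eqP ->].
Qed.

End PairingPositivity.

(** * An isometry with the prescribed pairings on the first [n] cells *)

Section ContractionCoupling.
Context (R : realType).
Local Notation C := R[i].
Local Notation mu := (lebesgue01 R).
Local Notation T := (measurableTypeR R).

Lemma in_cell_indic N i : (fun x : T => (in_cell N i x)%:R : R) =
  \1_(`[(i%:R / N%:R : R), (i%:R / N%:R + N%:R^-1)%R[%classic : set T).
Proof. by apply/funext => x; rewrite tile_indic. Qed.

Lemma Rintegral_step_fun n (d : 'I_n -> R) :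
  \int[mu]_x step_fun d x = \sum_i d i / n.+1%:R.
Proof.
have mI (i : 'I_n) :
    measurable (`[(i%:R / n.+1%:R : R), (i%:R / n.+1%:R + n.+1%:R^-1)%R[%classic : set T).
  exact: measurable_itv.
have mF (i : 'I_n) : measurable_fun [set: T] (fun x => (in_cell n.+1 i x)%:R : R).
  by rewrite in_cell_indic; exact: measurable_indic.
have IF (i : 'I_n) : mu.-integrable [set: T] (EFin \o (fun x => (in_cell n.+1 i x)%:R : R)).
  apply: (Rint_bounded (lebesgue01_fin R) (M := 1)) => // x.
  by case: in_cell; rewrite ?normr1 ?normr0.
rewrite /Rintegral; under eq_integral do rewrite /step_fun -sumEFin.
rewrite integral_sum//; last first.
  move=> i; have := integrableZl measurableT (d i) (IF i); exact.
rewrite (_ : \sum_i _ = (\sum_i d i / n.+1%:R)%:E)//.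
rewrite -sumEFin; apply: eq_bigr => i _.
under eq_integral do rewrite EFinM; rewrite integralZl//; last exact: IF.
rewrite EFinM; congr *%E.
rewrite -[LHS]/(\int[mu]_x ((fun x : T => (in_cell n.+1 i x)%:R) x)%:E)%E in_cell_indic.
rewrite integral_indic// setIT lebesgue01_tile// => x ix.
by apply: (@in_cell_itv _ n.+1 (ltn0Sn n) (widen_ord (leqnSn n) i)).
Qed.

Lemma lnrm_step (p : R) (P : \bar R) (PE : P = p%:E) (P1 : (1 <= P)%E) n (c : 'I_n -> R) :
  1 < p -> (forall i, 0 <= c i) ->
  lnrm (\sum_(i < n) (c i)%:C *: cls mu P1 (cell_fun n.+1 i)) `^ p = \sum_i c i `^ p / n.+1%:R.
Proof.
move=> p1 c0; have p0 : 0 < p by lra.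
have hF (i : 'I_n) : cell_fun n.+1 i \in cLfun mu P by rewrite PE cell_fun_Lp.
have hs : (fun x => \sum_i (c i)%:C * cell_fun n.+1 i x) \in cLfun mu P.
  by apply: cLfun_sum => // i; apply: cLfunZ.
rewrite -cls_sum// lnrm_cls// -Rintegral_step_fun.
rewrite PE in hs *; rewrite nrm_powR//; apply: eq_Rintegral => x _.
rewrite -[\sum_i _]/(cstep (fun i => (c i)%:C) x) cstepE.
have -> : step_fun (fun i => complex.Im ((c i)%:C)) x = 0.
  by rewrite /step_fun big1// => i _; rewrite mul0r.
rewrite [X in normc X](_ : _ = (step_fun c x)%:C)// normc_real.
have [[i ix]|nx] := pselect (exists i : 'I_n, in_cell n.+1 i x).
  by rewrite !(step_fun_in _ ix) ger0_norm.
by rewrite !step_fun_out ?normr0 ?powR0 ?gt_eqF// => i; apply/negP => h; apply: nx; exists i.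
Qed.

Lemma cls_cell_ge0 (p : R) (P : \bar R) (PE : P = p%:E) (P1 : (1 <= P)%E) N i : 1 < p ->
  cLspace_ge0 (cls mu P1 (cell_fun N i)).
Proof.
move=> p1; apply: filterS (cls_ae P1 (f := cell_fun N i) _); last by rewrite PE cell_fun_Lp.
by move=> x ->; rewrite /cell_fun ler0n.
Qed.

Variables (p q : R) (pq : conjugates p q) (p1 : 1 < p).
Variables (Q : \bar R) (QE : Q = q%:E) (Q1 : (1 <= Q)%E).
Local Notation P1 := (exponent_ge1 p1).
Local Notation L := (cLspace mu P1).
Local Notation e n i := (cls mu P1 (cell_fun n.+1 i)).
Local Notation g n j := (cls mu Q1 (cell_fun n.+1 j)).

Lemma contraction_coupling (A : boundedOp L L) (n : nat) (theta : R) :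
  positive_contractions p1 A -> 0 <= theta < 1 ->
  exists2 U : boundedOp L L, positive_invertible_isometries p1 U &
  forall i j : 'I_n, lpair (U (e n i)) (g n j) = theta%:C * lpair (A (e n i)) (g n j).
Proof.
move=> [Apos Acon] /andP[th0 th1].
have q1 := conjugates_gt1 (conjugatesC pq).
have p0 := conjugates_gt0 pq; have q0 := conjugates_gt0 (conjugatesC pq).
have N0 : 0 < n.+1%:R :> R by rewrite ltr0n.
have AE (i j : 'I_n) := lpair_ge0 (Apos _ (cls_cell_ge0 (erefl p%:E) P1 n.+1 i p1))
  (cls_cell_ge0 QE Q1 n.+1 j q1).
pose a (i j : 'I_n) := complex.Re (lpair (A (e n i)) (g n j)).
have a0 i j : 0 <= a i j by rewrite /a AE; apply: Rintegral_ge0.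
have {}AE (i j : 'I_n) : lpair (A (e n i)) (g n j) = (a i j)%:C by rewrite /a AE.
have [||||c [b [c0 b0 hc hb]]] := @subinvariant_weights R p q pq 'I_n (fun=> n.+1%:R^-1)
  (fun i j => theta * a i j) theta.
- by move=> _; rewrite invr_gt0.
- by move=> i j; rewrite mulr_ge0.
- by [].
(* The form at [(c, b)] is [theta] times the pairing of [A u] with [v], for the step functions [u],
   [v] with these coefficients. Contractivity, Hoelder and then Young bound it. *)
- move=> c b c0 b0.
  have -> : \sum_i \sum_j c i * b j * (theta * a i j) =
      theta * \sum_i \sum_j c i * (b j * a i j).
    rewrite mulr_sumr; apply: eq_bigr => i _; rewrite mulr_sumr; apply: eq_bigr => j _.
    by ring.
  apply: ler_wpM2l => //.
  set u := \sum_(i < n) (c i)%:C *: e n i; set v := \sum_(j < n) (b j)%:C *: g n j.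
  have uE : \sum_i c i `^ p / n.+1%:R = lnrm u `^ p by rewrite (lnrm_step (erefl p%:E)).
  have vE : \sum_j b j `^ q / n.+1%:R = lnrm v `^ q by rewrite (lnrm_step QE).
  rewrite uE vE; apply: le_trans (conjugate_powR (lnrm_ge0 _) (lnrm_ge0 _) p0 q0
    (conjugates_inv pq)).
  have -> : \sum_i \sum_j c i * (b j * a i j) = complex.Re (lpair (A u) v).
    have -> : A u = \sum_(i < n) (c i)%:C *: A (e n i).
      by rewrite linear_sum; apply: eq_bigr => i _; rewrite linearZ.
    rewrite (lpair_suml pq (erefl _) QE) raddf_sum; apply: eq_bigr => i _.
    rewrite lpairC (lpair_suml (conjugatesC pq) QE (erefl _)) mulr_sumr raddf_sum.
    by apply: eq_bigr => j _; rewrite lpairC AE -!rmorphM.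
  rewrite (le_trans (ler_norm _))// (le_trans (abs_Re_le_normc _))//.
  rewrite (le_trans (lpair_le pq (erefl _) QE _ _))// ler_wpM2r ?lnrm_ge0//.
  by have := Acon u; rewrite !cLspace_normE lecR.
have ta0 i j : 0 <= theta * a i j by rewrite mulr_ge0.
have [K [c' [e' [K0 [c'0 e'0] Kc Ke Kt]]]] := coupling_matrix pq ta0 c0 b0 hc hb.
have [U [hU UE]] := coupling_op p1 q1 QE Q1 (ltn0Sn n) K0 c'0 e'0 Kc Ke.
exists U => // i j.
(* [lift ord_max] embeds ['I_n] as the first [n] indices without changing values, so the cells
   agree. *)
have := UE (lift ord_max i) (lift ord_max j).
by rewrite !lift_max Kt => ->; rewrite AE -rmorphM.
Qed.

End ContractionCoupling.

(** * Continuity points *)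

Section ComplexConvergence.
Context (R : realType).
Local Notation C := R[i].

Lemma gt0_complexE (e : C) : 0 < e -> exists2 r : R, 0 < r & e = r%:C.
Proof.
case: e => a b; rewrite ltcE /= => /andP[/eqP b0 a0]; exists a => //.
by rewrite b0.
Qed.

Lemma cvg_normcP S (G : set_system S) (FG : Filter G) (u : S -> C) (l : C) :
  (u y @[y --> G] --> (l : C^o)) <->
  (forall e : R, 0 < e -> \forall y \near G, normc (l - u y) < e).
Proof.
split=> [/(@cvgrPdist_lt C C^o S G FG u l) cv e e0|h].
  have /cv : (0 : C) < e%:C by rewrite ltcR.
  by apply: filterS => y; rewrite ltcR.
apply/(@cvgrPdist_lt C C^o S G FG u l) => e /gt0_complexE[r r0 ->].
by apply: filterS (h r r0) => y; rewrite ltcR.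
Qed.

Lemma cvg_lnrmP d (T : measurableType d) (mu : {measure set T -> \bar R})
    (P : \bar R) (P1 : (1 <= P)%E) S (G : set_system S) (FG : Filter G)
    (u : S -> cLspace mu P1) (l : cLspace mu P1) :
  (u y @[y --> G] --> l) <->
  (forall e : R, 0 < e -> \forall y \near G, lnrm (l - u y) < e).
Proof.
split=> [/cvgrPdist_lt cv e e0|h].
  have /cv : (0 : C) < e%:C by rewrite ltcR.
  by apply: filterS => y; rewrite cLspace_normE ltcR.
apply/cvgrPdist_lt => e /gt0_complexE[r r0 ->].
by apply: filterS (h r r0) => y; rewrite cLspace_normE ltcR.
Qed.

End ComplexConvergence.

Section WeakConvergence.
Context d (T : measurableType d) (R : realType).
Variables (mu : {measure set T -> \bar R}) (p q : R) (pq : conjugates p q).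
Variables (P Q : \bar R) (PE : P = p%:E) (QE : Q = q%:E).
Variables (P1 : (1 <= P)%E) (Q1 : (1 <= Q)%E).
Local Notation C := R[i].
Local Notation Lp := (cLspace mu P1).
Local Notation Lq := (cLspace mu Q1).

(** After division by the norm of [l], weak convergence is tested on the functional that norms [l],
    and the uniform estimate turns this into norm convergence. *)
Lemma radon_riesz_cvg S (G : set_system S) (FG : Filter G) (u : S -> Lp) (l : Lp) :
  (forall y, lnrm (u y) <= lnrm l) ->
  (forall g : Lq, lpair (u y) g @[y --> G] --> (lpair l g : C^o)) ->
  u y @[y --> G] --> l.
Proof.
move=> ul wk; apply/cvg_lnrmP => e e0.
have [l0|l0] := eqVneq (lnrm l) 0.
  apply: nearW => y; rewrite (lnrm_eq0 l0) (_ : u y = 0) ?subr0 ?lnrm0//.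
  by apply: lnrm_eq0; apply/eqP; rewrite eq_le lnrm_ge0 andbT -l0 ul.
have lp : 0 < lnrm l by rewrite lt_neqAle eq_sym l0 lnrm_ge0.
have el : 0 < e / lnrm l by rewrite divr_gt0.
have [del del0 rr] := radon_riesz_space mu pq PE QE P1 Q1 el.
pose a : C := (lnrm l)^-1%:C.
have aE : normc a = (lnrm l)^-1 by rewrite normc_real ger0_norm ?invr_ge0 ?lnrm_ge0.
have al1 : lnrm (a *: l) = 1 by rewrite lnrmZ aE mulVf.
have [g g1 {}rr] := rr _ al1.
have /cvg_normcP/(_ (del * lnrm l)) := wk g.
move=> /(_ (mulr_gt0 del0 lp)); apply: filterS => y hy.
have uE : lnrm (a *: u y - a *: l) < e / lnrm l.
  apply: rr.
    by rewrite lnrmZ aE mulrC ler_pdivrMr// mul1r.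
  rewrite (lpairZl pq PE QE); move: g1; rewrite (lpairZl pq PE QE) => g1.
  have -> : a * lpair (u y) g = 1 - a * (lpair l g - lpair (u y) g).
    by rewrite mulrBr g1; ring.
  have ReB (z : C) : complex.Re (1 - z) = 1 - complex.Re z by case: z.
  rewrite ReB ltrD2l ltrN2 (le_lt_trans (ler_norm _))//.
  rewrite (le_lt_trans (abs_Re_le_normc _))// normcM aE mulrC ltr_pdivrMr//.
move: uE; rewrite -scalerBr lnrmZ aE mulrC ltr_pM2r ?invr_gt0//.
by rewrite lnrmBC.
Qed.

Lemma lpairBr (f : Lp) (g g' : Lq) : lpair f (g - g') = lpair f g - lpair f g'.
Proof. by rewrite !(lpairC f) (lpairBl (conjugatesC pq) QE PE). Qed.

Lemma lpair_op_dist (W : Lp -> Lp) (f s : Lp) (g t : Lq) :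
  (forall f f', W (f - f') = W f - W f') -> (forall f, lnrm (W f) <= lnrm f) ->
  normc (lpair (W f) g - lpair (W s) t) <= lnrm (f - s) * lnrm g + lnrm s * lnrm (g - t).
Proof.
move=> Wl W1; have -> : lpair (W f) g - lpair (W s) t =
    lpair (W (f - s)) g + lpair (W s) (g - t).
  by rewrite Wl (lpairBl pq PE QE) lpairBr addrA subrK.
rewrite (le_trans (le_normcD _ _))// lerD// (le_trans (lpair_le pq PE QE _ _))//;
  by rewrite ler_wpM2r ?lnrm_ge0.
Qed.

End WeakConvergence.

Lemma conjugates_hoelder (R : realType) (p : R) : 1 < p ->
  conjugates p (p / (p - 1)) /\ hoelder_conjugate p%:E = (p / (p - 1))%:E.
Proof.
move=> p1; have p0 : 0 < p - 1 by rewrite subr_gt0.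
split.
  split => //; first by rewrite ltr_pdivlMr//; lra.
  by field; rewrite gt_eqF.
rewrite /hoelder_conjugate/= eqe gt_eqF; last by lra.
by rewrite -EFinB inver gt_eqF//= -EFinM.
Qed.

Lemma positive_isometry_contraction (R : realType) (p : R) (p1 : 1 < p)
    (A : boundedOp (Lp01 p1) (Lp01 p1)) :
  positive_isometries p1 A -> positive_contractions p1 A.
Proof. by move=> [h hA]; split=> // f; rewrite hA. Qed.

(** * Weak approximation of contractions by invertible isometries *)

Section WeakApproximation.
Context (R : realType) (p q : R) (pq : conjugates p q) (p1 : 1 < p).
Variables (Q : \bar R) (QE : Q = q%:E) (Q1 : (1 <= Q)%E).
Local Notation C := R[i].
Local Notation mu := (lebesgue01 R).
Local Notation P1 := (exponent_ge1 p1).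
Local Notation L := (cLspace mu P1).
Local Notation L' := (cLspace mu Q1).

Lemma contraction_lnrm (A : boundedOp L L) f :
  positive_contractions p1 A -> lnrm (A f) <= lnrm f.
Proof. by move=> [_ /(_ f)]; rewrite !cLspace_normE lecR. Qed.

Lemma weak_approximation (A : boundedOp L L) : positive_contractions p1 A ->
  exists U : nat -> boundedOp L L, (forall n, positive_invertible_isometries p1 (U n)) /\
  forall (f : L) (g : L'), lpair (U n f) g @[n --> \oo] --> (lpair (A f) g : C^o).
Proof.
move=> hA; pose th (n : nat) : R := 1 - n.+1%:R^-1.
have thP n : 0 <= th n < 1.
  rewrite /th subr_ge0 ltrBlDr ltrDl invr_gt0 ltr0n andbT.
  by rewrite invf_le1 ?ltr0n// ler1n.
have exU n : exists U : boundedOp L L, positive_invertible_isometries p1 U /\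
    forall i j : 'I_n, lpair (U (cls mu P1 (cell_fun n.+1 i))) (cls mu Q1 (cell_fun n.+1 j)) =
    (th n)%:C * lpair (A (cls mu P1 (cell_fun n.+1 i))) (cls mu Q1 (cell_fun n.+1 j)).
  by have [U hU UE] := contraction_coupling pq QE Q1 n hA (thP n); exists U.
have [U hU] := choice exU.
exists U; split; first by move=> n; have [] := hU n.
move=> f g; apply/cvg_normcP => e e0.
have q1 := conjugates_gt1 (conjugatesC pq).
pose F := lnrm f + 1; pose H := lnrm g + 1.
have F1 : 1 <= F by rewrite lerDr lnrm_ge0.
have H1 : 1 <= H by rewrite lerDr lnrm_ge0.
have FH0 : 0 < F * H by rewrite mulr_gt0//; lra.
(* Replacing [f], [g] by step functions costs at most [2 a F H] for [A] and again for [U n], in all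
   [e / 2]. The bound [a <= 1] keeps the norms of the step functions below [F] and [H]. *)
pose a := Num.min 1 (e / (8 * (F * H))).
have a0 : 0 < a by rewrite lt_min ltr01 divr_gt0// mulr_gt0.
have a1 : a <= 1 by rewrite ge_min lexx.
have aFH : 4 * a * (F * H) <= e / 2.
  have : a <= e / (8 * (F * H)) by rewrite ge_min lexx orbT.
  by rewrite ler_pdivlMr ?mulr_gt0//; lra.
near=> n.
have [c hc] : exists c : 'I_n -> C, lnrm (f - \sum_(i < n) c i *: cls mu P1 (cell_fun n.+1 i)) < a.
  by near: n; exact: (cLspace_step_density (erefl p%:E)).
have [b hb] : exists b : 'I_n -> C, lnrm (g - \sum_(i < n) b i *: cls mu Q1 (cell_fun n.+1 i)) < a.
  by near: n; exact: (cLspace_step_density QE).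
set s := \sum_(i < n) _ in hc; set t := \sum_(i < n) _ in hb.
have [Upos UE] := hU n.
have UC : positive_contractions p1 (U n).
  by apply: positive_isometry_contraction; have [] := Upos.
have stE : lpair (U n s) t = (th n)%:C * lpair (A s) t.
  rewrite /s /t !linear_sum.
  under eq_bigr do rewrite linearZ.
  under [X in _ = _ * lpair X _]eq_bigr do rewrite linearZ.
  rewrite !(lpair_suml pq (erefl _) QE) mulr_sumr; apply: eq_bigr => i _.
  rewrite mulrCA; congr (_ * _).
  rewrite !(lpairC _ (\sum_i _)) !(lpair_suml (conjugatesC pq) QE (erefl _)) mulr_sumr.
  by apply: eq_bigr => j _; rewrite mulrCA !(lpairC (cls mu Q1 _)) UE.
have sF : lnrm s <= F.
  rewrite (_ : s = f - (f - s)); last by rewrite opprB addrC subrK.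
  by rewrite (le_trans (lnrmB _ _))// lerD2l ltW// (lt_le_trans hc).
have tH : lnrm t <= H.
  rewrite (_ : t = g - (g - t)); last by rewrite opprB addrC subrK.
  by rewrite (le_trans (lnrmB _ _))// lerD2l ltW// (lt_le_trans hb).
have dist (W : boundedOp L L) : positive_contractions p1 W ->
    normc (lpair (W f) g - lpair (W s) t) <= 2 * a * (F * H).
  move=> hW; have := @lpair_op_dist _ _ _ mu p q pq _ _ (erefl _) QE P1 Q1 W f s g t
    (fun u v => linearB _ u v) (fun u => contraction_lnrm u hW).
  move=> /le_trans; apply.
  have h1 : lnrm (f - s) * lnrm g <= a * (F * H).
    apply: ler_pM; rewrite ?lnrm_ge0//; first exact: ltW.
    apply: (@le_trans _ _ H); first by rewrite /H; lra.
    by rewrite ler_peMl//; lra.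
  have h2 : lnrm s * lnrm (g - t) <= a * (F * H).
    rewrite mulrC; apply: ler_pM; rewrite ?lnrm_ge0//; first exact: ltW.
    by rewrite (le_trans sF)// ler_peMr//; lra.
  by rewrite -mulrA; lra.
(* On step functions [U n] agrees weakly with [th n] times [A], so the last term measures
   [1 - th n], which tends to 0. *)
have -> : lpair (A f) g - lpair (U n f) g = (lpair (A f) g - lpair (A s) t)
    - (lpair (U n f) g - lpair (U n s) t) + (1 - th n)%:C * lpair (A s) t.
  have thC : (1 - th n)%:C = 1 - (th n)%:C :> C by rewrite [LHS]rmorphB rmorph1.
  by rewrite stE thC; ring.
rewrite (le_lt_trans (le_normcD _ _))//.
have h3 : normc ((1 - th n)%:C * lpair (A s) t) < e / 2.
  rewrite normcM normc_real /th subKr ger0_norm ?invr_ge0//.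
  rewrite mulrC ltr_pdivrMr ?ltr0n//.
  apply: (@le_lt_trans _ _ (F * H)).
    rewrite (le_trans (lpair_le pq (erefl _) QE _ _))// ler_pM ?lnrm_ge0//.
    by rewrite (le_trans (contraction_lnrm _ hA)).
  have : F * H / (e / 2) < n%:R by near: n; exact: nbhs_infty_gtr.
  rewrite ltr_pdivrMr ?divr_gt0// => /lt_trans; apply.
  by rewrite mulrC ltr_pM2l ?divr_gt0// ltr_nat.
have h4 := le_normcD (lpair (A f) g - lpair (A s) t) (- (lpair (U n f) g - lpair (U n s) t)).
have h5 := dist _ hA; have h6 := dist _ UC.
by move: h4; rewrite normcN; lra.
Unshelve. all: by end_near. Qed.

End WeakApproximation.

Lemma cvg_initial_pair (S : choiceType) (T1 T2 : topologicalType)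
    (w1 : S -> T1) (w2 : S -> T2) (F : set_system S) (FF : Filter F) (x : S) :
  w1 @ F --> w1 x -> w2 @ F --> w2 x ->
  F --> (x : initial_topology (fun s => (w1 s, w2 s))).
Proof. by move=> h1 h2; apply: cvg_initial; exact: cvg_pair. Qed.

(** Pairing with the functional that norms [l] bounds the norm of [u y] from below and tends to the
    norm of [l]. *)
Lemma weak_lsc d (T : measurableType d) (R : realType)
    (mu : {measure set T -> \bar R}) (p q : R) (pq : conjugates p q)
    (P Q : \bar R) (PE : P = p%:E) (QE : Q = q%:E) (P1 : (1 <= P)%E) (Q1 : (1 <= Q)%E)
    S (G : set_system S) (FG : Filter G) (u : S -> cLspace mu P1) (l : cLspace mu P1)
    (a : R) :
  (forall g : cLspace mu Q1, lpair (u y) g @[y --> G] --> (lpair l g : (R[i])^o)) ->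
  a < lnrm l -> \forall y \near G, a < lnrm (u y).
Proof.
move=> wk al; have [g g1 gE] := norming pq PE QE Q1 l.
have /cvg_normcP/(_ (lnrm l - a)) := wk g; rewrite subr_gt0 => /(_ al).
apply: filterS => y; rewrite gE => hy.
have le_u : normc (lpair (u y) g) <= lnrm (u y).
  by rewrite (le_trans (lpair_le pq PE QE _ _))// ler_piMr ?lnrm_ge0.
have := le_normcD ((lnrm l)%:C - lpair (u y) g) (lpair (u y) g).
rewrite subrK normc_real ger0_norm ?lnrm_ge0// => h; lra.
Qed.

(** * A countable dense family and the G-delta property *)

Section RationalSteps.
Context (R : realType).
Local Notation C := R[i].
Local Notation mu := (lebesgue01 R).
Variables (P : \bar R) (P1 : (1 <= P)%E).

Definition rat_complex (r : rat * rat) : C := ratr r.1 +i* ratr r.2.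

(** The length of the list fixes the grid, so a single countable type of codes ranges over all
    grids. *)
Definition rational_step (s : seq (rat * rat)) : cLspace mu P1 :=
  \sum_(0 <= i < size s) rat_complex (nth (0, 0) s i) *: cls mu P1 (cell_fun (size s).+1 i).

Lemma rat_complex_dense (z : C) (e : R) : 0 < e ->
  exists r, normc (z - rat_complex r) < e.
Proof.
move=> e0; have approx (x : R) : exists r : rat, `|x - ratr r| < e / 2.
  have : x - e / 2 < x + e / 2 by lra.
  move=> /rat_in_itvoo[r]; rewrite in_itv/= => /andP[h1 h2]; exists r.
  by rewrite ltr_norml; apply/andP; split; lra.
have [r hr] := approx (complex.Re z); have [s hs] := approx (complex.Im z).
exists (r, s); rewrite (le_lt_trans (normc_le_ReIm _))// (splitr e).
by case: z hr hs => a b /= hr hs; exact: ltrD.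
Qed.

Lemma lnrm_sum (I : Type) (r : seq I) (F : I -> cLspace mu P1) :
  lnrm (\sum_(i <- r) F i) <= \sum_(i <- r) lnrm (F i).
Proof.
elim/big_ind2: _ => //; first by rewrite lnrm0.
by move=> f a g b fa gb; rewrite (le_trans (lnrmD _ _))// lerD.
Qed.

Lemma rational_step_dense (p : R) (f : cLspace mu P1) (e : R) : 1 < p -> P = p%:E ->
  0 < e -> exists s, lnrm (f - rational_step s) < e.
Proof.
move=> p1 PE e0; have e2 : 0 < e / 2 by rewrite divr_gt0.
have [n [c hc]] := filter_ex (cLspace_step_density PE f p1 e2).
pose N := \sum_(i < n) lnrm (cls mu P1 (cell_fun n.+1 i)).
have N0 : 0 <= N by apply: sumr_ge0 => i _; exact: lnrm_ge0.
(* Each coefficient may err by this much, since the cell functions have total norm [N]; the added 1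
   keeps the divisor positive. *)
have d0 : 0 < e / 2 / (N + 1) by rewrite divr_gt0// ltr_wpDl.
have [r hr] := choice (fun i => rat_complex_dense (c i) d0).
pose r' i := if insub i is Some j then r j else (0, 0).
exists (mkseq r' n); rewrite /rational_step size_mkseq big_mkord.
rewrite (eq_bigr (fun i : 'I_n => rat_complex (r i) *: cls mu P1 (cell_fun n.+1 i))); last first.
  by move=> i _; rewrite nth_mkseq// /r' valK.
set s := \sum_(i < n) _ in hc; set t := \sum_(i < n) _.
rewrite -[f](subrK s) -addrA (le_lt_trans (lnrmD _ _))// (splitr e) ltr_leD//.
have -> : s - t = \sum_(i < n) (c i - rat_complex (r i)) *: cls mu P1 (cell_fun n.+1 i).
  by rewrite /s /t -sumrB; apply: eq_bigr => i _; rewrite scalerBl.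
apply: (le_trans (lnrm_sum _ _)).
apply: (@le_trans _ _ (e / 2 / (N + 1) * N)).
  rewrite mulr_sumr; apply: ler_sum => i _; rewrite lnrmZ.
  by apply: ler_wpM2r; [exact: lnrm_ge0|exact: ltW].
rewrite mulrAC ler_pdivrMr ?ltr_wpDl//; apply: ler_wpM2l; first exact: ltW.
by rewrite lerDl.
Qed.

(** Each pair of a rational step [s] and an integer [k] gives the open condition that [W] loses less
    than [1 / (k + 1)] of the norm of [s]; contractivity extends norm preservation from the dense
    family. Leaving [W] abstract covers both the operator and its adjoint. *)
Lemma Gdelta_isometric (p : R) (X : topologicalType)
    (W : X -> cLspace mu P1 -> cLspace mu P1) : 1 < p -> P = p%:E ->
  (forall x f g, W x (f - g) = W x f - W x g) ->
  (forall x f, lnrm (W x f) <= lnrm f) ->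
  (forall f a, open [set x | a < lnrm (W x f)]) ->
  Gdelta [set x | forall f, lnrm (W x f) = lnrm f].
Proof.
move=> p1 PE WB W1 Wo.
pose F (m : nat) : set X := if unpickle m is Some (s, k) then
  [set x | lnrm (rational_step s) - k.+1%:R^-1 < lnrm (W x (rational_step s))] else setT.
exists F.
  move=> m; rewrite /F; case: (unpickle m : option (seq (rat * rat) * nat)) => [[s k]|].
    exact: Wo.
  exact: openT.
apply/seteqP; split=> [x hx m _|x hx f].
  rewrite /F; case: (unpickle m : option (seq (rat * rat) * nat)) => [[s k]|]//=.
  by rewrite hx ltrBlDr ltrDl invr_gt0.
apply/eqP; rewrite eq_le W1/=; apply/ler_addgt0Pr => e e0.
have e3 : 0 < e / 3 by rewrite divr_gt0.
have [s hs] := rational_step_dense f p1 PE e3.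
have [k hk] : exists k : nat, (k.+1%:R)^-1 < e / 3.
  exists (Num.truncn (e / 3)^-1); rewrite -[ltRHS]invrK ltf_pV2 ?posrE ?invr_gt0//.
  exact: truncnS_gt.
have := hx (pickle (s, k)) I; rewrite /F pickleK /= => h.
have h1 := lnrmD (f - rational_step s) (rational_step s).
have h2 := lnrmD (W x (rational_step s - f)) (W x f).
have h3 := W1 x (rational_step s - f).
rewrite subrK in h1; rewrite WB subrK -WB in h2; rewrite lnrmBC in h3.
move: h h1 h2 h3 hs hk; move: (_^-1) (lnrm _) => kk dd.
lra.
Qed.

End RationalSteps.

Lemma GdeltaI (X : topologicalType) (A B : set X) :
  Gdelta A -> Gdelta B -> Gdelta (A `&` B).
Proof.
move=> [F oF ->] [G oG ->]; exists (fun n => F n `&` G n).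
  by move=> n; exact: openI.
by rewrite bigcapI.
Qed.

(** * Operators on L^p[0,1] and the continuity points *)

Section Lp01Operators.
Context (R : realType) (p : R) (p1 : 1 < p).
Local Notation C := R[i].
Local Notation mu := (lebesgue01 R).
Local Notation L := (Lp01 p1).
Local Notation L' := (Lp01' p1).
Local Notation q := (p / (p - 1)).
Local Notation Q1 := (hoelder_conj_ge1 (exponent_ge1 p1)).
Local Notation Cp := (positive_contractions p1).
Local Notation adj A := (cLadjoint Q1 (A : L -> L) : L' -> L').
Local Notation norm f := (@lnrm _ _ _ mu p%:E (exponent_ge1 p1) f).
Local Notation norm' g := (@lnrm _ _ _ mu (hoelder_conjugate p%:E) Q1 g).
Local Notation pair f g :=
  (@lpair _ _ _ mu p%:E (hoelder_conjugate p%:E) (exponent_ge1 p1) Q1 f g).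

Let pq : conjugates p q := (conjugates_hoelder p1).1.
Let QE : hoelder_conjugate p%:E = q%:E := (conjugates_hoelder p1).2.
Let PE : p%:E = p%:E := erefl.

Lemma pair_adjoint (A : boundedOp L L) (f : L) (g : L') : pair (A f) g = pair f (adj A g).
Proof. exact: (@adjointP _ _ _ (lebesgue01_finite R) p q pq _ _ PE QE _ _ A f g). Qed.

Lemma dual_pair (phi : dual_space L) : exists g : L', forall f : L, phi f = pair f g.
Proof. exact: (@riesz_representation _ _ _ (lebesgue01_finite R) p q pq _ _ PE QE _ Q1 phi). Qed.

(** Norms on the dual side are attained in L^p: [norming] with the exponents exchanged. *)
Lemma pair_norming' (g : L') : exists2 f : L, norm f <= 1 & pair f g = (norm' g)%:C.
Proof.
have [f f1 fE] := norming (conjugatesC pq) QE PE (exponent_ge1 p1) g.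
by exists f => //; rewrite lpairC.
Qed.

Lemma normc_pair (f : L) (g : L') : normc (pair f g) <= norm f * norm' g.
Proof. exact: (lpair_le pq PE QE). Qed.

Lemma contraction_norm (A : boundedOp L L) f : Cp A -> norm (A f) <= norm f.
Proof. exact: contraction_lnrm. Qed.

Lemma adjoint_norm (A : boundedOp L L) g : Cp A -> norm' (adj A g) <= norm' g.
Proof.
move=> hA; have [f f1 fE] := pair_norming' (adj A g).
have : norm' (adj A g) = normc (pair (A f) g).
  by rewrite pair_adjoint fE normc_real ger0_norm ?lnrm_ge0.
move=> ->; rewrite (le_trans (normc_pair _ _))// ler_piMl ?lnrm_ge0//.
by rewrite (le_trans (contraction_norm _ hA)).
Qed.

Lemma isometry_norm (A : boundedOp L L) f : positive_isometries p1 A ->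
  norm (A f) = norm f.
Proof.
by move=> [_ hA]; apply: (@complexI R); rewrite -!cLspace_normE hA.
Qed.

(** Surjectivity writes the element norming [g] as [A f], with [f] still in the unit ball; this [f]
    then tests [adj A g]. *)
Lemma invertible_adjoint_norm (A : boundedOp L L) g :
  positive_invertible_isometries p1 A -> norm' (adj A g) = norm' g.
Proof.
move=> [hA sA]; apply/eqP; rewrite eq_le adjoint_norm/=; last first.
  exact: positive_isometry_contraction.
have [h h1 hE] := pair_norming' g; have [f fE] := sA h.
have : norm' g = normc (pair f (adj A g)).
  by rewrite -pair_adjoint fE hE normc_real ger0_norm ?lnrm_ge0.
move=> ->; rewrite (le_trans (normc_pair _ _))// ler_piMl ?lnrm_ge0//.
by rewrite -(isometry_norm f hA) fE.
Qed.

Lemma adjoint_isometry_surjective (A : boundedOp L L) : positive_isometries p1 A ->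
  (forall g, norm' (adj A g) = norm' g) -> positive_invertible_isometries p1 A.
Proof.
move=> hA hA'; split => // h.
have [h0|h0] := eqVneq (norm h) 0.
  by exists 0; rewrite linear0 (lnrm_eq0 h0).
pose a : C := (norm h)^-1%:C; pose k : L := a *: h.
have k1 : norm k = 1.
  by rewrite lnrmZ normc_real ger0_norm ?invr_ge0 ?lnrm_ge0// mulVf.
pose j : L' := duality_map p Q1 k.
have j1 : norm' j = 1 by rewrite (lnrm_duality_map pq PE QE) k1 one_powR.
have [f f1 fE] := pair_norming' (adj A j).
(* [A f] and [k] are both in the unit ball and both pair to 1 with [j]; strict convexity identifies
   them. *)
have Af : A f = k.
  apply: (norming_unique pq PE QE k1 (Q1 := Q1)).
    by rewrite isometry_norm.
  by rewrite pair_adjoint fE hA' j1.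
exists ((norm h)%:C *: f); rewrite linearZ/= Af /k scalerA -rmorphM mulfV//.
by rewrite rmorph1 scale1r.
Qed.

Local Notation ev y := (set_val y : boundedOp L L).

Lemma WOT_pair_continuous (f : L) (g : L') :
  continuous (fun y : topology_on Cp WOT => (pair (ev y f) g : C^o)).
Proof. exact: (@WOT_eval_continuous C L L Cp f (lpair_functional pq PE QE _ g)). Qed.

Lemma WOT_pair_cvg (G : set_system (topology_on Cp WOT)) (FG : Filter G)
    (x : topology_on Cp WOT) :
  (forall f g, pair (ev y f) g @[y --> G] --> (pair (ev x f) g : C^o)) -> G --> x.
Proof.
move=> h; apply: WOT_cvg => f phi; have [g gE] := dual_pair phi.
by rewrite gE; under eq_fun do rewrite gE; exact: h.
Qed.

Lemma SOTstar_cvg (G : set_system (topology_on Cp SOTstar)) (FG : Filter G)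
    (x : topology_on Cp SOTstar) :
  (forall f, ev y f @[y --> G] --> ev x f) ->
  (forall g, adj (ev y) g @[y --> G] --> adj (ev x) g) -> G --> x.
Proof.
move=> cv cv'; apply: cvg_topology_on.
have FG' : Filter ((set_val : topology_on Cp SOTstar -> Topological.Pack SOTstar) @ G).
  exact: fmap_filter.
apply: (@cvg_initial_pair (boundedOp L L) {ptws L -> L} {ptws L' -> L'}
  (fun A : boundedOp L L => (A : L -> L)) (fun A => adj A)).
  by apply: cvg_ptws; exact: cv.
by apply: cvg_ptws; exact: cv'.
Qed.

Lemma SOTstar_continuous : continuous (fun y : topology_on Cp SOTstar =>
  ((ev y : L -> L), (adj (ev y))) : ({ptws L -> L} * {ptws L' -> L'})%type).
Proof.
move=> x; have := @set_val_continuous _ Cp SOTstar x.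
move=> /(@continuous_comp _ _ _ _ (fun A : initial_topology (fun A : boundedOp L L =>
    ((A : L -> L), (adj A)) : ({ptws L -> L} * {ptws L' -> L'})%type) =>
    (((A : boundedOp L L) : L -> L), (adj (A : boundedOp L L)))
     : ({ptws L -> L} * {ptws L' -> L'})%type) x).
by move=> /(_ (@initial_continuous _ _ _ _)).
Qed.

Lemma SOTstar_eval_continuous (f : L) :
  continuous (fun y : topology_on Cp SOTstar => ev y f).
Proof.
move=> x; have h := @SOTstar_continuous x.
have h1 : continuous (@fst {ptws L -> L} {ptws L' -> L'}) by move=> z; exact: cvg_fst.
have h2 := continuous_comp h (h1 _).
exact: (continuous_comp h2 (@ptws_eval_continuous L L f _)).
Qed.

Lemma SOTstar_adjoint_continuous (g : L') :
  continuous (fun y : topology_on Cp SOTstar => adj (ev y) g).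
Proof.
move=> x; have h := @SOTstar_continuous x.
have h1 : continuous (@snd {ptws L -> L} {ptws L' -> L'}) by move=> z; exact: cvg_snd.
have h2 := continuous_comp h (h1 _).
exact: (continuous_comp h2 (@ptws_eval_continuous L' L' g _)).
Qed.

Let in_Cp (y : topology_on Cp WOT) : Cp (ev y).
Proof. exact: set_valP. Qed.

(** All operators considered are contractions, so the norm of [ev y f] never exceeds that of its
    weak limit, as Radon-Riesz demands. *)
Lemma isometry_WOT_cvg (x : topology_on Cp WOT) (f : L) :
  (forall f, norm (ev x f) = norm f) -> ev y f @[y --> x] --> ev x f.
Proof.
move=> hx; apply: (radon_riesz_cvg pq PE QE (Q1 := Q1)).
  exact: (@nbhs_filter (topology_on Cp WOT) x).
  by move=> y; rewrite hx contraction_norm.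
by move=> g; exact: (@WOT_pair_continuous f g x).
Qed.

(** Passing to the adjoint only moves the operator across the pairing, so WOT convergence passes to
    adjoints, unlike SOT convergence. *)
Lemma WOT_adjoint_pair_continuous (g : L') (f : L) :
  continuous (fun y : topology_on Cp WOT => (lpair (adj (ev y) g) f : C^o)).
Proof.
have -> : (fun y : topology_on Cp WOT => lpair (adj (ev y) g) f) =
    (fun y => pair (ev y f) g).
  by apply/funext => y; rewrite pair_adjoint lpairC.
exact: WOT_pair_continuous.
Qed.

Lemma adjoint_isometry_WOT_cvg (x : topology_on Cp WOT) (g : L') :
  (forall g, norm' (adj (ev x) g) = norm' g) ->
  adj (ev y) g @[y --> x] --> adj (ev x) g.
Proof.
move=> hx; apply: (radon_riesz_cvg (conjugatesC pq) QE PE (Q1 := exponent_ge1 p1)).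
  exact: (@nbhs_filter (topology_on Cp WOT) x).
  by move=> y; rewrite hx adjoint_norm.
by move=> f; exact: (@WOT_adjoint_pair_continuous g f x).
Qed.

(** A sequence suffices, since the isometry built on the [n]-th grid serves all [f] and [g] at
    once. *)
Lemma invertible_WOT_dense (x : topology_on Cp WOT) : exists u : nat -> topology_on Cp WOT,
  (forall n, positive_invertible_isometries p1 (ev (u n))) /\ u @ \oo --> x.
Proof.
have [U [hU cU]] := weak_approximation pq QE Q1 (in_Cp x).
have hC n : U n \in Cp by apply/mem_set/positive_isometry_contraction; have [] := hU n.
exists (fun n => exist _ (U n) (hC n)); split => //.
by apply: WOT_pair_cvg => f g; exact: cU.
Qed.

Lemma cvg_norm_eq S (G : set_system S) (FG : ProperFilter G) (P : \bar R) (P1 : (1 <= P)%E)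
    (u : S -> cLspace mu P1) (l : cLspace mu P1) (r : R) :
  u @ G --> l -> (forall y, lnrm (u y) = r) -> lnrm l = r.
Proof.
move=> /cvg_lnrmP cv ur; apply/eqP; rewrite eq_le; apply/andP; split;
  apply/ler_addgt0Pr => e e0; have [y hy] := filter_ex (cv e e0).
  rewrite -(ur y) -[l in leLHS](subrK (u y)) addrC (le_trans (lnrmD _ _))//.
  by rewrite lerD2l ltW.
rewrite -(ur y) -[u y](subrK l) addrC (le_trans (lnrmD _ _))//.
by rewrite lerD2l lnrmBC ltW.
Qed.

Lemma Cont_WOT_SOT : Cont p1 WOT SOT = positive_isometries p1.
Proof.
apply/seteqP; split=> A.
  move=> [x cx <-]; split; first by have [] := in_Cp x.
  move=> f; have [u [hu cu]] := invertible_WOT_dense x.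
  (* Continuity of the identity at [x] upgrades the weak limit of isometries to a strong one, and
     norms pass to strong limits. *)
  have c1 := @cvg_comp _ _ _ u (@identity_map _ Cp WOT SOT) _ _ _ cu cx.
  have cv : (fun n => ev (u n) f) @ \oo --> ev x f.
    exact: (@cvg_comp _ _ _ _ (fun y : topology_on Cp SOT => ev y f) _ _ _ c1
      (@SOT_eval_continuous C L L Cp f x)).
  rewrite !cLspace_normE; congr (_%:C); apply: (cvg_norm_eq _ cv) => n.
  by apply: isometry_norm; have [] := hu n.
move=> hA; have hC : A \in Cp by apply/mem_set/positive_isometry_contraction.
pose x : topology_on Cp WOT := exist _ A hC; exists x => //.
have FG : Filter (@identity_map _ Cp WOT SOT y @[y --> x]).
  apply: fmap_filter; exact: (@nbhs_filter (topology_on Cp WOT) x).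
apply: (SOT_cvg FG) => f.
by apply: (@isometry_WOT_cvg x) => g; exact: isometry_norm.
Qed.

Lemma Cont_WOT_SOTstar : Cont p1 WOT SOTstar = positive_invertible_isometries p1.
Proof.
apply/seteqP; split=> A.
  move=> [x cx <-]; have [u [hu cu]] := invertible_WOT_dense x.
  have c1 := @cvg_comp _ _ _ u (@identity_map _ Cp WOT SOTstar) _ _ _ cu cx.
  have cv (f : L) : (fun n => ev (u n) f) @ \oo --> ev x f.
    exact: (@cvg_comp _ _ _ _ (fun y : topology_on Cp SOTstar => ev y f) _ _ _ c1
      (@SOTstar_eval_continuous f x)).
  have cv' (g : L') : (fun n => adj (ev (u n)) g) @ \oo --> adj (ev x) g.
    exact: (@cvg_comp _ _ _ _ (fun y : topology_on Cp SOTstar => adj (ev y) g) _ _ _ c1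
      (@SOTstar_adjoint_continuous g x)).
  apply: adjoint_isometry_surjective.
    split; first by have [] := in_Cp x.
    move=> f; rewrite !cLspace_normE; congr (_%:C); apply: (cvg_norm_eq _ (cv f)) => n.
    by apply: isometry_norm; have [] := hu n.
  move=> g; apply: (cvg_norm_eq _ (cv' g)) => n; exact: invertible_adjoint_norm.
move=> hA; have hC : A \in Cp by apply/mem_set/positive_isometry_contraction; case: hA.
pose x : topology_on Cp WOT := exist _ A hC; exists x => //.
have FG : Filter (@identity_map _ Cp WOT SOTstar y @[y --> x]).
  apply: fmap_filter; exact: (@nbhs_filter (topology_on Cp WOT) x).
apply: (SOTstar_cvg FG) => [f|g].
  by apply: (@isometry_WOT_cvg x) => g; apply: isometry_norm; case: hA.
by apply: (@adjoint_isometry_WOT_cvg x) => h; exact: invertible_adjoint_norm.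
Qed.

(** The adjoint is a chosen solution, so additivity has to be derived: the difference of the two
    sides pairs to 0 with an element norming it. *)
Lemma adjointB (A : boundedOp L L) (g g' : L') : adj A (g - g') = adj A g - adj A g'.
Proof.
apply: subr0_eq; apply: lnrm_eq0.
have [f _ ] := pair_norming' (adj A (g - g') - (adj A g - adj A g')).
rewrite !(lpairBr pq PE QE) -!pair_adjoint (lpairBr pq PE QE) subrr.
by move=> /(congr1 (@complex.Re R))/= <-.
Qed.

Lemma Gdelta_isometries : Gdelta (set_val @^-1` positive_isometries p1 : set (topology_on Cp WOT)).
Proof.
have : Gdelta [set y : topology_on Cp WOT | forall f : L, norm (ev y f) = norm f].
  apply: (Gdelta_isometric (p := p) (W := fun y : topology_on Cp WOT => (ev y : L -> L))) => //.
  - by move=> y f g; rewrite linearB.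
  - by move=> y f; exact: contraction_norm.
  move=> f a; rewrite openE => y /= hy.
  have FG : Filter (nbhs y) := @nbhs_filter (topology_on Cp WOT) y.
  exact: (weak_lsc pq PE QE FG (fun g : L' => @WOT_pair_continuous f g y) hy).
congr Gdelta; apply/seteqP; split=> y hy; last by move=> f; exact: isometry_norm.
split; first by have [] := in_Cp y.
by move=> f; rewrite !cLspace_normE hy.
Qed.

Lemma Gdelta_adjoint_isometries :
  Gdelta [set y : topology_on Cp WOT | forall g : L', norm' (adj (ev y) g) = norm' g].
Proof.
apply: (Gdelta_isometric (p := q) (W := fun y : topology_on Cp WOT => adj (ev y))) => //.
- exact: conjugates_gt1 (conjugatesC pq).
- by move=> y f g; exact: adjointB.
- by move=> y f; exact: adjoint_norm.
move=> g a; rewrite openE => y /= hy.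
have FG : Filter (nbhs y) := @nbhs_filter (topology_on Cp WOT) y.
exact: (weak_lsc (conjugatesC pq) QE PE FG
  (fun f : L => @WOT_adjoint_pair_continuous g f y) hy).
Qed.

Lemma Gdelta_invertible_isometries :
  Gdelta (set_val @^-1` positive_invertible_isometries p1 : set (topology_on Cp WOT)).
Proof.
have := GdeltaI Gdelta_isometries Gdelta_adjoint_isometries.
congr Gdelta; apply/seteqP; split=> y.
  by move=> [h1 h2]; exact: adjoint_isometry_surjective.
by move=> hy; split; [case: hy|move=> g; exact: invertible_adjoint_norm].
Qed.

Lemma dense_invertible_isometries :
  dense (set_val @^-1` positive_invertible_isometries p1 : set (topology_on Cp WOT)).
Proof.
move=> O [x Ox] oO; have [u [hu cu]] := invertible_WOT_dense x.
have : \forall n \near \oo, O (u n) by apply: cu; exact: open_nbhs_nbhs.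
by move=> /filter_ex[n hn]; exists (u n); split => //; exact: hu.
Qed.

End Lp01Operators.

Theorem theorem8p4 (R : realType) (p : R) (p1 : 1 < p) :
  [/\ Cont p1 WOT SOT = positive_isometries p1,
      Cont p1 WOT SOTstar = positive_invertible_isometries p1,
      dense_Gdelta_in (positive_contractions p1) WOT (positive_isometries p1)
    & dense_Gdelta_in (positive_contractions p1) WOT
        (positive_invertible_isometries p1)].
Proof.
split.
- exact: Cont_WOT_SOT.
- exact: Cont_WOT_SOTstar.
- split; last exact: Gdelta_isometries.
  move=> O O0 oO; have [x [Ox [ix _]]] := dense_invertible_isometries O0 oO.
  by exists x.
- by split; [exact: dense_invertible_isometries|exact: Gdelta_invertible_isometries].
Qed.
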